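(* For each $\omega<-\lambda_0(\Omega)$ let $\phi_{\Omega,\omega}\in\mathcal{A}_{\Omega,\omega}$ be an arbitrary action ground state, and let $\hat\phi_{\Omega,\omega}=\phi_{\Omega,\omega}/\|\phi_{\Omega,\omega}\|_{L^2}$. Then $$\lim_{\omega\to-\lambda_0(\Omega)^-}d(\hat\phi_{\Omega,\omega},E_0)=0,\qquad\text{where } d(\hat\phi_{\Omega,\omega},E_0)=\inf_{\phi\in E_0}\|\hat\phi_{\Omega,\omega}-\phi\|_X.$$
   Context: Let $d\ge 2$, let $1<p<\infty$ if $d=2$ and $1<p<\frac{d+2}{d-2}$ if $d\ge 3$. Let $V:\mathbb{R}^d\to\mathbb{R}$ satisfy $V\ge 0$ and $\lim_{|\mathbf{x}|\to\infty}V(\mathbf{x})=\infty$. Let $\Omega_{\max}:=\sup\{\gamma\ge 0:\lim_{|\mathbf{x}|\to\infty}(V(\mathbf{x})-\frac{\gamma^2}{2}(x_1^2+x_2^2))=\infty\}$, assume $\Omega_{\max}>0$, and fix $0<\Omega<\Omega_{\max}$. Let $L_z=i(x_2\partial_{x_1}-x_1\partial_{x_2})$. Let $X$ be the space of complex-valued $\phi\in H^1(\mathbb{R}^d)$ with $\int_{\mathbb{R}^d}V|\phi|^2\,d\mathbf{x}<\infty$, with norm $\|\phi\|_X^2=\int_{\mathbb{R}^d}\big(|\nabla\phi|^2+(1+V)|\phi|^2\big)d\mathbf{x}$. For $\phi\in X$ the quantity $\int_{\mathbb{R}^d}\overline{\phi}L_z\phi\,d\mathbf{x}$ is well defined and real.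 Define the action $S_{\Omega,\omega}(\phi)=\frac12\|\nabla\phi\|_{L^2}^2+\int_{\mathbb{R}^d}V|\phi|^2\,d\mathbf{x}+\frac{2}{p+1}\|\phi\|_{L^{p+1}}^{p+1}-\Omega\int_{\mathbb{R}^d}\overline{\phi}L_z\phi\,d\mathbf{x}+\omega\|\phi\|_{L^2}^2$. Let $R=-\frac12\Delta+V-\Omega L_z$ be the linear Schr\''odinger operator with rotation; it is self-adjoint on $L^2(\mathbb{R}^d)$ (form domain $X$) with purely discrete spectrum, its smallest eigenvalue is $\lambda_0(\Omega)=\inf_{0\ne\phi\in X}\frac{\int_{\mathbb{R}^d}(\frac12|\nabla\phi|^2+V|\phi|^2-\Omega\overline{\phi}L_z\phi)d\mathbf{x}}{\|\phi\|_{L^2}^2}$, and $E_0\subset X$ denotes the eigenspace of $R$ associated with $\lambda_0(\Omega)$. For $\omega<-\lambda_0(\Omega)$, the set of action ground states is $\mathcal{A}_{\Omega,\omega}:=\arg\min_{\phi\in X}S_{\Omega,\omega}(\phi)$, which is known to be nonempty with $\min_X S_{\Omega,\omega}<0$ (in particular its elements are nonzero). *)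

(* Defs.v *)
From HB Require Import structures.
From mathcomp Require Import all_boot all_order all_algebra.
From mathcomp Require Import all_classical all_reals all_analysis.
From mathcomp Require Import complex.
Set Implicit Arguments.
Unset Strict Implicit.
Unset Printing Implicit Defensive.
Import Order.TTheory GRing.Theory Num.Theory.
Import numFieldNormedType.Exports.
Local Open Scope classical_set_scope.
Local Open Scope ring_scope.

Definition rV_display : measure_display.
Proof. exact: default_measure_display. Qed.

Section rV_measurable.
Context {R : realType}.
Variable n : nat.

Let coord : 'I_n -> 'rV[R]_n -> measurableTypeR R := fun i x => x 0 i.

Let rV_set0 : g_sigma_preimage coord set0.
Proof. exact: sigma_algebra0. Qed.

Let rV_setC A : g_sigma_preimage coord A -> g_sigma_preimage coord (~` A).
Proof. exact: sigma_algebraC. Qed.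

Let rV_bigcup (F : _^nat) : (forall i, g_sigma_preimage coord (F i)) ->
  g_sigma_preimage coord (\bigcup_i (F i)).
Proof. exact: sigma_algebra_bigcup. Qed.

(* Coordinate sigma-algebra, i.e. the Borel sigma-algebra of R^n. *)
HB.instance Definition _ := @isMeasurable.Build rV_display
  'rV[R]_n (g_sigma_preimage coord) rV_set0 rV_setC rV_bigcup.

End rV_measurable.

Section lebesgue_rV.
Context {R : realType}.

Lemma measurable_coord n (i : 'I_n) :
  measurable_fun [set: 'rV[R]_n] (fun x => x 0 i : measurableTypeR R).
Proof.
move=> _ Y mY; rewrite setTI; apply: sub_sigma_algebra => /=.
rewrite -bigcup_seq/=; exists i => /=; first by rewrite mem_index_enum.
by exists Y => //; rewrite setTI.
Qed.

Lemma measurable_fun_rVP d (T : measurableType d) n (f : T -> 'rV[R]_n) :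
  (forall i, measurable_fun setT (fun x => f x 0 i : measurableTypeR R)) ->
  measurable_fun setT f.
Proof.
move=> mf; have H : g_sigma_preimage
    (fun i (x : 'rV[R]_n) => x 0 i : measurableTypeR R)
    `<=` image_set_system setT f measurable.
  apply: smallest_sub.
    exact/sigma_algebra_image/sigma_algebra_measurable.
  move=> A; rewrite -bigcup_seq /= => -[i _ [B mB <-]].
  by rewrite /image_set_system /= !setTI; have := mf i measurableT B mB;
    rewrite setTI.
by move=> _ A mA; exact: H.
Qed.

Definition rV_cons n (tx : measurableTypeR R * 'rV[R]_n) : 'rV[R]_n.+1 :=
  row_mx (const_mx tx.1 : 'rV_1) tx.2.

Lemma rV_cons0 n t (x : 'rV[R]_n) : rV_cons (t, x) 0 ord0 = t.
Proof. by rewrite mxE; case: splitP => // j _; rewrite mxE. Qed.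

Lemma rV_consS n t (x : 'rV[R]_n) i : rV_cons (t, x) 0 (lift ord0 i) = x 0 i.
Proof.
have -> : lift ord0 i = rshift 1 i by apply/val_inj.
exact: (@row_mxEr _ 1 1 n (const_mx t) x 0 i).
Qed.

Definition rV_uncons n (x : 'rV[R]_n.+1) : measurableTypeR R * 'rV[R]_n :=
  (x 0 ord0, rsubmx (x : 'rV_(1 + n))).

Lemma rV_consK n : cancel (@rV_cons n) (@rV_uncons n).
Proof. by move=> [t x]; rewrite /rV_uncons rV_cons0 row_mxKr. Qed.

Lemma measurable_rV_cons n : measurable_fun setT (@rV_cons n).
Proof.
apply: measurable_fun_rVP => i; case: (unliftP ord0 i) => [j|] ->.
  rewrite (_ : (fun _ => _) = (fun x : 'rV[R]_n => x 0 j) \o snd).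
    exact: measurableT_comp (@measurable_coord n j) measurable_snd.
  by apply/funext => -[t x]; rewrite rV_consS.
rewrite (_ : (fun _ => _) = fst); first exact: measurable_fst.
by apply/funext => -[t x]; rewrite rV_cons0.
Qed.

Lemma measurable_rV_uncons n : measurable_fun setT (@rV_uncons n).
Proof.
apply/measurable_fun_pairP; split; first exact: measurable_coord.
apply: measurable_fun_rVP => i; rewrite /=.
rewrite (_ : (fun _ => _) = fun x : 'rV[R]_n.+1 => x 0 (rshift 1 i)).
  exact: measurable_coord.
by apply/funext => x; rewrite mxE.
Qed.

Section step.
Variables (n : nat) (m : {sigma_finite_measure set 'rV[R]_n -> \bar R}).


Definition lebesgue_step : set 'rV[R]_n.+1 -> \bar R :=
  pushforward (@lebesgue_measure R \x m)%E (@rV_cons n).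

Let lebesgue_step0 : lebesgue_step set0 = 0%E.
Proof. by rewrite /lebesgue_step /pushforward preimage_set0 measure0. Qed.

Let lebesgue_step_ge0 A : (0 <= lebesgue_step A)%E.
Proof. by rewrite /lebesgue_step /pushforward; exact: measure_ge0. Qed.

Let lebesgue_step_sigma_additive : semi_sigma_additive lebesgue_step.
Proof.
move=> F mF tF mUF; rewrite /lebesgue_step /pushforward preimage_bigcup.
have mP A : measurable A -> measurable (@rV_cons n @^-1` A).
  by move=> mA; rewrite -[X in measurable X]setTI; exact: measurable_rV_cons.
apply: measure_semi_sigma_additive => [k|| ]; first exact: mP.
- apply/trivIsetP => /= i j _ _ ij; rewrite -preimage_setI.
  by move/trivIsetP : tF => /(_ _ _ _ _ ij) ->//; rewrite preimage_set0.
- by rewrite -preimage_bigcup; exact: mP.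
Qed.

HB.instance Definition _ := isMeasure.Build _ _ _ lebesgue_step
  lebesgue_step0 lebesgue_step_ge0 lebesgue_step_sigma_additive.

Let lebesgue_step_sigma_finite : sigma_finite setT lebesgue_step.
Proof.
have /sigma_finiteP[F [FT ndF Foo]] := sigma_finiteT (@lebesgue_measure R).
have /sigma_finiteP[G [GT ndG Goo]] := sigma_finiteT m.
exists (fun k => @rV_uncons n @^-1` (F k `*` G k)).
  rewrite -preimage_bigcup (_ : \bigcup_k _ = setT) ?preimage_setT//.
  rewrite -subTset => -[x y] _.
  have [i _ Fx] : (\bigcup_k F k) x by rewrite -FT.
  have [j _ Gy] : (\bigcup_k G k) y by rewrite -GT.
  exists (maxn i j) => //; split.
    by move: x Fx; exact/subsetPset/ndF/leq_maxl.
  by move: y Gy; exact/subsetPset/ndG/leq_maxr.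
move=> k; have [mF Fk] := Foo k; have [mG Gk] := Goo k; split.
  rewrite -[X in measurable X]setTI; apply: measurable_rV_uncons => //.
  exact: measurableX.
rewrite /lebesgue_step /pushforward -comp_preimage.
rewrite (_ : _ \o _ = id); last by apply/funext => x /=; rewrite rV_consK.
by rewrite preimage_id product_measure1E// lte_mul_pinfty// ge0_fin_numE.
Qed.

HB.instance Definition _ := Measure_isSigmaFinite.Build _ _ _ lebesgue_step
  lebesgue_step_sigma_finite.

End step.

Fixpoint lebesgue_rV n : {sigma_finite_measure set 'rV[R]_n -> \bar R} :=
  if n is n'.+1 then lebesgue_step (lebesgue_rV n') else \d_(0 : 'rV[R]_0).

(* The normalisation that characterises Lebesgue measure. *)
Lemma lebesgue_rV_box n (A : 'I_n -> set R) :
  (forall i, measurable (A i : set (measurableTypeR R))) ->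
  lebesgue_rV n [set x | forall i, A i (x 0 i)] =
  (\prod_(i < n) lebesgue_measure (A i))%E.
Proof.
elim: n => [|n IH] in A * => mA.
  rewrite big_ord0 /= diracE mem_set// => -[]//.
rewrite big_ord_recl -IH//.
transitivity ((@lebesgue_measure R \x lebesgue_rV n)%E
    (A ord0 `*` [set x : 'rV[R]_n | forall i, A (lift ord0 i) (x 0 i)])).
  congr product_measure1; apply/seteqP; split => -[t x] /=.
    move=> H; split => [|i]; first by have := H ord0; rewrite rV_cons0.
    by have := H (lift ord0 i); rewrite rV_consS.
  by move=> [At Ax] i; case: (unliftP ord0 i) => [j|] ->;
    rewrite ?rV_cons0 ?rV_consS.
rewrite product_measure1E//.
rewrite (_ : mkset _ = \bigcap_(i in setT)
  ((fun x : 'rV[R]_n => x 0 i : measurableTypeR R) @^-1` A (lift ord0 i))).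
  apply: fin_bigcap_measurable => // i _.
  by rewrite -[X in measurable X]setTI; exact: measurable_coord.
by apply/seteqP; split => x /= => [H i _|H i]; exact: H.
Qed.

End lebesgue_rV.

Import Normc.
Local Open Scope complex_scope.

Section functions.
Context {R : realType} {d : nat}.
Local Notation mu := (@lebesgue_rV R d).
Implicit Types (u v g : 'rV[R]_d -> R[i]) (f : 'rV[R]_d -> R).

(* [`|x|] is the sup norm, which is equivalent to the Euclidean one. *)
Definition tends_to_pinfty f :=
  forall M : R, exists r : R, forall x, r < `|x| -> M < f x.

Definition Cmeasurable u :=
  measurable_fun setT (fun x => complex.Re (u x)) /\
  measurable_fun setT (fun x => complex.Im (u x)).

Definition Cintegral u : R[i] :=
  (\int[mu]_x complex.Re (u x)) +i* (\int[mu]_x complex.Im (u x)).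

Definition L2 : set ('rV[R]_d -> R[i]) :=
  [set u | Cmeasurable u /\ (\int[mu]_x (normc (u x) ^+ 2)%:E < +oo)%E].

Definition L2norm u : R := Num.sqrt (\int[mu]_x (normc (u x) ^+ 2)).

Definition partial (i : 'I_d) f : 'rV[R]_d -> R :=
  fun x => 'D_(delta_mx 0 i) f x.

Definition smooth f := forall s : seq 'I_d,
  continuous (foldr partial f s) /\
  forall i x, derivable (foldr partial f s) x (delta_mx 0 i).

Definition test_function f := smooth f /\ compact (closure [set x | f x != 0]).

Definition is_weak_partial (i : 'I_d) u g :=
  forall eta, test_function eta ->
    Cintegral (fun x => (partial i eta x)%:C * u x) =
    - Cintegral (fun x => (eta x)%:C * g x).

Definition H1 : set ('rV[R]_d -> R[i]) :=
  [set u | L2 u /\ forall i, exists2 g, L2 g & is_weak_partial i u g].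

(* A representative of the weak derivative (unique up to a null set). *)
Definition wpartial (i : 'I_d) u : 'rV[R]_d -> R[i] :=
  xget (fun=> 0) [set g | L2 g /\ is_weak_partial i u g].

Definition gradsq u x : R := \sum_(i < d) normc (wpartial i u x) ^+ 2.

Definition Xspace (V : 'rV[R]_d -> R) : set ('rV[R]_d -> R[i]) :=
  [set u | H1 u /\ (\int[mu]_x (V x * normc (u x) ^+ 2)%:E < +oo)%E].

Definition Xnorm (V : 'rV[R]_d -> R) u : R :=
  Num.sqrt (\int[mu]_x (gradsq u x + (1 + V x) * normc (u x) ^+ 2)).

End functions.

Section rotation.
Context {R : realType} {d : nat}.
Variables (hd : (2 <= d)%N) (V : 'rV[R]_d -> R).
Local Notation mu := (@lebesgue_rV R d).
Implicit Types (u v g : 'rV[R]_d -> R[i]) (Omega omega p : R).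

Definition axis1 : 'I_d := Ordinal (ltnW hd).
Definition axis2 : 'I_d := Ordinal hd.

Definition Omega_max : \bar R :=
  ereal_sup [set gamma%:E | gamma in [set gamma : R | 0 <= gamma /\
    tends_to_pinfty (fun x : 'rV[R]_d =>
      V x - gamma ^+ 2 / 2 * (x 0 axis1 ^+ 2 + x 0 axis2 ^+ 2))]].

Definition Lz u : 'rV[R]_d -> R[i] := fun x =>
  'i%C * ((x 0 axis2)%:C * wpartial axis1 u x
          - (x 0 axis1)%:C * wpartial axis2 u x).

(* The integral is real for [u] in [Xspace V]. *)
Definition angular_momentum u : R :=
  complex.Re (Cintegral (fun x => conjc (u x) * Lz u x)).

(* The power term is kept extended-real; it is finite on [Xspace V] for
   subcritical [p]. *)
Definition action Omega omega p u : \bar R :=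
  ((2^-1 * \int[mu]_x gradsq u x + \int[mu]_x (V x * normc (u x) ^+ 2))%:E
   + (2 / (p + 1))%:E * \int[mu]_x (normc (u x) `^ (p + 1))%:E
   - (Omega * angular_momentum u)%:E
   + (omega * L2norm u ^+ 2)%:E)%E.

Definition action_ground_states Omega omega p : set ('rV[R]_d -> R[i]) :=
  [set u | Xspace V u /\
    forall v, Xspace V v -> (action Omega omega p u <= action Omega omega p v)%E].

(* Quadratic form of R = - Delta / 2 + V - Omega L_z. *)
Definition energy Omega u : R :=
  2^-1 * \int[mu]_x gradsq u x + \int[mu]_x (V x * normc (u x) ^+ 2)
  - Omega * angular_momentum u.

(* [L2norm u != 0] says that [u] is not a.e. zero. *)
Definition lambda0 Omega : R :=
  inf [set energy Omega u / L2norm u ^+ 2 | u in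
    [set u | Xspace V u /\ L2norm u != 0]].

(* Sesquilinear form of R, linear in [u]. *)
Definition rot_form Omega u v : R[i] :=
  Cintegral (fun x =>
    2^-1 * \sum_(i < d) conjc (wpartial i v x) * wpartial i u x
    + (V x)%:C * (conjc (v x) * u x) - Omega%:C * (conjc (v x) * Lz u x)).

(* Graph of the operator R associated with the form [rot_form] on [Xspace V]:
   [u] is in its domain and [R u = g]. *)
Definition rot_operator Omega u g :=
  [/\ Xspace V u, L2 g & forall v, Xspace V v ->
    rot_form Omega u v = Cintegral (fun x => conjc (v x) * g x)].

Definition E0 Omega : set ('rV[R]_d -> R[i]) :=
  [set u | rot_operator Omega u (fun x => (lambda0 Omega)%:C * u x)].

Definition dist_E0 Omega u : R :=
  inf [set Xnorm V (fun x => u x - v x) | v in E0 Omega].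

End rotation.

Definition normalize {R : realType} {d : nat} (u : 'rV[R]_d -> R[i]) :
  'rV[R]_d -> R[i] := fun x => ((L2norm u)^-1)%:C * u x.

(* Main.v *)
Require Import Defs.
From HB Require Import structures.
From mathcomp Require Import all_boot all_order all_algebra.
From mathcomp Require Import all_classical all_reals all_analysis.
From mathcomp Require Import complex.
From mathcomp Require Import measurable_realfun zify ring lra.
Import Order.TTheory GRing.Theory Num.Theory.
Import numFieldNormedType.Exports.
Local Open Scope classical_set_scope.
Local Open Scope ring_scope.
Set Implicit Arguments.
Unset Strict Implicit.
Unset Printing Implicit Defensive.

(** Comparing a ground state phi with the zero function gives S(phi) <= S(0) = 0.
    The power term of the action is nonnegative, so the normalised ground state
    u satisfies <R u, u> <= - omega: the nonnegative form
    Q(u) = <R u, u> - lambda0 |u|^2 tends to 0 as omega tends to - lambda0 from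
    the left. What remains concerns the linear operator alone: a unit vector
    with small Q is close, in the norm of X, to the eigenspace of lambda0
    ([near_minimizer_near_E0]).

    This is a matter of compactness. For a gam strictly between Omega and
    Omega_max, V dominates gam^2 (x_1^2 + x_2^2) / 2 up to a constant, so the
    rotation term is at most the fraction Omega / gam of the positive part of
    the energy plus a multiple of the mass ([rform_bound], [eform_bounds]). A
    Poincare inequality on the cells of a subdivided cube, together with the
    growth of V outside the cube, then bounds the squared X norm by Q(u) plus
    finitely many squared coefficients <u, w_k>^2, up to a constant factor
    ([finite_rank]). Along unit vectors with Q tending to 0 these coefficients
    cluster; since Q is nonnegative it obeys the parallelogram inequality, and
    a well chosen sequence of these vectors is Cauchy in X. By completeness
    ([jet_complete]) it has a limit, where Q vanishes; a zero of a nonnegative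
    hermitian form lies in its kernel, so the limit belongs to the eigenspace
    ([E0_intro]).

    That the form of R is hermitian rests on an integration by parts between two
    H^1 functions with a linear weight ([weighted_skew]). It is obtained without
    density of smooth functions, one variable at a time: weak derivatives in
    x_i are tested on functions rho(x_i) times the indicator of a box in the
    other variables, and a defect of skew-symmetry would be a square integrable
    solution of dy/dx_i = y or - y, of which there is none ([deficiency0],
    [slab_weak_skew]).

    Everything is written for the real and imaginary parts of a function and of
    its weak derivatives, collected in a jet. *)

(** * Square integrable real functions *)

(** The discriminant of a nonnegative quadratic polynomial. With e = 0 it
    forces b = 0, which is how minimality turns into orthogonality. *)
Lemma quad_disc (R : realType) (e b c : R) :
  (forall t, 0 <= e + 2 * t * b + t ^+ 2 * c) -> b ^+ 2 <= e * c.
Proof.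
move=> H; have e0 : 0 <= e by have := H 0; nra.
have c0 : 0 <= c.
  rewrite leNgt; apply/negP => c0.
  have [b0|b0] := leP 0 b.
    (* If c < 0, a large t whose sign is opposite to that of b contradicts the
        hypothesis. *)
    have := H (- ((e + 1) / - c + 1)); set s := (e + 1) / - c.
    have s0 : 0 <= s by rewrite divr_ge0//; lra.
    have : s * (- c) = e + 1 by rewrite mulfVK// oppr_eq0 lt_eqF.
    nra.
  have := H ((e + 1) / - c + 1); set s := (e + 1) / - c.
  have s0 : 0 <= s by rewrite divr_ge0//; lra.
  have : s * (- c) = e + 1 by rewrite mulfVK// oppr_eq0 lt_eqF.
  nra.
have [c00|c1] := eqVneq c 0.
  have [->|b0] := eqVneq b 0; first by rewrite c00; lra.
  have := H (- (e + 1) / (2 * b)); rewrite c00 !mulr0 addr0.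
  by rewrite (_ : 2 * _ * b = - (e + 1)); [lra|field].
have := H (- b / c); rewrite (_ : _ + _ = (e * c - b ^+ 2) / c); last by field.
by rewrite pmulr_lge0 ?subr_ge0// invr_gt0 lt0r c1.
Qed.

Lemma lim_sqr (R : realType) (u v : R^nat) (l c : R) :
  (forall n, (u n - l) ^+ 2 <= v n * c) -> v n @[n --> \oo] --> (0 : R) ->
  u n @[n --> \oo] --> l.
Proof.
move=> H vl; apply/cvgrPdist_lt => /= e e0.
have : v n * c @[n --> \oo] --> 0 * c by apply: cvgM => //; exact: cvg_cst.
rewrite mul0r => /cvgrPdist_lt/(_ _ (exprn_gt0 2 e0)); apply: filterS => n.
rewrite sub0r normrN => /(le_lt_trans (ler_norm _))/(le_lt_trans (H n)).
by rewrite -[_ ^+ 2]real_normK ?num_real// ltr_pXn2r ?nnegrE ?(ltW e0)// distrC.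
Qed.

Section L2.
Context d (T : measurableType d) (R : realType) (mu : {measure set T -> \bar R}).
Implicit Types f g h : T -> R.

Definition integ f := mu.-integrable setT (EFin \o f).

Definition sqint f := measurable_fun setT f /\ integ (fun x => f x ^+ 2).

Definition ip f g : R := \int[mu]_x (f x * g x).

Lemma integ_meas f : integ f -> measurable_fun setT f.
Proof. by move=> /measurable_int/measurable_EFinP. Qed.

Lemma integD f g : integ f -> integ g -> integ (fun x => f x + g x).
Proof. by move=> F G; have := integrableD measurableT F G. Qed.

Lemma integB f g : integ f -> integ g -> integ (fun x => f x - g x).
Proof. by move=> F G; have := integrableB measurableT F G. Qed.

Lemma integZ r f : integ f -> integ (fun x => r * f x).
Proof. by move=> F; have := integrableZl measurableT r F. Qed.

Lemma integ_sum I (s : seq I) (F : I -> T -> R) : (forall i, integ (F i)) ->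
  integ (fun x => \sum_(i <- s) F i x).
Proof.
move=> H; elim: s => [|i s IH].
  have -> : (fun x : T => \sum_(i <- [::]) F i x) = cst 0.
    by apply/funext => x; rewrite big_nil.
  exact: (integrable0 mu setT).
under [X in integ X]funext do rewrite big_cons.
exact: integD.
Qed.

Lemma le_integ f g : measurable_fun setT f -> (forall x, `|f x| <= g x) ->
  integ g -> integ f.
Proof.
move=> mf fg; apply: le_integrable => //; first exact/measurable_EFinP.
by move=> x _ /=; rewrite lee_fin (le_trans (fg x))// ler_norm.
Qed.

Lemma Rint_sum I (s : seq I) (F : I -> T -> R) : (forall i, integ (F i)) ->
  \int[mu]_x (\sum_(i <- s) F i x) = \sum_(i <- s) \int[mu]_x F i x.
Proof.
move=> H; elim: s => [|i s IH].
  rewrite big_nil; under eq_Rintegral do rewrite big_nil.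
  by rewrite Rintegral_cst// mul0r.
rewrite big_cons -IH -RintegralD//; [|exact: H|exact: integ_sum].
by apply: eq_Rintegral => x _; rewrite big_cons.
Qed.

Lemma Rint_indic A f : \int[mu]_(x in A) f x = \int[mu]_x (\1_A x * f x).
Proof.
rewrite Rintegral_mkcond; apply: eq_Rintegral => x _.
by rewrite patchE indicE; case: ifPn; rewrite ?mul1r ?mul0r.
Qed.

Lemma ae_Rint f g : measurable_fun setT f -> measurable_fun setT g ->
  {ae mu, forall x, f x = g x} -> \int[mu]_x f x = \int[mu]_x g x.
Proof.
move=> mf mg fg; rewrite /Rintegral; congr fine; apply: ae_eq_integral => //.
- exact/measurable_EFinP.
- exact/measurable_EFinP.
- by apply: filterS fg => x -> _.
Qed.

Lemma ae_integ f g : measurable_fun setT g ->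
  {ae mu, forall x, f x = g x} -> integ f -> integ g.
Proof.
move=> mg fg fi; apply/integrableP; split; first exact/measurable_EFinP.
have/integrableP[mf] := fi; congr (_ < _)%E; apply: ae_eq_integral => //.
- exact: measurableT_comp.
- by apply: measurableT_comp => //; exact/measurable_EFinP.
- by apply: filterS fg => x fx _; rewrite /= fx.
Qed.

Lemma sqint_mul f g : sqint f -> sqint g -> integ (fun x => f x * g x).
Proof.
move=> [mf f2] [mg g2].
apply: (@le_integ _ (fun x => f x ^+ 2 + g x ^+ 2)).
- exact: measurable_funM.
- move=> x; rewrite normrM -[f x ^+ 2]real_normK ?num_real//.
  rewrite -[g x ^+ 2]real_normK ?num_real//.
  have := normr_ge0 (f x); have := normr_ge0 (g x); nra.
- exact: integD.
Qed.

Lemma sqint_ext f g : (forall x, f x = g x) -> sqint f -> sqint g.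
Proof. by move=> /funext ->. Qed.

Lemma sqint_le f g : measurable_fun setT f -> (forall x, `|f x| <= `|g x|) ->
  sqint g -> sqint f.
Proof.
move=> mf fg [mg g2]; split => //; apply: le_integ g2.
  exact: measurable_funX.
move=> x; rewrite normrX -[g x ^+ 2]real_normK ?num_real//.
by rewrite lerXn2r ?nnegrE.
Qed.

Lemma sqintZ r f : sqint f -> sqint (fun x => r * f x).
Proof.
move=> [mf f2]; split; first exact: measurable_funM.
by under [X in integ X]funext do rewrite exprMn; exact: integZ.
Qed.

Lemma sqintD f g : sqint f -> sqint g -> sqint (fun x => f x + g x).
Proof.
move=> [mf f2] [mg g2]; split; first exact: measurable_funD.
under [X in integ X]funext do rewrite sqrrD.
apply: integD => //; apply: integD => //.
under [X in integ X]funext do rewrite -mulr_natl.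
exact/integZ/sqint_mul.
Qed.

Lemma sqintN f : sqint f -> sqint (fun x => - f x).
Proof. by move/(sqintZ (- 1)); apply: sqint_ext => x; rewrite mulN1r. Qed.

Lemma sqintB f g : sqint f -> sqint g -> sqint (fun x => f x - g x).
Proof. by move=> F G; exact/sqintD/sqintN. Qed.

Lemma sqint0 : sqint (fun=> 0).
Proof.
split => //; rewrite /integ (_ : EFin \o _ = cst 0%E); first exact: integrable0.
by apply/funext => x /=; rewrite expr0n.
Qed.

Lemma sqintM (m : T -> R) (C : R) f : measurable_fun setT m -> (forall x, `|m x| <= C) ->
  sqint f -> sqint (fun x => m x * f x).
Proof.
move=> mm mC sf; have [mf _] := sf.
apply: (@sqint_le _ (fun x => C * f x)); last exact: sqintZ.
  exact: measurable_funM.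
by move=> x; rewrite !normrM ler_wpM2r// (le_trans (mC x))// ler_norm.
Qed.

Lemma sqint_ind f A : measurable A -> sqint f -> sqint (fun x => \1_A x * f x).
Proof.
move=> mA; apply: (@sqintM _ 1); first exact: measurable_indic.
by move=> x; rewrite indicE; case: (_ \in _); rewrite ?normr0 ?normr1.
Qed.

Lemma ipC f g : ip f g = ip g f.
Proof. by apply: eq_Rintegral => x _; rewrite mulrC. Qed.

Lemma ipDl f g h : sqint f -> sqint g -> sqint h ->
  ip (fun x => f x + g x) h = ip f h + ip g h.
Proof.
move=> F G H; rewrite /ip -RintegralD//; [|exact: sqint_mul..].
by apply: eq_Rintegral => x _; rewrite mulrDl.
Qed.

Lemma ipZl r f h : sqint f -> sqint h -> ip (fun x => r * f x) h = r * ip f h.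
Proof.
move=> F H; rewrite /ip -RintegralZl//; last exact: sqint_mul.
by apply: eq_Rintegral => x _; rewrite mulrA.
Qed.

Lemma ipNl f h : sqint f -> sqint h -> ip (fun x => - f x) h = - ip f h.
Proof.
move=> F H; rewrite -mulN1r -ipZl//.
by apply: eq_Rintegral => x _; rewrite mulN1r.
Qed.

Lemma ipBl f g h : sqint f -> sqint g -> sqint h ->
  ip (fun x => f x - g x) h = ip f h - ip g h.
Proof. by move=> F G H; rewrite ipDl// ?ipNl//; exact: sqintN. Qed.

Lemma ipDr f g h : sqint f -> sqint g -> sqint h ->
  ip h (fun x => f x + g x) = ip h f + ip h g.
Proof. by move=> F G H; rewrite ipC ipDl// !(ipC h). Qed.

Lemma ipZr r f h : sqint f -> sqint h -> ip h (fun x => r * f x) = r * ip h f.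
Proof. by move=> F H; rewrite ipC ipZl// (ipC h). Qed.

Lemma ipBr f g h : sqint f -> sqint g -> sqint h ->
  ip h (fun x => f x - g x) = ip h f - ip h g.
Proof. by move=> F G H; rewrite ipC ipBl// !(ipC h). Qed.

Lemma ip_ge0 f : 0 <= ip f f.
Proof. by apply: Rintegral_ge0 => x _; rewrite -expr2 sqr_ge0. Qed.

Lemma ip_sqrD t f g : sqint f -> sqint g ->
  ip (fun x => f x + t * g x) (fun x => f x + t * g x) =
  ip f f + 2 * t * ip f g + t ^+ 2 * ip g g.
Proof.
move=> F G; have G' := sqintZ t G; have S := sqintD F G'.
rewrite ipDl// !ipDr// !ipZl// !ipZr// (ipC g f); ring.
Qed.

Lemma cauchy_schwarz_ip f g : sqint f -> sqint g ->
  ip f g ^+ 2 <= ip f f * ip g g.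
Proof.
move=> F G; apply: quad_disc => t.
by rewrite -ip_sqrD// ip_ge0.
Qed.

Definition ipn f := ip f f.

Lemma ip_cvg (f_ : (T -> R)^nat) f g : (forall n, sqint (f_ n)) -> sqint f ->
  sqint g -> ipn (fun x => f_ n x - f x) @[n --> \oo] --> (0 : R) ->
  ip (f_ n) g @[n --> \oo] --> ip f g.
Proof.
move=> F0 F G; apply: (@lim_sqr _ _ _ _ (ipn g)) => n.
by rewrite -ipBl//; apply: cauchy_schwarz_ip => //; exact: sqintB.
Qed.

End L2.

Lemma geometric_cauchy_bound (R : realType) (a : R^nat) (s : R) :
  (forall k, `|a k.+1 - a k| <= s / 2 ^+ k) ->
  forall n k, `|a (n + k)%N - a n| <= 2 * s / 2 ^+ n.
Proof.
move=> H n k.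
have s0 : 0 <= s by have := le_trans (normr_ge0 _) (H 0); rewrite expr0 divr1.
suff : `|a (n + k)%N - a n| <= 2 * s / 2 ^+ n - 2 * s / 2 ^+ (n + k).
  move/le_trans; apply; rewrite gerBl.
  by rewrite divr_ge0// ?exprn_ge0// mulr_ge0.
elim: k => [|k IH]; first by rewrite addn0 !subrr normr0.
rewrite addnS; have := H (n + k)%N.
have -> : a (n + k).+1 - a n = (a (n + k).+1 - a (n + k)%N) + (a (n + k)%N - a n).
  by ring.
move=> H1; rewrite (le_trans (ler_normD _ _))// (le_trans (lerD H1 IH))//.
rewrite exprS; set z := 2 ^+ (n + k).
have : z != 0 by rewrite expf_neq0.
move=> z0; rewrite le_eqVlt; apply/orP; left; apply/eqP.
set w := 2 ^+ n; have w0 : w != 0 by rewrite expf_neq0.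
by field; rewrite w0 z0.
Qed.

Section completeness.
Context d (T : measurableType d) (R : realType) (mu : {measure set T -> \bar R}).

(** Riesz-Fischer with a geometric rate. The series of the 4^n (f_{n+1} -
    f_n)^2 has a finite integral because 4 / 16 < 1; where it is finite, the
    increments are bounded by a multiple of 2^-n, which gives the limit, and
    the same series dominates the squared tails, which gives convergence in
    L2. The almost everywhere limit serves to identify products with a fixed
    function in the limit. *)
Lemma sqint_complete (f_ : (T -> R)^nat) (C : R) :
  (forall n, sqint mu (f_ n)) ->
  (forall n, ipn mu (fun x => f_ n.+1 x - f_ n x) <= C / 16 ^+ n) ->
  exists f, [/\ sqint mu f, {ae mu, forall x, f_ n x @[n --> \oo] --> f x} &
    ipn mu (fun x => f_ n x - f x) @[n --> \oo] --> (0 : R)].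
Proof.
move=> F HC.
pose h n x := 4 ^+ n * (f_ n.+1 x - f_ n x) ^+ 2.
have hi n : integ mu (h n).
  by apply: integZ; have [] := sqintB (F n.+1) (F n).
have h0 n x : 0 <= h n x by rewrite mulr_ge0 ?sqr_ge0 ?exprn_ge0//.
pose H x : \bar R := (\sum_(0 <= n <oo) (h n x)%:E)%E.
have mH : measurable_fun setT H.
  apply: ge0_emeasurable_sum => // n *; first by rewrite lee_fin.
  exact: measurable_int (hi n).
have H0' x : (0 <= H x)%E by apply: nneseries_ge0 => k _ _; rewrite lee_fin.
have Hint : mu.-integrable setT H.
  apply/integrableP; split => //.
  under eq_integral do rewrite gee0_abs//.
  rewrite integral_nneseries//; last 2 first.
    by move=> n; exact: measurable_int (hi n).
    by move=> n x _; rewrite lee_fin.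
  have bnd n : (\int[mu]_x (h n x)%:E <= (C / 4 ^+ n)%:E)%E.
    rewrite -[leLHS]fineK; last exact: (integrable_fin_num measurableT (hi n)).
    rewrite lee_fin -/(Rintegral mu setT (h n)) RintegralZl//; last first.
      by have [] := sqintB (F n.+1) (F n).
    rewrite -ler_pdivlMl ?exprn_gt0//; apply: le_trans (HC n) _.
    rewrite (_ : 16 = 4 * 4 :> R); last by ring.
    by rewrite exprMn invfM; lra.
  apply: (@le_lt_trans _ _ (2 * C)%:E); last exact: ltry.
  apply: lime_le.
    apply: is_cvg_nneseries => n _ _; apply: integral_ge0 => x _.
    by rewrite lee_fin.
  apply: nearW => n.
  have C0 : 0 <= C by have := le_trans (ip_ge0 _ _) (HC 0); rewrite expr0 divr1.
  suff : (\sum_(0 <= k < n) \int[mu]_x (h k x)%:E <= (2 * C - 2 * C / 4 ^+ n)%:E)%E.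
    move/le_trans; apply; rewrite lee_fin gerBl.
    by rewrite divr_ge0// ?exprn_ge0// mulr_ge0.
  elim: n => [|n IH]; first by rewrite big_geq// lee_fin expr0; lra.
  rewrite big_nat_recr//=; apply: le_trans (leeD IH (bnd n)) _.
  rewrite -EFinD lee_fin exprS invfM.
  have : 0 <= C / 4 ^+ n by rewrite divr_ge0// exprn_ge0.
  by set z := (4 ^+ n)^-1; rewrite (_ : 2 * C * (_ * z) = C * z / 2); [lra|field].
pose A := [set x | H x \is a fin_num].
have mA : measurable A.
  by rewrite -[A]setTI; exact: emeasurable_fin_num.
have aeA : {ae mu, forall x, A x}.
  by have := integrable_ae measurableT Hint; apply: filterS => x; apply.
have hle x n : A x -> h n x <= fine (H x).
  move=> Ax; rewrite -lee_fin fineK//.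
  apply: le_trans (nneseries_lim_ge n.+1 _); last by move=> k _ _; rewrite lee_fin.
  rewrite big_nat_recr//= leeDr//.
  by apply: sume_ge0 => k _; rewrite lee_fin.
have H0 x : 0 <= fine (H x) by rewrite fine_ge0// nneseries_ge0// => k _ _; rewrite lee_fin.
have bd x n k : A x -> (f_ (n + k)%N x - f_ n x) ^+ 2 <= 4 * fine (H x) / 4 ^+ n.
  move=> Ax; have := @geometric_cauchy_bound _ (f_ ^~ x) (Num.sqrt (fine (H x))) _ n k.
  have P j : `|f_ j.+1 x - f_ j x| <= Num.sqrt (fine (H x)) / 2 ^+ j.
    rewrite -(@ler_pXn2r _ 2) ?nnegrE ?divr_ge0 ?sqrtr_ge0 ?exprn_ge0//.
    rewrite real_normK ?num_real// expr_div_n sqr_sqrtr// -exprM mulnC exprM.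
    rewrite ler_pdivlMr ?exprn_gt0// mulrC.
    rewrite (_ : 2 ^+ 2 = 4 :> R); last by ring.
    exact: hle.
  have S0 : 0 <= 2 * Num.sqrt (fine (H x)) / 2 ^+ n.
    by rewrite divr_ge0 ?exprn_ge0// mulr_ge0// sqrtr_ge0.
  move=> /(_ P); rewrite -(@ler_pXn2r _ 2) ?nnegrE ?normr_ge0//.
  rewrite real_normK ?num_real// expr_div_n exprMn sqr_sqrtr// -exprM mulnC exprM.
  by rewrite (_ : 2 ^+ 2 = 4 :> R)//; ring.
have cv x : A x -> cvgn (f_ ^~ x).
  move=> Ax; apply/cauchy_cvgP/cauchy_exP => e e0.
  have : (4 * fine (H x)) * (4^-1) ^+ n @[n --> \oo] --> (4 * fine (H x)) * 0.
    by apply: cvgMr; apply: cvg_expr; rewrite ger0_norm; lra.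
  rewrite mulr0 => /cvgrPdist_lt/(_ _ (exprn_gt0 2 e0))[N _ HN].
  exists (f_ N x); exists N => // m /= Nm; rewrite /ball/= distrC.
  have := bd x N (m - N)%N Ax; rewrite subnKC// => b.
  rewrite -(@ltr_pXn2r _ 2) ?nnegrE ?(ltW e0)// real_normK ?num_real//.
  apply: le_lt_trans b _; have := HN N (leqnn N).
  by rewrite /= sub0r normrN exprVn => /(le_lt_trans (ler_norm _)).
pose f := fun x => limn (fun n => \1_A x * f_ n x).
have cvf x : \1_A x * f_ n x @[n --> \oo] --> f x.
  rewrite /f indicE; case: (boolP (x \in A)) => [/set_mem Ax|_].
    by rewrite (_ : (fun n => 1%:R * f_ n x) = f_ ^~ x)//;
      [exact: cv | apply/funext => n; rewrite mul1r].
  rewrite (_ : (fun n => 0%:R * f_ n x) = cst 0); last first.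
    by apply/funext => n; rewrite mul0r.
  exact: is_cvg_cst.
have mf : measurable_fun setT f.
  apply: (measurable_fun_cvg (h := fun n x => \1_A x * f_ n x)) => [m|x _].
    by apply: measurable_funM; [exact: measurable_indic | have [] := F m].
  exact: cvf.
have cvA x : A x -> f_ n x @[n --> \oo] --> f x.
  move=> Ax; have := cvf x; rewrite indicE mem_set//=.
  by rewrite (_ : (fun n => 1%:R * f_ n x) = f_ ^~ x)//;
    apply/funext => n; rewrite mul1r.
have bdf x n : A x -> (f x - f_ n x) ^+ 2 <= 4 * fine (H x) / 4 ^+ n.
  move=> Ax.
  have : (f_ k x - f_ n x) ^+ 2 @[k --> \oo] --> (f x - f_ n x) ^+ 2.
    rewrite expr2; under eq_fun do rewrite expr2.
    by apply: cvgM; (apply: cvgB; [exact: cvA | exact: cvg_cst]).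
  move=> cf; rewrite -(cvg_lim _ cf)//; apply: limr_le; first by apply/cvg_ex; eexists; exact: cf.
  by exists n => // k /= nk; have := bd x n (k - n)%N Ax; rewrite subnKC.
pose g n x := \1_A x * (f x - f_ n x).
have iH : integ mu (fun x => \1_A x * fine (H x)).
  apply: (@ae_integ _ _ _ mu (fun x => fine (H x))).
  - apply: measurable_funM; first exact: measurable_indic.
    exact: measurableT_comp mH.
  - by apply: filterS aeA => x Ax; rewrite indicE mem_set// mul1r.
  - rewrite /integ; apply: le_integrable Hint => //.
      by apply/measurable_EFinP; exact: measurableT_comp mH.
    by move=> x _ /=; case: (H x) => [r||] /=; rewrite ?normr0 ?leey.
have gb n x : g n x ^+ 2 <= 4 / 4 ^+ n * (\1_A x * fine (H x)).
  rewrite /g indicE; case: (boolP (x \in A)) => [/set_mem Ax|_].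
    rewrite !mul1r; apply: le_trans (bdf x n Ax) _; lra.
  by rewrite !mul0r expr0n mulr0.
have mg n : measurable_fun setT (g n).
  apply: measurable_funM; first exact: measurable_indic.
  by apply: measurable_funB => //; have [] := F n.
have gs n : sqint mu (g n).
  split => //; apply: (@le_integ _ _ _ _ _ (fun x => 4 / 4 ^+ n * (\1_A x * fine (H x)))).
  - exact: measurable_funX.
  - by move=> x; rewrite ger0_norm ?sqr_ge0.
  - exact: integZ.
have fg n : {ae mu, forall x, f x - f_ n x = g n x}.
  by apply: filterS aeA => x Ax; rewrite /g indicE mem_set// mul1r.
have sf : sqint mu f.
  split => //; have s0 : sqint mu (fun x => g 0 x + f_ 0 x) by apply: sqintD.
  apply: (@ae_integ _ _ _ mu _ _ _ _ s0.2); first exact: measurable_funX.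
  by apply: filterS (fg 0) => x <-; rewrite subrK.
exists f; split => //; first by apply: filterS aeA.
have E n : ipn mu (fun x => f_ n x - f x) = \int[mu]_x (g n x ^+ 2).
  apply: ae_Rint.
  - by apply: measurable_funM; apply: measurable_funB => //; have [] := F n.
  - exact: measurable_funX.
  - by apply: filterS (fg n) => x <-; rewrite -expr2 -sqrrN opprB.
under eq_fun do rewrite E.
apply: (@squeeze_cvgr _ _ _ _ (cst 0) (fun n => (4 * \int[mu]_x (\1_A x * fine (H x))) * (4^-1) ^+ n)).
- apply: nearW => n /=; rewrite Rintegral_ge0/=; last by move=> x _; exact: sqr_ge0.
  apply: le_trans (le_Rintegral measurableT (gs n).2 (integZ (4 / 4 ^+ n) iH) _) _ => //.
  by rewrite RintegralZl// exprVn; lra.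
- exact: cvg_cst.
- rewrite -[X in _ --> X](mulr0 (4 * \int[mu]_x (\1_A x * fine (H x)))).
  by apply: cvgMr; apply: cvg_expr; rewrite ger0_norm; lra.
Qed.

End completeness.

(** * Smooth functions and bumps on the line *)

Section smooth1.
Context {R : realType}.
Implicit Types f g h : R -> R.

Definition has_deriv f g := forall x : R, is_derive x (1 : R) f (g x).

(** Membership in some class of functions closed under differentiation.
    Closure properties of smooth functions are thus closure properties of
    classes, and no derivative of higher order is ever named. *)
Definition smooth1 f := exists C : set (R -> R),
  C f /\ forall g, C g -> exists2 g', C g' & has_deriv g g'.

Lemma smooth1_deriv f : smooth1 f -> exists2 f', smooth1 f' & has_deriv f f'.
Proof.
move=> [C [Cf HC]]; have [f' Cf' ff'] := HC f Cf.
by exists f' => //; exists C.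
Qed.

Lemma has_derivD f f' g g' : has_deriv f f' -> has_deriv g g' ->
  has_deriv (fun x => f x + g x) (fun x => f' x + g' x).
Proof. by move=> F G x; exact: is_deriveD. Qed.

Lemma has_derivM f f' g g' : has_deriv f f' -> has_deriv g g' ->
  has_deriv (fun x => f x * g x) (fun x => f x * g' x + g x * f' x).
Proof. by move=> F G x; exact: is_deriveM. Qed.

Lemma has_derivZ c f f' : has_deriv f f' ->
  has_deriv (fun x => c * f x) (fun x => c * f' x).
Proof. by move=> F x; exact: is_deriveZ. Qed.

Lemma has_deriv_cont f g : has_deriv f g -> continuous f.
Proof.
move=> H x; apply/differentiable_continuous/derivable1_diffP.
exact: (@ex_derive _ _ _ _ _ _ _ (H x)).
Qed.

Lemma smooth1_cont f : smooth1 f -> continuous f.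
Proof. by move=> /smooth1_deriv[f' _]; exact: has_deriv_cont. Qed.

Lemma has_deriv_affine f f' a b : has_deriv f f' ->
  has_deriv (fun x => f (a * x + b)) (fun x => a * f' (a * x + b)).
Proof.
move=> F x; rewrite mulrC.
apply: (@is_derive1_comp _ f (fun x => a * x + b) x (f' (a * x + b)) a (F _)).
rewrite -[X in is_derive _ _ _ X]addr0 -{2}(mulr1 a).
exact: is_deriveD.
Qed.

Lemma smooth1_cst c : smooth1 (fun=> c).
Proof.
exists [set g | exists c, g = fun=> c]; split; first by exists c.
move=> _ [k ->]; exists (fun=> 0); first by exists 0.
by move=> x; exact: is_derive_cst.
Qed.

Lemma smooth1D f g : smooth1 f -> smooth1 g -> smooth1 (fun x => f x + g x).
Proof.
move=> [C [Cf HC]] [D [Dg HD]].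
exists [set h | exists a b, [/\ C a, D b & h = fun x => a x + b x]].
split; first by exists f, g.
move=> _ [a [b [Ca Db ->]]]; have [a' Ca' aa'] := HC a Ca.
have [b' Db' bb'] := HD b Db; exists (fun x => a' x + b' x).
  by exists a', b'.
exact: has_derivD.
Qed.

Lemma smooth1_affine f a b : smooth1 f -> smooth1 (fun x => f (a * x + b)).
Proof.
move=> [C [Cf HC]].
exists [set h | exists c g, C g /\ h = fun x => c * g (a * x + b)].
split; first by exists 1, f; split => //; apply/funext => x; rewrite mul1r.
move=> _ [c [g [Cg ->]]]; have [g' Cg' gg'] := HC g Cg.
exists (fun x => c * (a * g' (a * x + b))).
  by exists (c * a), g'; split => //; apply/funext => x; rewrite mulrA.
exact/has_derivZ/has_deriv_affine.
Qed.

(** By the Leibniz rule, sums of products stay within sums of products. *)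
Inductive prod_class (C D : set (R -> R)) : (R -> R) -> Prop :=
| pc_mul a b : C a -> D b -> prod_class C D (fun x => a x * b x)
| pc_add a b : prod_class C D a -> prod_class C D b ->
    prod_class C D (fun x => a x + b x).

Lemma smooth1M f g : smooth1 f -> smooth1 g -> smooth1 (fun x => f x * g x).
Proof.
move=> [C [Cf HC]] [D [Dg HD]].
exists (prod_class C D); split; first exact: pc_mul.
move=> h; elim=> [a b Ca Db|a b _ [a' Ca' aa'] _ [b' Cb' bb']].
  have [a' Ca' aa'] := HC a Ca; have [b' Db' bb'] := HD b Db.
  exists (fun x => a x * b' x + a' x * b x).
    by apply: pc_add; exact: pc_mul.
  move=> x; rewrite (mulrC (a' x)); exact: has_derivM.
exists (fun x => a' x + b' x); first exact: pc_add.
exact: has_derivD.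
Qed.

Lemma smooth1Z c f : smooth1 f -> smooth1 (fun x => c * f x).
Proof. by move=> F; apply: smooth1M => //; exact: smooth1_cst. Qed.

Lemma smooth1_prim f g : has_deriv f g -> smooth1 g -> smooth1 f.
Proof.
move=> fg [C [Cg HC]]; exists [set h | h = f \/ C h]; split; first by left.
move=> h [->|/HC[g' Cg' hg]]; [exists g => //|exists g' => //]; by right.
Qed.

Lemma smooth1_expR : smooth1 expR.
Proof.
exists [set expR]; split => // _ ->; exists expR => // x; exact: is_derive_expR.
Qed.

(** The constant polynomial 1 gives the classical flat function; letting p
    vary makes the family closed under differentiation. *)
Definition expinv (p : {poly R}) (x : R) :=
  if 0 < x then p.[x^-1] * expR (- x^-1) else 0.

Lemma horner_le_expR (p : {poly R}) :
  exists C : R, forall y, 0 <= y -> `|p.[y]| <= C * expR y.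
Proof.
exists (\sum_(i < size p) `|p`_i| * (i`!)%:R) => y y0.
rewrite horner_coef (le_trans (ler_norm_sum _ _ _))// mulr_suml.
apply: ler_sum => i _; rewrite normrM -mulrA ler_wpM2l//.
rewrite ger0_norm ?exprn_ge0//; case: i => -[|n] /= _.
  by rewrite expr0 mul1r; have := expR_ge1Dx y; lra.
have := expR_ge1Dxn n y0; set z := expR y.
rewrite -ler_pdivrMl ?ltr0n ?fact_gt0// mulrC; lra.
Qed.

(** With y = 1 / x, the product y p(y) is bounded by a multiple of exp y, so
    the function is O(x) on the right of 0. *)
Lemma expinv_cont0 (p : {poly R}) : {for 0, continuous (expinv p)}.
Proof.
have [C HC] := horner_le_expR (p * 'X).
apply/cvgrPdist_lt => /= e e0.
have CC : 0 <= C.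
  have := HC 0 (lexx 0); rewrite expR0 mulr1; exact: le_trans.
have d0 : 0 < e / (C + 1) by rewrite divr_gt0//; lra.
near=> z.
rewrite {1}/expinv ltxx sub0r normrN /expinv; case: ifPn => [z0|_]; last first.
  by rewrite normr0.
have zi : 0 <= z^-1 by rewrite invr_ge0 ltW.
have := HC _ zi; rewrite hornerMX normrM (ger0_norm zi) => H.
rewrite normrM (ger0_norm (expR_ge0 _)) expRN.
rewrite ltr_pdivrMr ?expR_gt0//.
have ze : z < e / (C + 1).
  by rewrite (le_lt_trans (ler_norm _))//; near: z; exact: nbhs0_lt.
move: H; rewrite -ler_pdivlMr ?invr_gt0// invrK => /le_lt_trans; apply.
rewrite mulrAC ltr_pM2r ?expR_gt0//.
rewrite ltr_pdivlMr in ze; last lra.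
nra.
Unshelve. all: by end_near.
Qed.

(** At 0 the difference quotient is the member of the family attached to p *
    'X, which is continuous there. *)
Lemma expinv_deriv (p : {poly R}) :
  has_deriv (expinv p) (expinv ((p - p^`()) * 'X^2)).
Proof.
move=> x; have [x0|x0|->] := ltgtP x 0.
- apply: (@near_eq_is_derive _ _ _ (cst 0)).
    near=> y; rewrite /expinv ifF//; apply/negbTE; rewrite -leNgt ltW//.
    by near: y; exact: lt_nbhsl.
  rewrite /expinv ifF; first exact: is_derive_cst.
  by apply/negbTE; rewrite -leNgt ltW.
- apply: (@near_eq_is_derive _ _ _ (fun y : R => (p.[y^-1] * expR (- y^-1) : R))).
    near=> y; rewrite /expinv ifT//.
    by near: y; exact: lt_nbhsr.
  rewrite /expinv x0.
  have dV : is_derive x (1:R) (fun y : R => y^-1) (- x ^- 2).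
    have d1 : derivable (fun y : R => y^-1) x 1.
      by apply: derivableV; [rewrite gt_eqF | exact: derivable_id].
    apply: (@DeriveDef _ _ _ _ _ _ _ d1).
    have := @deriveV R R id x 1 (lt0r_neq0 x0) (@derivable_id R R x 1).
    by rewrite derive_id /GRing.scale/= mulr1.
  have dp : is_derive x^-1 (1:R) (horner p) (p^`().[x^-1]) by exact: is_derive_poly.
  have dP : is_derive x (1:R) (fun y => p.[y^-1]) (p^`().[x^-1] * - x ^- 2).
    exact: (@is_derive1_comp _ (horner p) (fun y => y^-1)).
  have dE : is_derive x (1:R) (fun y => expR (- y^-1)) (expR (- x^-1) * x ^- 2).
    apply: (@is_derive1_comp _ expR (fun y => - y^-1)).
    by rewrite -[x ^- 2]opprK; exact: is_deriveN.
  rewrite (_ : _ * _ = p.[x^-1] *: (expR (- x^-1) * x ^- 2) +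
    expR (- x^-1) *: (p^`().[x^-1] * - x ^- 2)).
    exact: is_deriveM.
  rewrite hornerM hornerXn hornerD hornerN /GRing.scale/= exprVn; ring.
- apply/is_derive1_caratheodory; exists (expinv (p * 'X)); split.
  + move=> z; rewrite subr0 /expinv ltxx subr0; case: ifPn => [z0|]; last by rewrite mul0r.
    by rewrite hornerMX; field; rewrite gt_eqF.
  + exact: expinv_cont0.
  + by rewrite /expinv ltxx.
Unshelve. all: by end_near.
Qed.

Lemma smooth1_expinv p : smooth1 (expinv p).
Proof.
exists (range expinv); split; first by exists p.
move=> _ [q _ <-]; exists (expinv ((q - q^`()) * 'X^2)); first by eexists.
exact: expinv_deriv.
Qed.

Lemma const_deriv0 f f' : has_deriv f f' -> forall a b, a <= b ->
  (forall x, x \in `]a, b[ -> f' x = 0) -> f b = f a.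
Proof.
move=> ff' a b ab H.
have [c cab] : exists2 c : R, c \in `[a, b] & f b - f a = (fun=> 0) c * (b - a).
  apply: (MVT_segment ab).
    by move=> x xab; rewrite -(H x xab); exact: ff'.
  by apply: continuous_subspaceT; exact: has_deriv_cont ff'.
by rewrite mul0r => /eqP; rewrite subr_eq0 => /eqP.
Qed.

(** A smooth approximation of the indicator of ]0, l]. The square in the
    second factor makes its argument at least k + 1 up to the endpoint l
    included, so that the product still tends to 1 there. *)
Definition bump (l : R) (k : nat) (t : R) : R :=
  expinv 1 (k.+1%:R * t) * expinv 1 (k.+1%:R ^+ 2 * (l + k.+1%:R^-1 - t)).

Lemma expinv1_ge0 t : 0 <= expinv 1 t.
Proof. by rewrite /expinv; case: ifP => // _; rewrite hornerC mul1r expR_ge0. Qed.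

Lemma expinv1_le1 t : expinv 1 t <= 1.
Proof.
rewrite /expinv; case: ifPn => // t0; rewrite hornerC mul1r -[leRHS]expR0.
by rewrite ler_expR oppr_le0 invr_ge0 ltW.
Qed.

Lemma bump_ge0 l k t : 0 <= bump l k t.
Proof. by rewrite mulr_ge0// expinv1_ge0. Qed.

Lemma bump_le1 l k t : bump l k t <= 1.
Proof. by rewrite -[leRHS]mulr1 ler_pM// ?expinv1_ge0 ?expinv1_le1. Qed.

Lemma bump_out (l : R) k (t : R) : ~~ (0 < t < l + k.+1%:R^-1) -> bump l k t = 0.
Proof.
rewrite negb_and -!leNgt => /orP[t0|tl]; rewrite /bump /expinv.
  by rewrite ifF ?mul0r//; apply/negbTE; rewrite -leNgt pmulr_rle0.
rewrite [X in _ * X]ifF ?mulr0//; apply/negbTE; rewrite -leNgt.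
by rewrite pmulr_rle0 ?exprn_gt0// subr_le0.
Qed.

Lemma smooth1_bump l k : smooth1 (bump l k).
Proof.
apply: smooth1M.
  rewrite (_ : (fun x => _) = fun x => expinv 1 (k.+1%:R * x + 0)).
    by apply/smooth1_affine/smooth1_expinv.
  by apply/funext => x; rewrite addr0.
rewrite (_ : (fun x => _) = fun x => expinv 1 (- k.+1%:R ^+ 2 * x + k.+1%:R ^+ 2 * (l + k.+1%:R^-1))).
  by apply/smooth1_affine/smooth1_expinv.
by apply/funext => x; congr expinv; ring.
Qed.

Lemma expinv1_lb y : 0 < y -> 1 - y^-1 <= expinv 1 y.
Proof.
by move=> y0; rewrite /expinv y0 hornerC mul1r; have := expR_ge1Dx (- y^-1).
Qed.

Lemma bump_cvg l t :
  bump l k t @[k --> \oo] --> (\1_(`]0, l]%classic : set R) t : R).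
Proof.
rewrite indicE; have [t0|t0] := boolP (0 < t); last first.
  rewrite memNset; last by rewrite /= in_itv/= (negbTE t0).
  by apply: cvg_near_cst; apply: nearW => k; apply: bump_out; rewrite (negbTE t0).
have [tl|lt] := leP t l.
  rewrite mem_set; last by rewrite /= in_itv/= t0.
  apply: (@squeeze_cvgr _ _ _ _ (fun k => 1 - (t^-1 + 1) * harmonic k) (cst 1)).
  - apply: nearW => k; rewrite bump_le1 andbT.
    have k0 : 0 < (k.+1%:R : R) by rewrite ltr0n.
    have ki : 0 < (k.+1%:R : R)^-1 by rewrite invr_gt0.
    have y1 : 0 < k.+1%:R * t by rewrite mulr_gt0.
    have y2 : 0 < k.+1%:R ^+ 2 * (l + k.+1%:R^-1 - t).
      rewrite mulr_gt0 ?exprn_gt0//.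
      by move: ki; set h := _^-1 => h0; clearbody h; lra.
    have L1 := expinv1_lb y1; have L2 := expinv1_lb y2.
    have U1 := expinv1_le1 (k.+1%:R * t).
    have U2 := expinv1_le1 (k.+1%:R ^+ 2 * (l + k.+1%:R^-1 - t)).
    have L3 : (k.+1%:R ^+ 2 * (l + k.+1%:R^-1 - t))^-1 <= (k.+1%:R)^-1.
      rewrite lef_pV2 ?posrE// expr2 -mulrA ler_peMr ?(ltW k0)//.
      rewrite mulrBr mulrDr mulfV ?gt_eqF//.
      have : k.+1%:R * t <= k.+1%:R * l by rewrite ler_pM2l.
      lra.
    have P1 := expinv1_ge0 (k.+1%:R * t).
    rewrite /bump (_ : harmonic k = k.+1%:R^-1 :> R)//; move: L1; rewrite invfM.
    move: L2 L3 U1 U2 P1; set a := expinv _ _; set b := expinv _ _.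
    set c := (_ ^+ 2 * _)^-1; set h := k.+1%:R^-1 => L2 L3 U1 U2 P1 L1.
    suff : (1 - a) + (1 - b) <= (t^-1 + 1) * h by nra.
    rewrite (_ : _ * h = h / t + h); last by ring.
    lra.
  - rewrite -[X in _ --> X]subr0; apply: cvgB; first exact: cvg_cst.
    rewrite -(mulr0 (t^-1 + 1)); apply: cvgMr; exact: cvg_harmonic.
  - exact: cvg_cst.
rewrite memNset; last by rewrite /= in_itv/= leNgt lt andbF.
apply: cvg_near_cst.
have : @harmonic R k @[k --> \oo] --> (0:R) by exact: cvg_harmonic.
move=> /cvgrPdist_lt/(_ (t - l)); rewrite subr_gt0 => /(_ lt); apply: filterS => k.
rewrite sub0r normrN ger0_norm ?invr_ge0// -[X in X < _]/(k.+1%:R^-1) => H.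
move: H; rewrite ltrBrDl => /ltW H.
by apply: bump_out; rewrite negb_and -!leNgt H orbT.
Qed.

(** The difference of two translates of this primitive has compact support,
    and a difference of bumps as derivative. *)
Lemma bump_prim (l : R) k : 0 < l -> exists B : R -> R,
  [/\ has_deriv B (bump l k), forall t : R, t <= 0 -> B t = 0,
     forall t, 0 <= B t <= l + k.+1%:R^-1 &
     forall t : R, l + k.+1%:R^-1 <= t -> B t = B (l + k.+1%:R^-1)].
Proof.
move=> l0; set L := l + _; have L0 : 0 < L by rewrite addr_gt0 ?invr_gt0.
have cb := smooth1_cont (smooth1_bump l k).
have ib : integ (@lebesgue_measure R) (bump l k).
  apply: (@le_integ _ (measurableTypeR R) R lebesgue_measure (bump l k) (\1_(`[0, L]%classic : set R))).
  - exact: continuous_measurable_fun cb.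
  - move=> x; rewrite ger0_norm ?bump_ge0 ?indicE//.
    have [xL|xL] := boolP (0 < x < L).
      rewrite mem_set ?bump_le1//= in_itv/=.
      by move/andP : xL => [/ltW -> /ltW ->].
    by rewrite bump_out.
  - exact: (@integrable_indic_itv R 0 L true false).
pose F x := \int[lebesgue_measure]_(t in [set` Interval -oo%O (BRight x)]) bump l k t.
have FF : has_deriv F (bump l k).
  move=> x; have x1 : x < x + 1 by lra.
  have [] := @continuous_FTC1 R (bump l k) -oo%O x (x + 1) x1 _ _ (cb x).
  - by apply: integrableS ib.
  - by first [rewrite ltNyr | exact: ltNyr | case: x {x1}].
  move=> dF Fx; rewrite -Fx derive1E; exact: (@DeriveDef _ _ _ _ _ _ _ dF).
have le t : t <= 0 -> F t = F 0.
  move=> t0; apply/esym; apply: (const_deriv0 FF t0) => x; rewrite in_itv/= => /andP[_ x0].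
  by apply: bump_out; rewrite negb_and -!leNgt (ltW x0).
have ge t : L <= t -> F t = F L.
  move=> tL; apply: (const_deriv0 FF tL) => x.
  rewrite in_itv/= => /andP[x0 _].
  by apply: bump_out; rewrite negb_and -!leNgt (ltW x0) orbT.
have md a b : a <= b -> 0 <= F b - F a <= b - a.
  move=> ab; have [c _ ->] : exists2 c : R, c \in `[a, b] & F b - F a = bump l k c * (b - a).
    by apply: (MVT_segment ab) => //; apply: continuous_subspaceT; exact: has_deriv_cont FF.
  have := bump_ge0 l k c; have := bump_le1 l k c; nra.
exists (fun t => F t - F 0); split.
- move=> x; rewrite -[X in is_derive _ _ _ X]subr0.
  by apply: is_deriveB; exact: FF.
- by move=> t /le ->; rewrite subrr.
- move=> t; have [t0|t0] := leP t 0; first by rewrite le// subrr lexx ltW.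
  have [tL|tL] := leP L t.
    by rewrite ge//; have := md 0 L (ltW L0); rewrite subr0.
  by have := md 0 t (ltW t0); rewrite subr0 => /andP[-> /=]; lra.
- by move=> t /ge ->.
Qed.

End smooth1.

(** * Measurability and boxes in R^d *)

Section dct.
Context d (T : measurableType d) (R : realType) (mu : {measure set T -> \bar R}).

Lemma Rdominated (f_ : (T -> R)^nat) (f g : T -> R) :
  (forall n, measurable_fun setT (f_ n)) ->
  (forall x, f_ n x @[n --> \oo] --> f x) ->
  (forall n x, `|f_ n x| <= g x) -> integ mu g ->
  integ mu f /\ \int[mu]_x f_ n x @[n --> \oo] --> \int[mu]_x f x.
Proof.
move=> mf_ ff fg ig.
have mf : measurable_fun setT f.
  by apply: (measurable_fun_cvg mf_) => x _; exact: ff.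
have [] := @dominated_convergence _ T R mu setT measurableT
  (fun n => EFin \o f_ n) (EFin \o f) (EFin \o g).
- by move=> n; exact/measurable_EFinP.
- exact/measurable_EFinP.
- by apply: aeW => x _ /=; apply: cvg_EFin; [exact: nearW|exact: ff].
- exact: ig.
- by apply: aeW => x n _ /=; rewrite lee_fin.
move=> fi _ cv; split; first exact: fi.
move: cv; rewrite -(fineK (integrable_fin_num measurableT fi)).
by move=> /fine_cvg; apply: cvg_trans.
Qed.
End dct.

Section Rn.
Context {R : realType} {d : nat}.
Local Notation T := ('rV[R]_d).
Local Notation mu := (@lebesgue_rV R d).

Lemma measurable_coord_preimage (i : 'I_d) (B : set R) :
  measurable (B : set (measurableTypeR R)) ->
  measurable [set x : T | B (x 0 i)].
Proof.
by move=> mB; rewrite -[X in measurable X]setTI; exact: measurable_coord.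
Qed.

Lemma coord_bounded (x : T) : exists n : nat, forall i, `|x 0 i| < n%:R.
Proof.
exists (Num.trunc (\sum_j `|x 0 j|)).+1 => i; apply: le_lt_trans (truncnS_gt _).
by rewrite (bigD1 i)//= lerDl; exact: sumr_ge0.
Qed.

(** Cubes with rational centres and radii 1 / (n + 1) form a countable base,
    and cubes belong to the coordinate sigma-algebra. *)
Lemma open_measurable_rV (U : set T) : open U -> measurable U.
Proof.
move=> oU.
pose F (q : 'rV[rat]_d * nat) : set T :=
  [set x | (forall i, `|x 0 i - ratr (q.1 0 i)| < q.2.+1%:R^-1) /\
     forall y : T, (forall i, `|y 0 i - ratr (q.1 0 i)| < q.2.+1%:R^-1) -> U y].
rewrite (_ : U = \bigcup_q F q); last first.
  apply/seteqP; split => [x Ux|x [q _ [H1 H2]]]; last exact: H2.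
  have /nbhs_ballP[e /= e0 eU] := open_nbhs_nbhs (conj oU Ux).
  have [n ne] : exists n, 2 * n.+1%:R^-1 < e.
    have : @harmonic R k @[k --> \oo] --> (0:R) by exact: cvg_harmonic.
    have e2 : 0 < e / 2 by lra.
    move=> /cvgrPdist_lt/(_ _ e2)[N _ HN]; exists N.
    have := HN N (leqnn _); rewrite sub0r normrN ger0_norm ?invr_ge0//.
    rewrite -[X in X < _]/(N.+1%:R^-1); set h := _^-1; clearbody h; lra.
  have n0 : 0 < n.+1%:R^-1 :> R by rewrite invr_gt0.
  have H i : exists q : rat, `|x 0 i - ratr q| < n.+1%:R^-1.
    have /(@rat_in_itvoo R)[q] : x 0 i - n.+1%:R^-1 < x 0 i + n.+1%:R^-1.
      by rewrite ltrD2l gtrN.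
    rewrite in_itv/= => /andP[q1 q2]; exists q; rewrite ltr_norml.
    move: n0 q1 q2; set h := _^-1; clearbody h; lra.
  have [q Hq] := choice H.
  exists (\row_i q i, n) => //=; split => [i|y Hy]; first by rewrite mxE.
  apply: eU => /=; split => // i j; rewrite /ball/= (ord1 i).
  apply: le_lt_trans ne; rewrite (_ : x 0 j - y 0 j = (x 0 j - ratr (q j)) - (y 0 j - ratr (q j))); last by ring.
  rewrite (le_trans (ler_normB _ _))// mulr_natl mulr2n lerD// ltW//.
  by have := Hy j; rewrite mxE.
apply: countable_bigcupT_measurable; first exact: countableP.
move=> q; have [H|H] := pselect (forall y : T,
  (forall i, `|y 0 i - ratr (q.1 0 i)| < q.2.+1%:R^-1) -> U y); last first.
  by rewrite (_ : F q = set0)//; apply/seteqP; split => // x [].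
rewrite (_ : F q = \bigcap_(i in [set: 'I_d])
  [set x : T | (ball (ratr (q.1 0 i) : R) q.2.+1%:R^-1) (x 0 i)]).
  apply: fin_bigcap_measurable => // i _; apply: measurable_coord_preimage.
  exact: measurable_ball.
apply/seteqP; split => x /=; first by move=> [xq _] i _; rewrite /ball/= distrC.
by move=> xq; split => // i; have := xq i I; rewrite /ball/= distrC.
Qed.

Lemma continuous_measurable_rV (f : T -> R) :
  continuous f -> measurable_fun [set: T] f.
Proof.
move=> cf; apply: (measurability _ (RGenOpens.measurableE R)).
move=> _ [_ [a [b ->] <-]]; rewrite setTI; apply: open_measurable_rV.
by apply: open_comp => [x _|]; [exact: cf | exact: interval_open].
Qed.

Lemma measurable_coord_fun i (w : R -> R) : continuous w ->
  measurable_fun setT (fun x : T => w (x 0 i)).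
Proof.
move=> cw; apply: (@measurableT_comp _ _ _ _ _ _ w); last exact: measurable_coord.
exact: continuous_measurable_fun.
Qed.

Definition box (a b : 'I_d -> R) : set T :=
  [set x | forall i, (`]a i, b i]%classic : set R) (x 0 i)].

Lemma measurable_prod_set (A : 'I_d -> set R) :
  (forall i, measurable (A i : set (measurableTypeR R))) ->
  measurable [set x : T | forall i, A i (x 0 i)].
Proof.
move=> mA.
rewrite (_ : [set x | _] = \bigcap_(i in [set: 'I_d]) [set x : T | A i (x 0 i)]).
  by apply: fin_bigcap_measurable => // i _; exact: measurable_coord_preimage.
by apply/seteqP; split => x /= H i; [move=> _|]; exact: H.
Qed.

Lemma measurable_box a b : measurable (box a b).
Proof. by apply: (@measurable_prod_set (fun i => `]a i, b i]%classic)) => i; exact: measurable_itv. Qed.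

Lemma box_vol a b : (forall i, a i <= b i) ->
  mu (box a b) = (\prod_(i < d) (b i - a i))%:E.
Proof.
move=> ab; rewrite (@lebesgue_rV_box R d (fun i => `]a i, b i]%classic)); last by move=> i; exact: measurable_itv.
rewrite -prodEFin; apply: eq_bigr => i _.
by rewrite lebesgue_measure_itv/= lte_fin; case: ltgtP (ab i) => // ->; rewrite subrr.
Qed.

Lemma box_fin a b : (mu (box a b) < +oo)%E.
Proof.
rewrite (@lebesgue_rV_box R d (fun i => `]a i, b i]%classic)); last by move=> i; exact: measurable_itv.
have : (\prod_(i < d) lebesgue_measure (`]a i, b i]%classic : set R) \is a fin_num)%E.
  apply: prode_fin_num => i _; rewrite lebesgue_measure_itv/=.
  by case: ifP => // _; rewrite -EFinB.
by rewrite ge0_fin_numE// prode_ge0.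
Qed.

Definition orthant (a : 'I_d -> R) : set T :=
  [set x | forall i, (`]a i, +oo[%classic : set R) (x 0 i)].

Lemma measurable_orthant a : measurable (orthant a).
Proof. by apply: (@measurable_prod_set (fun i => `]a i, +oo[%classic)) => i; exact: measurable_itv. Qed.

Lemma measurable_orthantE :
  @measurable _ T = <<s range orthant >>.
Proof.
apply/seteqP; split; last first.
  apply: smallest_sub; first exact: sigma_algebra_measurable.
  by move=> _ [a _ <-]; exact: measurable_orthant.
apply: smallest_sub; first exact: smallest_sigma_algebra.
move=> A; rewrite -bigcup_seq/= => -[i _ [B mB <-]]; rewrite setTI.
pose P := [set B : set R | <<s range orthant >> [set x : T | B (x 0 i)]].
suff : (@measurable _ (measurableTypeR R)) `<=` P by apply.
rewrite (_ : @measurable _ (measurableTypeR R) = <<s @RGenOInfty.G R >>); last first.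
  exact: RGenOInfty.measurableE.
have sa := @smallest_sigma_algebra T setT (range orthant).
apply: smallest_sub.
  split.
  - by rewrite /P/= (_ : [set _ | _] = set0)//; exact: sigma_algebra0.
  - move=> C PC; rewrite /P/=.
    by have [_ + _] := sa; apply.
  - move=> F PF; rewrite /P/=.
    have [_ _] := sa; exact.
move=> _ [c ->]; rewrite /P/=.
pose a (n : nat) j := if j == i then c else - n%:R : R.
rewrite (_ : [set _ | _] = \bigcup_n orthant (a n)).
  apply: sigma_algebra_bigcup => n; apply: sub_sigma_algebra; by exists (a n).
apply/seteqP; split => x /=.
  rewrite in_itv/= andbT => cx.
  have [n xn] := coord_bounded x; exists n => // j; rewrite /= in_itv/= andbT /a.
  by case: eqP => [->//|_]; rewrite ltrNl (le_lt_trans (ler_norm _))// normrN.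
by move=> [n _ /(_ i)]; rewrite /a eqxx.
Qed.

(** Orthants are stable under intersection and generate the sigma-algebra, and
    the measurable sets over which f has integral 0 form a Dynkin system. *)
Lemma orthant_ae0 (f : T -> R) : integ mu f ->
  (forall a, \int[mu]_(x in orthant a) f x = 0) ->
  {ae mu, forall x, f x = 0}.
Proof.
move=> fi H.
pose P A := (\int[mu]_(x in A) (f x)%:E = 0)%E.
have fiA A : measurable A -> mu.-integrable A (EFin \o f).
  by move=> mA; apply: integrableS fi.
have PO a : P (orthant a).
  rewrite /P -[LHS]fineK; last exact: (integrable_fin_num (measurable_orthant a) (fiA _ (measurable_orthant a))).
  by have := H a; rewrite /Rintegral => ->.
have PT : P setT.
  pose F (n : nat) := orthant (fun=> - n%:R).
  have FT : \bigcup_n F n = setT.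
    apply/seteqP; split => // x _; have [n xn] := coord_bounded x.
    exists n => // j; rewrite /= in_itv/= andbT.
    by rewrite ltrNl (le_lt_trans (ler_norm _))// normrN.
  have mF n : measurable (F n) by exact: measurable_orthant.
  have cvF x : \1_(F n) x * f x @[n --> \oo] --> f x.
    apply: cvg_near_cst; have [N _ FN] : (\bigcup_n F n) x by rewrite FT.
    exists N => // n /= Nn; rewrite indicE mem_set ?mul1r// => j.
    have := FN j; rewrite /= !in_itv/= !andbT; apply: le_lt_trans.
    by rewrite lerN2 ler_nat.
  have [] := @Rdominated _ T R mu (fun n x => \1_(F n) x * f x) f (fun x => `|f x|).
  - move=> n; apply: measurable_funM; last exact: integ_meas fi.
    exact: measurable_indic.
  - exact: cvF.
  - move=> n x; rewrite indicE; case: (_ \in _); rewrite ?mul1r//.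
    by rewrite mul0r normr0.
  - exact: (integrable_norm fi).
  move=> _; rewrite (_ : (fun n => _) = cst 0); last first.
    by apply/funext => n; rewrite -Rint_indic; exact: H.
  move=> /(cvg_lim (@Rhausdorff R)); rewrite lim_cst// => f0.
  rewrite /P -[LHS]fineK; last exact: (integrable_fin_num measurableT fi).
  by rewrite -[fine _]/(\int[mu]_x f x) -f0.
have all A : measurable A -> P A.
  rewrite measurable_orthantE; apply: (@dynkin_induction _ T (range orthant) P).
  - exact: measurable_orthantE.
  - move=> _ _ [a _ <-] [b _ <-]; exists (fun i => Num.max (a i) (b i)) => //.
    apply/seteqP; split => x /=.
      move=> K; split => i; have := K i; rewrite /= !in_itv/= !andbT gt_max => /andP[]//.
    by move=> [Ka Kb] i; have := Ka i; have := Kb i; rewrite /= !in_itv/= !andbT gt_max => -> ->.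
  - exact: PT.
  - by move=> _ [a _ <-]; exact: PO.
  - move=> S mS PS; rewrite /P.
    have := PT; rewrite /P -(setUv S) integral_setU_EFin//; last 3 first.
      exact: measurableC.
      by rewrite setUv; exact: integ_meas fi.
      by apply/disj_setPS; rewrite setICr.
    by rewrite PS add0e.
  - move=> F mF tF PF; rewrite /P integral_bigcup//.
      by apply: eseries0 => i _ _; exact: PF.
    by apply: fiA; exact: bigcup_measurable.
have : ae_eq mu setT (EFin \o f) (cst 0%E).
  apply: integral_ae_eq => //.
  by move=> E _ mE; rewrite integral0; exact: all.
by apply: filterS => x /(_ I) /= [].
Qed.

End Rn.

(** * Product test functions and weak derivatives *)

Section test1.
Context {R : realType}.
Implicit Types r : R -> R.

Lemma has_deriv_uniq r r' x D : has_deriv r r' -> is_derive x (1 : R) r D -> r' x = D.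
Proof.
by move=> H K; rewrite -(@derive_val _ _ _ _ _ _ _ (H x)) (@derive_val _ _ _ _ _ _ _ K).
Qed.

Definition supp_in (a b : R) r := forall t, ~~ (a <= t <= b) -> r t = 0.

Lemma supp_in_deriv a b r r' : has_deriv r r' -> supp_in a b r -> supp_in a b r'.
Proof.
move=> H S t tab; apply: (has_deriv_uniq H).
suff e0 : \near t, cst 0 t = r t.
  by apply: near_eq_is_derive e0 _; exact: is_derive_cst.
move: tab; rewrite negb_and -!ltNge => /orP[ta|bt].
  near=> s; rewrite S// negb_and -!ltNge; apply/orP; left.
  by near: s; exact: lt_nbhsl.
near=> s; rewrite S// negb_and -!ltNge; apply/orP; right.
by near: s; exact: lt_nbhsr.
Unshelve. all: by end_near.
Qed.

Lemma supp_in_bounded a b r : continuous r -> supp_in a b r ->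
  exists M : R, forall t, `|r t| <= M.
Proof.
move=> cr S; have [ab|ba] := leP a b; last first.
  exists 0 => t; rewrite S ?normr0//; apply/negP => /andP[/le_trans h /h].
  by rewrite leNgt ba.
have cn : {within `[a, b], continuous (fun t => `|r t|)}.
  by apply: continuous_subspaceT => x; apply: cvg_norm; exact: cr.
have [c _ Hc] := EVT_max ab cn.
exists `|r c| => t; have [tab|tab] := boolP (a <= t <= b).
  by apply: Hc; rewrite in_itv.
by rewrite S// normr0.
Qed.

(** The derivative is carried along with the function, so that it never has to
    be computed. *)
Definition test1 r r' := [/\ smooth1 r, has_deriv r r' &
  exists a b : R, [/\ a <= b, supp_in a b r & supp_in a b r']].

Lemma test1_intro r r' a b : smooth1 r -> has_deriv r r' -> a <= b ->
  supp_in a b r -> test1 r r'.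
Proof.
by move=> s D ab S; split => //; exists a, b; split => //; exact: supp_in_deriv S.
Qed.

Lemma smooth1_deriv_of r r' : smooth1 r -> has_deriv r r' -> smooth1 r'.
Proof.
move=> /smooth1_deriv[q sq rq] rr'; suff -> : r' = q by [].
by apply/funext => x; exact: has_deriv_uniq rr' (rq x).
Qed.

Lemma smooth1_shift (r : R -> R) c : smooth1 r -> smooth1 (fun t => r (t - c)).
Proof.
move=> /(smooth1_affine 1 (- c)); congr smooth1.
by apply/funext => t; rewrite mul1r.
Qed.

Lemma has_deriv_shift r r' c : has_deriv r r' ->
  has_deriv (fun t => r (t - c)) (fun t => r' (t - c)).
Proof.
move=> /(has_deriv_affine 1 (- c)) H x; have := H x; rewrite !mul1r.
by congr (is_derive _ _ _ _); apply/funext => t; rewrite mul1r.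
Qed.

Lemma test1_bump (l : R) k (c : R) : exists r', test1 (fun t => bump l k (t - c)) r'.
Proof.
have [q sq bq] := smooth1_deriv (smooth1_shift c (smooth1_bump l k)).
exists q; apply: (@test1_intro _ _ c (c + (`|l| + k.+1%:R^-1))) => //.
- exact: smooth1_shift (smooth1_bump l k).
- by rewrite lerDl addr_ge0.
- move=> t tc; apply: bump_out; apply: contra tc; rewrite subr_gt0.
  move=> /andP[/ltW -> /=]; rewrite ltrBlDl => /ltW/le_trans; apply.
  by rewrite lerD2l lerD2r ler_norm.
Qed.

End test1.

Section test_functions.
Context {R : realType} {d : nat}.
Local Notation T := ('rV[R]_d).
Local Notation mu := (@lebesgue_rV R d).

Lemma is_derive_line (f : T -> R) (x v : T) (g : R -> R) (c D t : R) :
  (forall h : R, f (h *: v + x) = c * g (h + t)) ->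
  is_derive t (1 : R) g D -> is_derive x v f (c * D).
Proof.
move=> E [dg vg].
have Q : (fun h : R => h^-1 *: ((f \o shift x) (h *: v) - f x)) =
    (fun h : R => c * (h^-1 *: ((g \o shift t) (h *: (1 : R)) - g t))).
  apply/funext => h /=; have := E 0; rewrite scale0r !add0r => ->.
  by rewrite E /GRing.scale/= mulr1; ring.
have cg : h^-1 *: ((g \o shift t) (h *: (1 : R)) - g t) @[h --> 0^'] --> D.
  by rewrite -vg; exact: dg.
have cf : h^-1 *: ((f \o shift x) (h *: v) - f x) @[h --> 0^'] --> c * D.
  by rewrite Q; apply: cvgMr.
apply: DeriveDef; first by apply/cvg_ex; exists (c * D).
exact: cvg_lim cf.
Qed.

Definition prodf (e : 'I_d -> R -> R) (x : T) : R := \prod_j e j (x 0 j).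

Definition upd (e : 'I_d -> R -> R) i r : 'I_d -> R -> R :=
  fun j => if j == i then r else e j.

Lemma prodf_upd e i r (x : T) :
  prodf (upd e i r) x = (\prod_(j | j != i) e j (x 0 j)) * r (x 0 i).
Proof.
rewrite /prodf (bigD1 i)//= /upd eqxx mulrC; congr (_ * _).
by apply: eq_bigr => j /negbTE ->.
Qed.

Lemma is_derive_prodf e i r (x : T) : has_deriv (e i) r ->
  is_derive x (delta_mx 0 i) (prodf e) (prodf (upd e i r) x).
Proof.
move=> er; rewrite prodf_upd; apply: (@is_derive_line _ _ _ (e i) _ _ (x 0 i)).
  move=> h; have {1}-> : e = upd e i (e i).
    by apply/funext => j; rewrite /upd; case: eqP => // ->.
  rewrite prodf_upd !mxE !eqxx mulr1; congr (_ * _).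
  by apply: eq_bigr => j ji; rewrite !mxE eqxx (negbTE ji) mulr0 add0r.
exact: er.
Qed.

Lemma partial_prodf e i r : has_deriv (e i) r ->
  partial i (prodf e) = prodf (upd e i r).
Proof.
by move=> er; apply/funext => x; have [_] := is_derive_prodf x er.
Qed.

Lemma continuous_prodf e : (forall j, smooth1 (e j)) -> continuous (prodf e).
Proof.
move=> se; apply: (@continuous_big R 'I_d *%R 1).
  by move=> x; exact: mul_continuous.
move=> j _ x; apply: (@continuous_comp _ _ _ (fun y : T => y 0 j) (e j)).
  exact: coord_continuous.
by apply: smooth1_cont.
Qed.

(** A partial derivative acts on a single factor, hence preserves the product
    form. *)
Lemma smooth_prodf e : (forall j, smooth1 (e j)) -> smooth (prodf e).
Proof.
move=> se s.
suff [e' se' ->] : exists2 e', (forall j, smooth1 (e' j)) &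
    foldr partial (prodf e) s = prodf e'.
  split; first exact: continuous_prodf.
  move=> i x; have [r _ er] := smooth1_deriv (se' i).
  by have [] := is_derive_prodf x er.
elim: s => [|i s [e' se' /= ->]]; first by exists e.
have [r sr er] := smooth1_deriv (se' i).
exists (upd e' i r); last exact: partial_prodf.
by move=> j; rewrite /upd; case: ifP.
Qed.

Lemma test_prodf e : (forall j, exists r', test1 (e j) r') ->
  test_function (prodf e).
Proof.
move=> te; split.
  by apply: smooth_prodf => j; have [r []] := te j.
have H j : exists ab : R * R, supp_in ab.1 ab.2 (e j).
  by have [r [_ _ [a [b []]]]] := te j; exists (a, b).
have [ab Hab] := choice H.
pose K : set T := [set x | forall i, (`[(ab i).1, (ab i).2]%classic : set R) (x 0 i)].
have cK : compact K.
  by apply: (@rV_compact R d (fun i => `[(ab i).1, (ab i).2]%classic)) => i; exact: segment_compact.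
have clK : closed K by apply: compact_closed => //; exact: norm_hausdorff.
apply: (@subclosed_compact _ _ K) => //; first exact: closed_closure.
rewrite [X in _ `<=` X](closure_id _).1//; apply: closure_subset => x /= nz i.
rewrite /= in_itv/=; apply/negPn/negP => /Hab e0; move/eqP: nz; apply.
by rewrite /prodf (bigD1 i)//= e0 mul0r.
Qed.

Definition slab (i : 'I_d) (a b : 'I_d -> R) : set T :=
  [set x | forall j, j != i -> (`]a j, b j]%classic : set R) (x 0 j)].

(** A pointwise limit of product test functions, smooth in x_i only. Sharp
    cut-offs in the other variables reduce questions about one partial
    derivative to functions of one real variable. *)
Definition slab_fun i a b (r : R -> R) (x : T) : R := \1_(slab i a b) x * r (x 0 i).

(** The weak derivative as seen by slab functions. This form is enough for
    uniqueness, for the Poincare inequality and for skew-symmetry. *)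
Definition slab_weak i (u g : T -> R) := forall r r', test1 r r' -> forall a b,
  ip mu u (slab_fun i a b r') = - ip mu g (slab_fun i a b r).

(** Unlike slab functions, product test functions are stable under smooth
    weights in the variables other than x_i. *)
Definition prod_weak i (u g : T -> R) := forall e : 'I_d -> R -> R,
  (forall j, exists r', test1 (e j) r') ->
  ip mu (partial i (prodf e)) u = - ip mu (prodf e) g.

Lemma prod_indic (P : pred 'I_d) (I : 'I_d -> set R) x :
  \1_([set x : T | forall j, P j -> I j (x 0 j)]) x =
  \prod_(j | P j) \1_(I j) (x 0 j) :> R.
Proof.
rewrite indicE; case: (boolP (x \in _)) => [/set_mem xs|].
  by rewrite big1// => j ji; rewrite indicE mem_set//; exact: xs.
move=> nx; have [j ji xj] : exists2 j, P j & ~ I j (x 0 j).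
  apply: contrapT => H; move/negP: nx; apply; apply/mem_set => j ji.
  by apply: contrapT => xj; apply: H; exists j.
by rewrite (bigD1 j)//= indicE memNset// mul0r.
Qed.

Lemma measurable_slab i a b : measurable (slab i a b).
Proof.
rewrite (_ : slab i a b = [set x : T | forall j,
    (if j == i then setT else `]a j, b j]%classic : set R) (x 0 j)]).
  apply: (@measurable_prod_set R d (fun j => if j == i then setT else `]a j, b j]%classic)) => j.
  by case: ifP => _; [exact: measurableT | exact: measurable_itv].
apply/seteqP; split => x /= H j; first by case: ifPn => // /H.
by move=> ji; have := H j; rewrite (negbTE ji).
Qed.

Lemma slabE i a b (x : T) : \1_(slab i a b) x =
  \prod_(j | j != i) \1_(`]a j, b j]%classic : set R) (x 0 j) :> R.
Proof. exact: (prod_indic (fun j => j != i) (fun j => `]a j, b j]%classic)). Qed.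

Lemma boxE i a b (x : T) :
  \1_(box a b) x = \1_(slab i a b) x * \1_(`]a i, b i]%classic : set R) (x 0 i) :> R.
Proof.
rewrite slabE (_ : box a b =
  [set x : T | forall j, predT j -> (`]a j, b j]%classic : set R) (x 0 j)]).
  by rewrite (prod_indic predT (fun j => `]a j, b j]%classic)) (bigD1 i)//= mulrC.
by apply/seteqP; split => y /= H j; [move=> _|]; exact: H.
Qed.

Definition bumps (a b : 'I_d -> R) k : 'I_d -> R -> R :=
  fun j t => bump (b j - a j) k (t - a j).

Lemma bump_shift_cvg (a b t : R) :
  bump (b - a) k (t - a) @[k --> \oo] --> (\1_(`]a, b]%classic : set R) t : R).
Proof.
have := @bump_cvg R (b - a) (t - a).
suff -> : \1_(`]0, (b - a)]%classic : set R) (t - a) = \1_(`]a, b]%classic : set R) t :> R by [].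
rewrite !indicE; congr (nat_of_bool _)%:R; apply/idP/idP => /set_mem H; apply/mem_set; move: H;
  by rewrite /= !in_itv/= subr_gt0 lerD2r.
Qed.

Lemma bump_out_shift (a b t : R) k : ~~ (a < t <= a + `|b - a| + 1) ->
  bump (b - a) k (t - a) = 0.
Proof.
move=> H; apply: bump_out; apply: contra H => /andP[]; rewrite subr_gt0 => -> /=.
rewrite ltrBlDl => /ltW/le_trans; apply.
rewrite addrA lerD//; first by rewrite lerD2l ler_norm.
by rewrite invf_le1// ler1n.
Qed.

Lemma sqint_box a b : sqint mu (\1_(box a b) : T -> R).
Proof.
split; first exact: measurable_indic (measurable_box a b).
rewrite /integ (_ : EFin \o _ = EFin \o (\1_(box a b) : T -> R)); last first.
  by apply/funext => x /=; rewrite indicE; case: (_ \in _); rewrite ?expr1n ?expr0n.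
apply/integrableP; split.
  by apply/measurable_EFinP; exact: measurable_indic (measurable_box a b).
under eq_integral do rewrite /= ger0_norm//.
by rewrite integral_indic ?setIT ?box_fin//; exact: measurable_box.
Qed.

(** A box outside of which the bumps approximating a slab function vanish: a
    bump overshoots its interval by at most 1. *)
Definition hull i (al be : R) (a b : 'I_d -> R) : set T :=
  box (fun j => if j == i then al - 1 else a j)
      (fun j => if j == i then be else a j + `|b j - a j| + 1).

Lemma bumps_le i a b k r (M al be : R) (x : T) : (forall t, `|r t| <= M) ->
  supp_in al be r ->
  `|prodf (upd (bumps a b k) i r) x| <= M * \1_(hull i al be a b) x.
Proof.
move=> rM rS; rewrite prodf_upd.
have M0 : 0 <= M := le_trans (normr_ge0 _) (rM 0).
have b01 j : 0 <= bumps a b k j (x 0 j) <= 1 by rewrite bump_ge0 bump_le1.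
rewrite indicE; case: (boolP (x \in _)) => [_|nx].
  have /andP[p0 p1] : 0 <= \prod_(j | j != i) bumps a b k j (x 0 j) <= 1.
    elim/big_ind : _ => [|y z /andP[y0 y1] /andP[z0 z1]|j _]; last exact: b01.
      by rewrite ler01 lexx.
    by rewrite mulr_ge0//= -[leRHS]mulr1 ler_pM.
  by rewrite mulr1 normrM -[leRHS]mul1r ler_pM// ger0_norm.
rewrite mulr0 normr_le0; apply/eqP.
have [j xj] : exists j, ~ (`](if j == i then al - 1 else a j),
    (if j == i then be else a j + `|b j - a j| + 1)]%classic : set R) (x 0 j).
  apply: contrapT => H; move/negP: nx; apply; apply/mem_set => j.
  by apply: contrapT => xj; apply: H; exists j.
have [ji|ji] := eqVneq j i.
  rewrite rS ?mulr0//; move: xj; rewrite ji eqxx /= in_itv/= => /negP.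
  by apply: contra => /andP[H ->]; rewrite andbT (lt_le_trans _ H)// gtrDl.
rewrite (bigD1 j)//= {1}/bumps bump_out_shift ?mul0r//.
by move: xj; rewrite (negbTE ji) /= in_itv/= => /negP.
Qed.

Lemma bumps_cvg i a b r (x : T) :
  prodf (upd (bumps a b k) i r) x @[k --> \oo] --> slab_fun i a b r x.
Proof.
rewrite /slab_fun slabE; under eq_fun do rewrite prodf_upd.
apply: cvgMl; apply: (@cvg_big R 'I_d *%R 1); first exact: mul_continuous.
by move=> j _; exact: bump_shift_cvg.
Qed.

Lemma bumps_test i a b k r r' : test1 r r' ->
  forall j, exists q, test1 (upd (bumps a b k) i r j) q.
Proof.
move=> rr' j; rewrite /upd; case: ifP => _.
  by exists r'.
exact: test1_bump.
Qed.

Lemma sqint_norm (h : T -> R) : sqint mu h -> sqint mu (fun x => `|h x|).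
Proof.
move=> [mh h2]; apply: (@sqint_le _ _ _ _ _ h) => //.
  exact: measurableT_comp.
by move=> x; rewrite normr_id.
Qed.

Lemma ip_bumps_cvg i a b r (M al be : R) (h : T -> R) :
  smooth1 r -> (forall t, `|r t| <= M) -> supp_in al be r -> sqint mu h ->
  ip mu (prodf (upd (bumps a b k) i r)) h @[k --> \oo] --> ip mu h (slab_fun i a b r).
Proof.
move=> sr rM rS sh; rewrite ipC.
have [] := @Rdominated _ T R mu (fun k x => prodf (upd (bumps a b k) i r) x * h x)
  (fun x => slab_fun i a b r x * h x) (fun x => M * (\1_(hull i al be a b) x * `|h x|)) => //.
- move=> k; apply: measurable_funM; last by case: sh.
  apply: continuous_measurable_rV; apply: continuous_prodf => j.
  rewrite /upd; case: ifP => // _.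
  exact: smooth1_shift (smooth1_bump _ _).
- by move=> x; apply: cvgMl; exact: bumps_cvg.
- by move=> k x; rewrite normrM mulrA ler_wpM2r// bumps_le.
- apply: integZ; apply: sqint_mul; [exact: sqint_box|exact: sqint_norm].
Qed.

Lemma test1_bounded r r' : test1 r r' -> exists M al be : R,
  [/\ al <= be, forall t, `|r t| <= M, forall t, `|r' t| <= M,
     supp_in al be r & supp_in al be r'].
Proof.
move=> [sr rr' [al [be [ab S S']]]].
have [M HM] := supp_in_bounded (smooth1_cont sr) S.
have [M' HM'] := supp_in_bounded (smooth1_cont (smooth1_deriv_of sr rr')) S'.
exists (Num.max M M'), al, be; split => // t.
  by rewrite le_max HM.
by rewrite le_max HM' orbT.
Qed.

Lemma measurable_slab_fun i a b r : continuous r -> measurable_fun setT (slab_fun i a b r).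
Proof.
move=> cr; apply: measurable_funM; first exact: measurable_indic (measurable_slab _ _ _).
exact: measurable_coord_fun.
Qed.

Lemma slab_fun_le i a b r (M al be : R) (x : T) : (forall t, `|r t| <= M) ->
  supp_in al be r -> `|slab_fun i a b r x| <= M * \1_(hull i al be a b) x.
Proof.
move=> rM S; have := @bumps_cvg i a b r x; move/cvg_norm => c.
rewrite -(cvg_lim _ c)//; apply: limr_le; first by apply/cvg_ex; eexists; exact: c.
by apply: nearW => k; exact: bumps_le.
Qed.

Lemma sqint_slab_fun_gen i a b r (M al be : R) : continuous r ->
  (forall t, `|r t| <= M) -> supp_in al be r -> sqint mu (slab_fun i a b r).
Proof.
move=> cr rM S; apply: (@sqint_le _ _ _ _ _ (fun x => M * \1_(hull i al be a b) x)).
- exact: measurable_slab_fun.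
- by move=> x; rewrite (le_trans (slab_fun_le _ _ _ _ rM S))// ler_norm.
- exact/sqintZ/sqint_box.
Qed.

Lemma sqint_slab_fun i a b r r' : test1 r r' -> sqint mu (slab_fun i a b r).
Proof.
move=> rr'; have [M [al [be [_ rM rM' S S']]]] := test1_bounded rr'.
by apply: sqint_slab_fun_gen rM S; case: rr' => /smooth1_cont.
Qed.

Lemma sqint_slab_fun' i a b r r' : test1 r r' -> sqint mu (slab_fun i a b r').
Proof.
move=> rr'; have [M [al [be [_ rM rM' S S']]]] := test1_bounded rr'.
apply: sqint_slab_fun_gen rM' S'; case: rr' => sr dr _.
exact: smooth1_cont (smooth1_deriv_of sr dr).
Qed.

(** Bumps converge to the indicators of the intervals while staying dominated.
    *)
Lemma prod_weak_slab i u g : sqint mu u -> sqint mu g -> prod_weak i u g -> slab_weak i u g.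
Proof.
move=> su sg H r r' rr' a b.
have [M [al [be [_ rM rM' S S']]]] := test1_bounded rr'.
have [sr dr _] := rr'.
have c1 := ip_bumps_cvg (i := i) (a := a) (b := b) (smooth1_deriv_of sr dr) rM' S' su.
have c2 := ip_bumps_cvg (i := i) (a := a) (b := b) sr rM S sg.
have E k : ip mu (prodf (upd (bumps a b k) i r')) u =
    - ip mu (prodf (upd (bumps a b k) i r)) g.
  rewrite -H; last exact: bumps_test rr'.
  rewrite (@partial_prodf (upd (bumps a b k) i r) i r').
    by congr (ip _ (prodf _) _); apply/funext => j; rewrite /upd; case: ifP.
  by rewrite /upd eqxx.
have c3 : ip mu (prodf (upd (bumps a b k) i r')) u @[k --> \oo] -->
    - ip mu g (slab_fun i a b r).
  by under eq_fun do rewrite E; exact: cvgN.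
exact: (cvg_unique _ c1 c3).
Qed.

(** As j differs from i, the weight is absorbed by the j-th factor of the test
    function. *)
Lemma prod_weak_mul i j (w : R -> R) u g : j != i -> smooth1 w -> prod_weak i u g ->
  prod_weak i (fun x => w (x 0 j) * u x) (fun x => w (x 0 j) * g x).
Proof.
move=> ji sw H e te; pose e' := upd e j (fun t => w t * e j t).
have te' l : exists r', test1 (e' l) r'.
  rewrite /e' /upd; case: eqP => [_|_]; last exact: te.
  have [r' [se de [al [be [ab S _]]]]] := te j.
  have [w' _ dw] := smooth1_deriv sw.
  exists (fun t => w t * r' t + e j t * w' t); apply: (test1_intro (a := al) (b := be)) => //.
  - exact: smooth1M.
  - exact: has_derivM.
  - by move=> t /S ->; rewrite mulr0.
have pw (f : 'I_d -> R -> R) x : prodf (upd f j (fun t => w t * f j t)) x = prodf f x * w (x 0 j).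
  have -> : prodf f x = (\prod_(l | l != j) f l (x 0 l)) * f j (x 0 j).
    by rewrite /prodf (bigD1 j)//= mulrC.
  by rewrite prodf_upd; ring.
have [r [_ er _]] := te i.
have er' : has_deriv (e' i) r by rewrite /e' /upd eq_sym (negbTE ji).
have := H e' te'; rewrite (partial_prodf er') (partial_prodf er).
have -> : upd e' i r = upd (upd e i r) j (fun t => w t * upd e i r j t).
  apply/funext => l; rewrite /e' /upd (negbTE ji).
  by case: (eqVneq l i) => // ->; rewrite eq_sym (negbTE ji).
move=> E; transitivity (ip mu (prodf (upd (upd e i r) j (fun t => w t * upd e i r j t))) u).
  by congr Rintegral; apply/funext => x; rewrite pw; ring.
rewrite E; congr (- _); congr Rintegral; apply/funext => x.
by rewrite /e' pw; ring.
Qed.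

(** Slab functions with a bump in the last variable recover integrals over
    boxes, with a continuous weight in x_i. *)
Lemma slab_fun_bump_cvg i a b (w : R -> R) (h : T -> R) : continuous w -> sqint mu h ->
  ip mu h (slab_fun i a b (fun t => w t * bump (b i - a i) k (t - a i))) @[k --> \oo] -->
  \int[mu]_x (\1_(box a b) x * (w (x 0 i) * h x)).
Proof.
move=> cw sh.
pose be := a i + `|b i - a i| + 1.
pose w' t := if a i <= t <= be then w t else 0.
have aibe : a i <= be by rewrite /be -addrA lerDl addr_ge0.
have cn : {within `[a i, be], continuous (fun t => `|w t|)}.
  by apply: continuous_subspaceT => x; apply: cvg_norm; exact: cw.
have [c _ Hc] := EVT_max aibe cn; set M := `|w c| in Hc.
pose K := hull i (a i) be a b.
have mw := measurable_coord_fun i cw.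
have mb k : measurable_fun setT (fun x : T => bump (b i - a i) k (x 0 i - a i)).
  apply: (measurable_coord_fun i (w := fun t => bump (b i - a i) k (t - a i))).
  exact: smooth1_cont (smooth1_shift _ (smooth1_bump _ _)).
have [] := @Rdominated _ T R mu
  (fun k x => h x * slab_fun i a b (fun t => w t * bump (b i - a i) k (t - a i)) x)
  (fun x => \1_(box a b) x * (w (x 0 i) * h x)) (fun x => M * (\1_K x * `|h x|)) => //.
- move=> k; apply: measurable_funM; first by case: sh.
  apply: measurable_funM; first exact: measurable_indic (measurable_slab _ _ _).
  exact: measurable_funM.
- move=> x; rewrite (boxE i).
  rewrite [X in _ --> X](_ : _ = h x * (\1_(slab i a b) x *
    (w (x 0 i) * \1_(`]a i, b i]%classic : set R) (x 0 i)))); last by ring.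
  by do 3 apply: cvgMr; exact: bump_shift_cvg.
- move=> k x; rewrite normrM mulrC mulrA ler_wpM2r// /slab_fun.
  have [xK|xK] := pselect (K x).
    rewrite [\1_K x]indicE mem_set// mulr1 normrM [`|w _ * _|]normrM.
    have [t1|t1] := boolP (a i < x 0 i <= be); last first.
      by rewrite bump_out_shift// normr0 !mulr0 normr_ge0.
    rewrite -[leRHS]mul1r ler_pM ?mulr_ge0//.
      by rewrite indicE; case: (_ \in _); rewrite ?normr0 ?normr1.
    rewrite -[leRHS]mulr1 ler_pM//; last by rewrite ger0_norm ?bump_ge0 ?bump_le1.
    by apply: Hc; rewrite in_itv/=; case/andP: t1 => /ltW -> ->.
  rewrite [\1_K x]indicE memNset// mulr0 normr_le0.
  have [xs|xs] := pselect (slab i a b x); last first.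
    by rewrite indicE memNset// mul0r.
  rewrite bump_out_shift ?mulr0//; apply/negP => /andP[t1 t2]; apply: xK => j.
  case: ifPn => [/eqP ->|/xs]; rewrite /= !in_itv/=.
    by rewrite t2 andbT (lt_trans _ t1)// gtrDl.
  move=> /andP[-> /le_trans]; apply; rewrite -addrA.
  by rewrite -lerBlDl (le_trans (ler_norm _))// lerDl.
- apply: integZ; apply: sqint_mul; [exact: sqint_box|exact: sqint_norm].
Qed.

Lemma box_ae0 (h : T -> R) :
  (forall a b, integ mu (fun x => \1_(box a b) x * h x)) ->
  (forall a b, \int[mu]_x (\1_(box a b) x * h x) = 0) ->
  {ae mu, forall x, h x = 0}.
Proof.
move=> hi H.
pose K (n : nat) : set T := box (fun=> - n%:R) (fun=> n%:R).
have A n : {ae mu, forall x, \1_(K n) x * h x = 0}.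
  apply: orthant_ae0; first exact: hi.
  move=> a; rewrite -[RHS](H (fun i => Num.max (a i) (- n%:R)) (fun=> n%:R)) Rint_indic.
  apply: eq_Rintegral => x _; rewrite mulrA; congr (_ * _).
  rewrite !indicE -natrM mulnb; congr (nat_of_bool _)%:R.
  apply/andP/idP => [[/set_mem H1 /set_mem H2]|/set_mem H1]; [apply/mem_set|split; apply/mem_set] => j.
  - by have := H1 j; have := H2 j; rewrite /= !in_itv/= gt_max andbT => /andP[-> ->] ->.
  - by have := H1 j; rewrite /= !in_itv/= gt_max andbT => /andP[/andP[]].
  - by have := H1 j; rewrite /= !in_itv/= gt_max => /andP[/andP[_ ->] ->].
have : {ae mu, forall x, forall n, \1_(K n) x * h x = 0} by apply/ae_foralln.
apply: filterS => x Hx; have [n xn] := coord_bounded x.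
have := Hx n; rewrite indicE mem_set ?mul1r// => j.
by rewrite /= in_itv/=; have := xn j; rewrite ltr_norml => /andP[-> /ltW ->].
Qed.

Lemma slab_fun_ae0 i (h : T -> R) : sqint mu h ->
  (forall r r', test1 r r' -> forall a b, ip mu h (slab_fun i a b r) = 0) ->
  {ae mu, forall x, h x = 0}.
Proof.
move=> sh H; apply: box_ae0 => a b.
  by apply: sqint_mul => //; exact: sqint_box.
have c1 : continuous (fun _ : R => 1 : R) by move=> x; exact: cvg_cst.
have := @slab_fun_bump_cvg i a b (fun=> 1) h c1 sh.
under eq_Rintegral do rewrite mul1r.
move=> c; apply/esym; apply: (cvg_unique _ _ c) => //.
rewrite (_ : (fun k => _) = fun=> 0); first exact: cvg_cst.
apply/funext => k; have [r' rr'] := test1_bump (b i - a i) k (a i).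
rewrite -[RHS](H _ _ rr' a b); congr (ip _ _ (slab_fun _ _ _ _)).
by apply/funext => t; rewrite mul1r.
Qed.

Lemma slab_weak_uniq i u g g2 : sqint mu g -> sqint mu g2 -> slab_weak i u g -> slab_weak i u g2 ->
  {ae mu, forall x, g x = g2 x}.
Proof.
move=> sg sg2 H H2.
suff : {ae mu, forall x, g x - g2 x = 0}.
  by apply: filterS => x /eqP; rewrite subr_eq0 => /eqP.
apply: (@slab_fun_ae0 i); first exact: sqintB.
move=> r r' rr' a b; rewrite ipBl//; last exact: sqint_slab_fun rr'.
by apply/eqP; rewrite subr_eq0 -eqr_opp -(H _ _ rr') -(H2 _ _ rr').
Qed.

End test_functions.

(** * Orthogonal projection in L2 x L2 *)

Section projection.
Context d (T : measurableType d) (R : realType) (mu : {measure set T -> \bar R}).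
Local Notation V := ((T -> R) * (T -> R))%type.
Implicit Types (p q F : V) (f g : T -> R).

Definition sqint2 p := sqint mu p.1 /\ sqint mu p.2.

Definition ip2 p q : R := ip mu p.1 q.1 + ip mu p.2 q.2.

Definition comb (c : R) p q : V := (fun x => p.1 x + c * q.1 x, fun x => p.2 x + c * q.2 x).

Definition subspace2 (S : set V) :=
  [/\ S (fun=> 0, fun=> 0), forall p, S p -> sqint2 p &
      forall c p q, S p -> S q -> S (comb c p q)].

Lemma sqint2_comb c p q : sqint2 p -> sqint2 q -> sqint2 (comb c p q).
Proof. by move=> [p1 p2] [q1 q2]; split; apply: sqintD => //; exact: sqintZ. Qed.

Lemma ip2_sqrD c p q : sqint2 p -> sqint2 q ->
  ip2 (comb c p q) (comb c p q) = ip2 p p + 2 * c * ip2 p q + c ^+ 2 * ip2 q q.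
Proof.
move=> [p1 p2] [q1 q2]; rewrite /ip2 /comb/= !ip_sqrD//; ring.
Qed.

Lemma ip2_ge0 p : 0 <= ip2 p p.
Proof. by rewrite addr_ge0// ip_ge0. Qed.

Lemma ip2_combl c p q r : sqint2 p -> sqint2 q -> sqint2 r ->
  ip2 (comb c p q) r = ip2 p r + c * ip2 q r.
Proof.
move=> [p1 p2] [q1 q2] [r1 r2]; rewrite /ip2 /comb/= !ipDl//; [|exact: sqintZ..].
by rewrite !ipZl//; ring.
Qed.

(** A sequence of S minimising the distance to F at rate 16^-n is Cauchy by
    the parallelogram identity; minimality makes F minus its limit orthogonal
    to S. The sequence itself is part of the conclusion because properties of
    S reach its closure through it. *)
Lemma projection2 (S : set V) F : subspace2 S -> sqint2 F ->
  exists (s : nat -> V) (a : V), [/\ forall n, S (s n), sqint2 a,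
    ipn mu (fun x => (s n).1 x - a.1 x) @[n --> \oo] --> (0 : R),
    ipn mu (fun x => (s n).2 x - a.2 x) @[n --> \oo] --> (0 : R) &
    forall p, S p -> ip2 (comb (-1) F a) p = 0].
Proof.
move=> [S0 Ss Sc] sF.
pose D p := ip2 (comb (-1) F p) (comb (-1) F p).
pose E := [set D p | p in S].
have E0 : has_inf E.
  split; first by exists (D (fun=> 0, fun=> 0)); eexists; first exact: S0.
  by exists 0 => _ [p _ <-]; exact: ip2_ge0.
pose del := inf E.
have Dle p : S p -> del <= D p.
  by move=> Sp; apply: ge_inf; [case: E0|exists p].
have ex n : exists p, S p /\ D p <= del + (16 ^+ n)^-1.
  have e0 : 0 < (16 ^+ n)^-1 :> R by rewrite invr_gt0 exprn_gt0.
  by have [_ [p Sp <-] /ltW] := inf_adherent e0 E0; exists p.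
have [s Hs] := choice ex.
have Sn n : S (s n) by case: (Hs n).
have sn n : sqint2 (s n) by apply/Ss/Sn.
have stp n : ip2 (comb (-1) (s n.+1) (s n)) (comb (-1) (s n.+1) (s n)) <= 4 / 16 ^+ n.
  pose X := comb (-1) F (s n); pose Y := comb (-1) F (s n.+1).
  have sX : sqint2 X by apply: sqint2_comb.
  have sY : sqint2 Y by apply: sqint2_comb.
  have e1 : ip2 (comb (-1) (s n.+1) (s n)) (comb (-1) (s n.+1) (s n)) =
      ip2 (comb (-1) X Y) (comb (-1) X Y).
    by congr (_ + _); congr ip; apply/funext => x; rewrite /comb/=; ring.
  (* The midpoint of s n and s n.+1, written with the one closure operation of
      S. *)
  pose m := comb (2^-1) (comb (2^-1) (fun=> 0, fun=> 0) (s n)) (s n.+1).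
  have Sm : S m by apply: (Sc) => //; apply: (Sc).
  pose Z := comb 1 X Y.
  have e2 : D m = 4^-1 * ip2 Z Z.
    have sZ : sqint2 Z by exact: sqint2_comb.
    have -> : D m = ip2 (comb (-(2^-1)) Z Z) (comb (-(2^-1)) Z Z).
      by congr (_ + _); congr ip; apply/funext => x; rewrite /Z /m /comb/=; field.
    by rewrite ip2_sqrD//; field.
  have := Dle _ Sm; rewrite e2 e1 (ip2_sqrD 1 sX sY) (ip2_sqrD (-1) sX sY).
  have [_] := Hs n; have [_] := Hs n.+1; rewrite /D -/X -/Y exprS.
  have : 0 < (16 ^+ n)^-1 :> R by rewrite invr_gt0 exprn_gt0.
  rewrite invfM; set h := (16 ^+ n)^-1; set xx := ip2 X X; set yy := ip2 Y Y.
  set xy := ip2 X Y; clearbody h xx yy xy del; lra.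
have [a [sa _ ca]] : exists a, [/\ sqint mu a,
    {ae mu, forall x, (s n).1 x @[n --> \oo] --> a x} &
    ipn mu (fun x => (s n).1 x - a x) @[n --> \oo] --> (0 : R)].
  apply: (@sqint_complete _ _ _ mu (fun n => (s n).1) 4) => n; first by case: (sn n).
  apply: le_trans (stp n); rewrite /ip2 /comb/=.
  under [X in ipn _ X]funext do rewrite -mulN1r.
  by rewrite /ipn lerDl ip_ge0.
have [b [sb _ cb]] : exists b, [/\ sqint mu b,
    {ae mu, forall x, (s n).2 x @[n --> \oo] --> b x} &
    ipn mu (fun x => (s n).2 x - b x) @[n --> \oo] --> (0 : R)].
  apply: (@sqint_complete _ _ _ mu (fun n => (s n).2) 4) => n; first by case: (sn n).
  apply: le_trans (stp n); rewrite /ip2 /comb/=.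
  under [X in ipn _ X]funext do rewrite -mulN1r.
  by rewrite /ipn lerDr ip_ge0.
exists s, (a, b); split => // p Sp.
have sp := Ss _ Sp; have [sp1 sp2] := sp.
have sab : sqint2 (a, b) by [].
have c1 : ip2 (comb (-1) F (s n)) p @[n --> \oo] --> ip2 (comb (-1) F (a, b)) p.
  rewrite ip2_combl//; under eq_fun do rewrite ip2_combl//.
  apply: cvgD; first exact: cvg_cst.
  apply: cvgMr; apply: cvgD; apply: ip_cvg => // n; by case: (sn n).
have c2 : ip2 (comb (-1) F (s n)) p @[n --> \oo] --> (0 : R).
  apply: (@lim_sqr _ _ (fun n => (16 ^+ n)^-1) _ (ip2 p p)).
    (* Near-minimality of s n along the direction p. *)
    move=> n; rewrite subr0; apply: quad_disc => t.
    have := Dle _ (Sc (- t) _ _ (Sn n) Sp); rewrite /D.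
    have -> : ip2 (comb (-1) F (comb (- t) (s n) p)) (comb (-1) F (comb (- t) (s n) p)) =
       ip2 (comb t (comb (-1) F (s n)) p) (comb t (comb (-1) F (s n)) p).
      by congr (_ + _); congr ip; apply/funext => x; rewrite /comb/=; ring.
    rewrite ip2_sqrD//; last exact: sqint2_comb.
    by have [_] := Hs n; rewrite /D; lra.
  under eq_fun do rewrite -exprVn.
  by apply: cvg_expr; rewrite ger0_norm; lra.
exact: (cvg_unique _ c1 c2).
Qed.

End projection.

(** * Poincare inequality on dyadic cells *)

Section boxes.
Context {R : realType} {d : nat}.
Local Notation T := ('rV[R]_d).
Local Notation mu := (@lebesgue_rV R d).
Local Notation rect := (('I_d -> R) * ('I_d -> R))%type.
Implicit Types (B : rect) (i j : 'I_d) (u g : T -> R).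

Definition setc (f : 'I_d -> R) i (v : R) : 'I_d -> R :=
  fun j => if j == i then v else f j.

Definition mid B i := (B.1 i + B.2 i) / 2.

Definition cutl i B : rect := (B.1, setc B.2 i (mid B i)).
Definition cutr i B : rect := (setc B.1 i (mid B i), B.2).

Definition rbox B : set T := box B.1 B.2.

Definition nondeg B := forall j, B.1 j < B.2 j.

Definition vol B : R := \prod_j (B.2 j - B.1 j).

Definition mass u B : R := ip mu u (\1_(rbox B)).

Definition sqmass u B : R := \int[mu]_x (\1_(rbox B) x * u x ^+ 2).

(** The squared distance in L2(B) from u to the constants, by [variance_subc].
    *)
Definition variance u B : R := sqmass u B - mass u B ^+ 2 / vol B.

Lemma vol_gt0 B : nondeg B -> 0 < vol B.
Proof. by move=> nB; apply: prodr_gt0 => j _; rewrite subr_gt0. Qed.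

Lemma ip_rbox B : nondeg B -> ip mu (\1_(rbox B)) (\1_(rbox B)) = vol B.
Proof.
move=> nB; rewrite /ip.
have -> : \int[mu]_x (\1_(rbox B) x * \1_(rbox B) x) = \int[mu]_(x in rbox B) 1.
  rewrite [RHS]Rint_indic; congr Rintegral; apply/funext => x.
  by rewrite indicE; case: (_ \in _); rewrite ?mulr1 ?mulr0.
rewrite Rintegral_cst; last exact: measurable_box.
rewrite mul1r (_ : vol B = fine (vol B)%:E)//; congr fine.
by apply: box_vol => j; exact/ltW.
Qed.

Lemma nondeg_mid B i : nondeg B -> B.1 i < mid B i < B.2 i.
Proof. by move=> nB; have := nB i; rewrite /mid; lra. Qed.

Lemma nondeg_cutl i B : nondeg B -> nondeg (cutl i B).
Proof.
move=> nB j; rewrite /cutl/= /setc; case: eqP => [->|_]; last exact: nB.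
by have /andP[] := nondeg_mid i nB.
Qed.

Lemma nondeg_cutr i B : nondeg B -> nondeg (cutr i B).
Proof.
move=> nB j; rewrite /cutr/= /setc; case: eqP => [->|_]; last exact: nB.
by have /andP[] := nondeg_mid i nB.
Qed.

Lemma vol_cutl i B : vol (cutl i B) = vol B / 2.
Proof.
rewrite /vol (bigD1 i)//= [in RHS](bigD1 i)//= /setc eqxx.
rewrite (eq_bigr (fun j => B.2 j - B.1 j)); last by move=> j /negbTE ->.
by rewrite /mid; field.
Qed.

Lemma vol_cutr i B : vol (cutr i B) = vol B / 2.
Proof.
rewrite /vol (bigD1 i)//= [in RHS](bigD1 i)//= /setc eqxx.
rewrite (eq_bigr (fun j => B.2 j - B.1 j)); last by move=> j /negbTE ->.
by rewrite /mid; field.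
Qed.

Lemma slab_eq i a b a' b' : (forall j, j != i -> a j = a' j) ->
  (forall j, j != i -> b j = b' j) -> slab i a b = slab i a' b' :> set T.
Proof.
move=> aa bb; apply/seteqP; split => x H j ji; have := H j ji.
  by rewrite aa// bb.
by rewrite aa// bb.
Qed.

Lemma cut_indic i B x : nondeg B ->
  \1_(rbox B) x = \1_(rbox (cutl i B)) x + \1_(rbox (cutr i B)) x :> R.
Proof.
move=> nB; rewrite /rbox !(boxE i)/=.
rewrite (@slab_eq i B.1 (setc _ _ _) B.1 B.2)//; last first.
  by move=> j /negbTE ji; rewrite /setc ji.
rewrite (@slab_eq i (setc _ _ _) B.2 B.1 B.2)//; last first.
  by move=> j /negbTE ji; rewrite /setc ji.
rewrite -mulrDr /setc eqxx; congr (_ * _).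
have /andP[m1 m2] := nondeg_mid i nB.
rewrite !indicE -natrD; congr (_%:R).
have M (a b t : R) : (t \in (`]a, b]%classic : set R)) = (a < t <= b).
  by apply/idP/idP => [/set_mem|H]; [|apply/mem_set]; rewrite /= in_itv.
rewrite !M; case: (leP (x 0 i) (mid B i)); case: (ltP (B.1 i) (x 0 i));
  case: (leP (x 0 i) (B.2 i)) => //= *; exfalso; lra.
Qed.

Lemma sqint_rbox B : sqint mu (\1_(rbox B) : T -> R).
Proof. exact: sqint_box. Qed.

Lemma mass_cut i u B : sqint mu u -> nondeg B ->
  mass u B = mass u (cutl i B) + mass u (cutr i B).
Proof.
move=> su nB; rewrite /mass -ipDr//; [|exact: sqint_rbox..].
by congr ip; apply/funext => x; exact: cut_indic.
Qed.

Lemma integ_rbox_sq u B : sqint mu u -> integ mu (fun x => \1_(rbox B) x * u x ^+ 2).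
Proof.
move=> su; have := sqint_mul (sqint_ind (measurable_box B.1 B.2) su) su.
by under [X in integ _ X]funext do rewrite -mulrA -expr2.
Qed.

Lemma sqmass_cut i u B : sqint mu u -> nondeg B ->
  sqmass u B = sqmass u (cutl i B) + sqmass u (cutr i B).
Proof.
move=> su nB; rewrite /sqmass -RintegralD//; [|exact: integ_rbox_sq..].
by apply: eq_Rintegral => x _; rewrite (cut_indic i)// mulrDl.
Qed.

(** The mean over B is the average of the means over its halves, so bisecting
    loses only the contribution of their difference. *)
Lemma variance_cut i u B : sqint mu u -> nondeg B ->
  variance u B = variance u (cutl i B) + variance u (cutr i B) +
    (mass u (cutl i B) - mass u (cutr i B)) ^+ 2 / vol B.
Proof.
move=> su nB; rewrite /variance (mass_cut i su nB) (sqmass_cut i su nB).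
rewrite vol_cutl vol_cutr; have v0 := lt0r_neq0 (vol_gt0 nB).
by field.
Qed.

Lemma sqmass_ge0 u B : 0 <= sqmass u B.
Proof. by apply: Rintegral_ge0 => x _; rewrite mulr_ge0// sqr_ge0. Qed.

Lemma mass_sq_le u B : sqint mu u -> nondeg B -> mass u B ^+ 2 <= sqmass u B * vol B.
Proof.
move=> su nB; pose v x := \1_(rbox B) x * u x.
have sv : sqint mu v by apply: sqint_ind => //; exact: measurable_box.
have -> : mass u B = ip mu v (\1_(rbox B)).
  apply: eq_Rintegral => x _; rewrite /v indicE.
  by case: (_ \in _); rewrite ?mulr1 ?mul1r ?mulr0.
have -> : sqmass u B = ip mu v v.
  apply: eq_Rintegral => x _; rewrite /v indicE.
  by case: (_ \in _); rewrite ?mul1r ?mul0r ?mulr0.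
by rewrite -ip_rbox//; apply: cauchy_schwarz_ip => //; exact: sqint_rbox.
Qed.

Lemma variance_subc u B c : sqint mu u -> nondeg B ->
  variance u B <= \int[mu]_x (\1_(rbox B) x * (u x - c) ^+ 2).
Proof.
move=> su nB.
have v0 := vol_gt0 nB.
have -> : \int[mu]_x (\1_(rbox B) x * (u x - c) ^+ 2) =
    sqmass u B - 2 * c * mass u B + c ^+ 2 * vol B.
  have i1 := integ_rbox_sq B su.
  have i2 := sqint_mul su (sqint_rbox B).
  have i3 := sqint_mul (sqint_rbox B) (sqint_rbox B).
  rewrite -(ip_rbox nB) /sqmass /mass /ip -!RintegralZl// -RintegralB//; last exact: integZ.
  rewrite -RintegralD//; [|exact: integB (integZ _ _)|exact: integZ].
  apply: eq_Rintegral => x _; rewrite indicE.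
  by case: (_ \in _) => /=; ring.
rewrite /variance -subr_ge0.
have -> : sqmass u B - 2 * c * mass u B + c ^+ 2 * vol B -
   (sqmass u B - mass u B ^+ 2 / vol B) = (mass u B - c * vol B) ^+ 2 / vol B.
  by field; rewrite gt_eqF.
by rewrite divr_ge0 ?sqr_ge0// ltW.
Qed.

Lemma itv_succ_cvg (a b t : R) :
  \1_(`]a, b + k.+1%:R^-1]%classic : set R) t @[k --> \oo] -->
  (\1_(`]a, b]%classic : set R) t : R).
Proof.
have M (a' b' : R) : (t \in (`]a', b']%classic : set R)) = (a' < t <= b').
  by apply/idP/idP => [/set_mem|H]; [|apply/mem_set]; rewrite /= in_itv.
apply: cvg_near_cst; rewrite indicE M.
have [ta|ta] := boolP (a < t); last first.
  by apply: nearW => k; rewrite indicE M (negbTE ta).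
have [tb|tb] := leP t b.
  by apply: nearW => k; rewrite indicE M ta /= (le_trans tb)// lerDl invr_ge0.
have : @harmonic R k @[k --> \oo] --> (0:R) by exact: cvg_harmonic.
have tb0 : 0 < t - b by lra.
move=> /cvgrPdist_lt/(_ _ tb0); apply: filterS => k.
rewrite sub0r normrN ger0_norm ?invr_ge0// -[X in X < _]/(k.+1%:R^-1) => H.
by rewrite indicE M ta leNgt -ltrBrDl H.
Qed.

Lemma cvgn_ext (v w : R^nat) (l : R) : (forall k, v k = w k) ->
  v k @[k --> \oo] --> l -> w k @[k --> \oo] --> l.
Proof. by move=> /funext ->. Qed.

Lemma mass_bump_cvg i u B (l : R) : sqint mu u -> B.2 i - B.1 i = l ->
  ip mu u (slab_fun i B.1 B.2 (fun t => bump l k (t - B.1 i))) @[k --> \oo] --> mass u B.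
Proof.
move=> su <-.
have c1 : continuous (fun _ : R => 1 : R) by move=> x; exact: cvg_cst.
have := @slab_fun_bump_cvg R d i B.1 B.2 (fun=> 1) u c1 su.
have -> : \int[mu]_x (\1_(box B.1 B.2) x * (1 * u x)) = mass u B.
  by congr Rintegral; apply/funext => x; rewrite mul1r mulrC.
apply: cvgn_ext => k; congr (ip _ _ (slab_fun _ _ _ _)).
by apply/funext => t; rewrite mul1r.
Qed.

(** The function with slope 1 on the left half of B and - 1 on the right half
    is a tent of height l, half the side of B in direction i. Testing the weak
    derivative on it bounds the difference of the masses by l times the L1
    norm of g over B, to which Cauchy-Schwarz applies. The tent is a limit of
    primitives of differences of bumps. *)
Lemma cut_mass_diff i u g B : sqint mu u -> sqint mu g -> slab_weak i u g -> nondeg B ->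
  (mass u (cutl i B) - mass u (cutr i B)) ^+ 2 <=
  ((B.2 i - B.1 i) / 2) ^+ 2 * vol B * sqmass g B.
Proof.
move=> su sg W nB; set l := (B.2 i - B.1 i) / 2.
have l0 : 0 < l by have := nB i; rewrite /l; lra.
pose h k : R := k.+1%:R^-1.
have h0 k : 0 <= h k by rewrite invr_ge0.
(* The approximate tents spill over B by h k in direction i. *)
pose Bk k := box B.1 (setc B.2 i (B.2 i + h k)) : set T.
have key k : `|ip mu u (slab_fun i B.1 B.2 (fun t => bump l k (t - B.1 i) - bump l k (t - mid B i)))|
   <= (l + h k) * ip mu (fun x => `|g x|) (\1_(Bk k)).
  have [P [dP P0 Pb Pl]] := bump_prim k l0.
  pose r t := P (t - B.1 i) - P (t - mid B i).
  pose r' t := bump l k (t - B.1 i) - bump l k (t - mid B i).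
  have dr : has_deriv r r'.
    move=> x; apply: is_deriveB; exact: (has_deriv_shift _ dP).
  have sr' : smooth1 r'.
    apply: smooth1D; first exact: smooth1_shift (smooth1_bump _ _).
    have := smooth1Z (-1) (smooth1_shift (mid B i) (smooth1_bump l k)).
    by congr smooth1; apply/funext => t; rewrite mulN1r.
  have m1 : mid B i - B.1 i = l by rewrite /mid /l; field.
  have m2 : B.2 i - mid B i = l by rewrite /mid /l; field.
  have Sr t : ~~ (B.1 i < t <= B.2 i + h k) -> r t = 0.
    rewrite negb_and -leNgt -ltNge /r => /orP[ta|tb].
      by rewrite !P0 ?subrr//; lra.
    by rewrite Pl 1?[in P (t - mid _ _)]Pl ?subrr// -/(h k); have := h0 k; lra.
  have tt : test1 r r'.
    apply: (@test1_intro _ _ _ (B.1 i) (B.2 i + h k)) => //.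
    - exact: smooth1_prim dr sr'.
    - by have := nB i; have := h0 k; lra.
    - by move=> t H; apply: Sr; apply: contra H => /andP[/ltW -> ->].
  have br t : `|r t| <= l + h k.
    have := Pb (t - B.1 i); have := Pb (t - mid B i).
    by rewrite ler_norml -/(h k) /r => /andP[? ?] /andP[? ?]; lra.
  rewrite (W _ _ tt) normrN.
  have sw := sqint_slab_fun i B.1 B.2 tt.
  apply: le_trans (le_normr_Rintegral measurableT (sqint_mul sg sw)) _.
  rewrite -ipZr; [|exact: sqint_box|exact: sqint_norm].
  apply: le_Rintegral => //.
  - exact: (integrable_norm (sqint_mul sg sw)).
  - by apply: sqint_mul; [exact: sqint_norm|apply: sqintZ; exact: sqint_box].
  - move=> x _; rewrite normrM ler_wpM2l// /Bk (boxE i) /slab_fun.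
    rewrite (@slab_eq i _ (setc _ _ _) B.1 B.2)//; last first.
      by move=> j /negbTE ji; rewrite /setc ji.
    rewrite /setc eqxx normrM mulrCA ger0_norm// ler_wpM2l//.
    have [xx|xx] := boolP (B.1 i < x 0 i <= B.2 i + h k); last first.
      by rewrite Sr// normr0 mulr_ge0// addr_ge0// ltW.
    by rewrite indicE mem_set ?mulr1//= in_itv.
have c1 : ip mu u (slab_fun i B.1 B.2 (fun t => bump l k (t - B.1 i) - bump l k (t - mid B i)))
    @[k --> \oo] --> mass u (cutl i B) - mass u (cutr i B).
  have m1 : mid B i - B.1 i = l by rewrite /mid /l; field.
  have m2 : B.2 i - mid B i = l by rewrite /mid /l; field.
  have L1 := @mass_bump_cvg i u (cutl i B) l su.
  have L2 := @mass_bump_cvg i u (cutr i B) l su.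
  rewrite /= /setc eqxx in L1 L2; apply: (cvgn_ext _ (cvgB (L1 m1) (L2 m2))) => k /=.
  have sb c : sqint mu (slab_fun i B.1 B.2 (fun t => bump l k (t - c))).
    by have [q tq] := test1_bump l k c; exact: (sqint_slab_fun _ _ _ tq).
  rewrite -[X in _ = X](_ : ip mu u (fun x => slab_fun i B.1 B.2 (fun t => bump l k (t - B.1 i)) x
      - slab_fun i B.1 B.2 (fun t => bump l k (t - mid B i)) x) = _); last first.
    by congr ip; apply/funext => x; rewrite /slab_fun -mulrBr.
  rewrite ipBr//; congr (_ - _); rewrite /slab_fun.
    by rewrite (@slab_eq i _ (setc B.2 i (mid B i)) B.1 B.2)// => j /negbTE ji; rewrite /setc ji.
  by rewrite (@slab_eq i (setc B.1 i (mid B i)) _ B.1 B.2)// => j /negbTE ji; rewrite /setc ji.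
have c2 : (l + h k) * ip mu (fun x => `|g x|) (\1_(Bk k)) @[k --> \oo] -->
    (l + 0) * mass (fun x => `|g x|) B.
  apply: cvgM; first by apply: cvgD; [exact: cvg_cst|exact: cvg_harmonic].
  have indE k x : \1_(Bk k) x = \1_(slab i B.1 B.2) x *
      \1_(`]B.1 i, B.2 i + k.+1%:R^-1]%classic : set R) (x 0 i) :> R.
    rewrite /Bk (boxE i) /setc eqxx; congr (\1_(_) _ * _).
    by apply: slab_eq => // j /negbTE ji; rewrite ji.
  have [] := @Rdominated _ T R mu (fun k x => `|g x| * \1_(Bk k) x)
    (fun x => `|g x| * \1_(rbox B) x) (fun x => `|g x| * \1_(Bk 0) x) => //.
  - move=> k; apply: measurable_funM; first by apply: measurableT_comp => //; case: sg.
    exact: measurable_indic (measurable_box _ _).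
  - move=> x; apply: cvgMr; rewrite /rbox (boxE i).
    by under eq_fun do rewrite indE; apply: cvgMr; exact: itv_succ_cvg.
  - move=> k x; rewrite normrM normr_id ler_wpM2l// ger0_norm//.
    rewrite !indE ler_wpM2l// !indicE; case: (boolP (_ \in (`]B.1 i, B.2 i + k.+1%:R^-1]%classic : set R))) => // /set_mem H.
    rewrite mem_set//; move: H; rewrite /= !in_itv/= => /andP[-> /le_trans]; apply.
    by rewrite lerD2l invr1 invf_le1// ler1n.
  - by apply: sqint_mul; [exact: sqint_norm|exact: sqint_box].
have : `|mass u (cutl i B) - mass u (cutr i B)| <= l * mass (fun x => `|g x|) B.
  rewrite -[l]addr0; move/cvg_norm : c1 => c1.
  apply: ler_cvg_to c1 c2 _; exact: nearW.
rewrite -(@ler_pXn2r _ 2) ?nnegrE//; last first.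
  apply: mulr_ge0; first exact: ltW.
  by apply: Rintegral_ge0 => x _; rewrite mulr_ge0.
rewrite real_normK ?num_real// => /le_trans; apply.
rewrite exprMn -mulrA ler_wpM2l ?sqr_ge0//.
have -> : sqmass g B = sqmass (fun x => `|g x|) B.
  by apply: eq_Rintegral => x _; rewrite real_normK ?num_real.
rewrite mulrC; apply: mass_sq_le => //; exact: sqint_norm.
Qed.

Lemma variance_cut_le i u g B : sqint mu u -> sqint mu g -> slab_weak i u g -> nondeg B ->
  variance u B <= variance u (cutl i B) + variance u (cutr i B) +
    ((B.2 i - B.1 i) / 2) ^+ 2 * sqmass g B.
Proof.
move=> su sg W nB; rewrite (variance_cut i su nB) lerD2l ler_pdivrMr ?vol_gt0//.
by rewrite mulrAC; exact: cut_mass_diff.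
Qed.

Variables (L : R) (L0 : 0 < L) (i0 : 'I_d).

Definition dir (n : nat) : 'I_d := insubd i0 (n %% d)%N.

(** The side in direction i after n bisections: the exponent counts the steps
    before n that are congruent to i modulo d. *)
Definition side (n : nat) (i : nat) : R := 2 * L / 2 ^+ ((n + (d.-1 - i)) %/ d)%N.

(** The cells of level n are numbered by k < 2^n; the last bit of k tells
    which half of its parent a cell is. *)
Fixpoint dyadic (n : nat) : nat -> rect :=
  if n is n'.+1 then
    fun k => if odd k then cutr (dir n') (dyadic n' k./2) else cutl (dir n') (dyadic n' k./2)
  else fun=> (fun=> - L, fun=> L).

Local Notation cube := (dyadic 0 0).

Let d_gt0 : (0 < d)%N. Proof. by case: d i0 => // -[]. Qed.

Lemma dirE n : (dir n = n %% d :> nat)%N.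
Proof. by rewrite /dir val_insubd ltn_mod d_gt0. Qed.

Lemma sideS n (i : 'I_d) : side n.+1 i = if i == dir n then side n i / 2 else side n i.
Proof.
rewrite /side addSn divnS//.
have id := ltn_ord i.
have -> : (d %| (n + (d.-1 - i)).+1)%N = (i == dir n).
  have -> : ((n + (d.-1 - i)).+1 = n + d - i)%N by move: d_gt0; lia.
  rewrite -eqn_mod_dvd; last by lia.
  by rewrite modnDr (modn_small id) -val_eqE/= dirE eq_sym.
by case: eqP => _; rewrite ?add1n ?add0n// exprS invfM mulrA mulrAC.
Qed.

Lemma dyadic_nondeg n k : (k < 2 ^ n)%N -> nondeg (dyadic n k) /\ forall i, (dyadic n k).2 i - (dyadic n k).1 i = side n i.
Proof.
elim: n k => [|n IH] k kn.
  split=> [j|i]; first by change (- L < L); have := L0; lra.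
  rewrite /side add0n divn_small ?expr0 ?divr1; first by rewrite /=; ring.
  by rewrite (leq_ltn_trans (leq_subr _ _))// prednK.
have k2 : (k./2 < 2 ^ n)%N by rewrite -ltn_double -(mul2n (2 ^ n)) -expnS (leq_ltn_trans _ kn)// -[leqRHS]odd_double_half leq_addl.
have [nB sB] := IH _ k2.
split=> [|i]; first by rewrite /=; case: ifP => _; [exact: nondeg_cutr|exact: nondeg_cutl].
rewrite sideS -sB /=; case: ifP => _ /=; rewrite /setc; case: ifP => // /eqP ->; rewrite /mid; by field.
Qed.

Lemma sum_double (F : nat -> R) n :
  \sum_(0 <= k < 2 ^ n.+1) F k = \sum_(0 <= k < 2 ^ n) (F k.*2 + F k.*2.+1).
Proof.
rewrite expnS mul2n; elim: (2 ^ n)%N => [|m IH]; first by rewrite !big_geq.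
by rewrite doubleS !big_nat_recr//= IH addrA.
Qed.

Lemma dyadicS_even n k : dyadic n.+1 k.*2 = cutl (dir n) (dyadic n k).
Proof. by rewrite /= odd_double doubleK. Qed.

Lemma dyadicS_odd n k : dyadic n.+1 k.*2.+1 = cutr (dir n) (dyadic n k).
Proof. by rewrite /= odd_double/= uphalf_double. Qed.

Lemma dyadic_indic n x : \sum_(0 <= k < 2 ^ n) \1_(rbox (dyadic n k)) x =
  \1_(rbox cube) x :> R.
Proof.
elim: n => [|n IH]; first by rewrite expn0 big_nat1.
rewrite sum_double -IH; apply: eq_big_nat => k /andP[_ kn].
by rewrite dyadicS_even dyadicS_odd -cut_indic//; have [] := dyadic_nondeg kn.
Qed.

Lemma dyadic_uniq (n : nat) x (j k : nat) : (j < 2 ^ n)%N -> (k < 2 ^ n)%N ->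
  rbox (dyadic n j) x -> rbox (dyadic n k) x -> j = k.
Proof.
move=> jn kn xj xk; apply/eqP; apply: contraT => jk.
have := dyadic_indic n x; rewrite big_mkord (bigD1 (Ordinal jn))//=.
rewrite (bigD1 (Ordinal kn))/=; last by rewrite -val_eqE/= eq_sym.
rewrite !indicE (mem_set xj) (mem_set xk) => H.
have : 1 + (1 + 0) <= (x \in rbox cube)%:R :> R.
  by rewrite -H; do 2 rewrite lerD//; exact: sumr_ge0.
by case: (_ \in _) => /=; lra.
Qed.

Lemma dyadic_sqmass n u : sqint mu u ->
  \sum_(0 <= k < 2 ^ n) sqmass u (dyadic n k) = sqmass u cube.
Proof.
move=> su; rewrite /sqmass -Rint_sum; last by move=> k; exact: integ_rbox_sq.
by apply: eq_Rintegral => x _; rewrite -mulr_suml dyadic_indic.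
Qed.

Definition totvar u n : R := \sum_(0 <= k < 2 ^ n) variance u (dyadic n k).

Lemma totvarS u (g : 'I_d -> T -> R) n : sqint mu u -> (forall i, sqint mu (g i)) ->
  (forall i, slab_weak i u (g i)) ->
  totvar u n <= totvar u n.+1 + (side n (dir n) / 2) ^+ 2 * sqmass (g (dir n)) cube.
Proof.
move=> su sg W; rewrite /totvar sum_double -(dyadic_sqmass n (sg _)) mulr_sumr -big_split.
apply: ler_sum_nat => k /andP[_ kn]; rewrite dyadicS_even dyadicS_odd.
have [nB sB] := dyadic_nondeg kn; rewrite -sB.
exact: variance_cut_le.
Qed.

Definition energy_cube (g : 'I_d -> T -> R) : R := \sum_i sqmass (g i) cube.

Lemma energy_cube_ge i (g : 'I_d -> T -> R) : sqmass (g i) cube <= energy_cube g.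
Proof.
by rewrite /energy_cube (bigD1 i)//= lerDl; apply: sumr_ge0 => j _; exact: sqmass_ge0.
Qed.

Lemma side_le (n K : nat) (i : 'I_d) : (K * d <= n)%N -> 0 <= side n i / 2 <= L / 2 ^+ K.
Proof.
move=> Kn; have p0 m : 0 < 2 ^+ m :> R by rewrite exprn_gt0.
rewrite /side; set m := (_ %/ d)%N.
have Km : (K <= m)%N by rewrite leq_divRL// (leq_trans Kn)// leq_addr.
rewrite (_ : 2 * L / 2 ^+ m / 2 = L / 2 ^+ m); last by field; rewrite gt_eqF.
rewrite divr_ge0 ?(ltW L0) ?(ltW (p0 _))//= ler_pM2l// lef_pV2 ?posrE//.
by rewrite ler_eXn2l// ltr1n.
Qed.

(** A round of d bisections cuts every direction once; in round K all
    half-sides are at most L / 2^K. *)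
Lemma totvar_round u (g : 'I_d -> T -> R) K : sqint mu u -> (forall i, sqint mu (g i)) ->
  (forall i, slab_weak i u (g i)) ->
  totvar u (K * d)%N <= totvar u (K.+1 * d)%N + d%:R * (L ^+ 2 / 4 ^+ K * energy_cube g).
Proof.
move=> su sg W; rewrite mulSn addnC; set N := (K * d)%N.
suff H r : (r <= d)%N -> totvar u N <= totvar u (N + r)%N + r%:R * (L ^+ 2 / 4 ^+ K * energy_cube g).
  exact: H.
elim: r => [|r IH] rd; first by rewrite addn0 mul0r addr0.
apply: (le_trans (IH (ltnW rd))); rewrite addnS -(natr1 r) mulrDl mul1r.
suff : totvar u (N + r)%N <= totvar u (N + r).+1 + L ^+ 2 / 4 ^+ K * energy_cube g.
  by set x := totvar _ _; set y := totvar _ _; set z := _ * energy_cube g; lra.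
apply: (le_trans (totvarS (N + r) su sg W)); rewrite lerD2l.
have /andP[s0 s1] := @side_le (N + r) K (dir (N + r)) (leq_addr _ _).
have E := energy_cube_ge (dir (N + r)) g.
apply: ler_pM => //; [exact: sqr_ge0|exact: sqmass_ge0|].
rewrite (_ : L ^+ 2 / 4 ^+ K = (L / 2 ^+ K) ^+ 2); first by rewrite lerXn2r ?nnegrE// (le_trans s0).
by rewrite expr_div_n -exprM mulnC exprM; congr (_ / _ ^+ _); ring.
Qed.

Lemma energy_cube_ge0 (g : 'I_d -> T -> R) : 0 <= energy_cube g.
Proof. by apply: sumr_ge0 => j _; exact: sqmass_ge0. Qed.

Lemma totvar_tail u (g : 'I_d -> T -> R) K m : sqint mu u -> (forall i, sqint mu (g i)) ->
  (forall i, slab_weak i u (g i)) ->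
  totvar u (K * d)%N <= totvar u ((K + m) * d)%N +
    d%:R * L ^+ 2 * energy_cube g * (2 / 4 ^+ K).
Proof.
move=> su sg W; set c := d%:R * L ^+ 2 * energy_cube g.
have c0 : 0 <= c.
  by rewrite mulr_ge0 ?energy_cube_ge0// mulr_ge0// sqr_ge0.
have p0 (j : nat) : 0 < (4 ^+ j)^-1 :> R by rewrite invr_gt0 exprn_gt0.
suff : totvar u (K * d)%N <= totvar u ((K + m) * d)%N + c * (2 / 4 ^+ K - 2 / 4 ^+ (K + m)).
  move/le_trans; apply; rewrite lerD2l ler_wpM2l// gerBl.
  by rewrite mulr_ge0// ltW.
elim: m => [|m IH]; first by rewrite addn0 subrr mulr0 addr0.
apply: (le_trans IH); rewrite addnS.
have := totvar_round (K + m) su sg W.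
rewrite (_ : d%:R * _ = c / 4 ^+ (K + m)); last by rewrite /c; ring.
rewrite exprS invfM; have := p0 (K + m)%N; set h := (4 ^+ (K + m))^-1 => h0.
have : 0 <= c * h by rewrite mulr_ge0// ltW.
set k := (4 ^+ K)^-1; clearbody c h k; nra.
Qed.

Definition const_on n (f : T -> R) := exists c : nat -> R,
  forall k, (k < 2 ^ n)%N -> forall x, rbox (dyadic n k) x -> f x = c k.

Lemma cut_sub i B x : nondeg B ->
  rbox (cutl i B) x \/ rbox (cutr i B) x -> rbox B x.
Proof.
move=> nB [] H j; have := H j; have /andP[m1 m2] := nondeg_mid i nB;
  rewrite /= !in_itv/= /setc; case: eqP => [->|//] /andP[h1 h2].
  by rewrite h1 (le_trans h2)// ltW.
by rewrite h2 (lt_trans m1).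
Qed.

Lemma half_lt k n : (k < 2 ^ n.+1)%N -> (k./2 < 2 ^ n)%N.
Proof.
move=> kn; rewrite -ltn_double -(mul2n (2 ^ n)) -expnS (leq_ltn_trans _ kn)//.
by rewrite -[leqRHS]odd_double_half leq_addl.
Qed.

Lemma const_onS n f : const_on n f -> const_on n.+1 f.
Proof.
move=> [c Hc]; exists (fun k => c k./2) => k kn x xk.
apply: Hc; first exact: half_lt.
have [nB _] := dyadic_nondeg (half_lt kn).
apply: (@cut_sub (dir n)) => //.
by move: xk; rewrite /=; case: ifP => _; [right|left].
Qed.

Lemma const_on_le n m f : (n <= m)%N -> const_on n f -> const_on m f.
Proof.
move=> nm H; rewrite -(subnKC nm); elim: (m - n)%N => [|k IH]; first by rewrite addn0.
by rewrite addnS; exact: const_onS.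
Qed.

Lemma totvar_const u f n : sqint mu u -> sqint mu f -> const_on n f ->
  totvar u n <= sqmass (fun x => u x - f x) cube.
Proof.
move=> su sf [c Hc]; rewrite -(dyadic_sqmass n (sqintB su sf)).
apply: ler_sum_nat => k /andP[_ kn]; have [nB _] := dyadic_nondeg kn.
apply: (le_trans (variance_subc (c k) su nB)).
rewrite le_eqVlt; apply/orP; left; apply/eqP; congr Rintegral; apply/funext => x.
have [xB|xB] := pselect (rbox (dyadic n k) x); first by rewrite (Hc k kn x xB).
by rewrite indicE memNset// !mul0r.
Qed.

Lemma side_small (e : R) : 0 < e -> exists N, forall n, (N <= n)%N -> forall i : 'I_d, side n i < e.
Proof.
move=> e0.
have : (2 * L) * 2^-1 ^+ n @[n --> \oo] --> (2 * L) * 0.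
  by apply: cvgMr; apply: cvg_expr; rewrite ger0_norm; lra.
rewrite mulr0 => /cvgrPdist_lt/(_ _ e0)[K _ HK].
exists (K * d)%N => n Kn i; have /andP[_] := side_le i Kn.
have := HK K (leqnn K); rewrite /= sub0r normrN exprVn => /(le_lt_trans (ler_norm _)).
set z := (2 ^+ K)^-1; set s := side n i; clearbody z s => h1 h2.
rewrite (_ : s = 2 * (s / 2)); last by field.
by apply: le_lt_trans h1; lra.
Qed.

(** The sides of the cells tend to 0, so the cells whose lower corner lies
    beyond al fill the part of the cube inside the orthant at al. *)
Lemma cells_ae0 (h : T -> R) : sqint mu h ->
  (forall n k, (k < 2 ^ n)%N -> ip mu h (\1_(rbox (dyadic n k))) = 0) ->
  {ae mu, forall x, \1_(rbox cube) x * h x = 0}.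
Proof.
move=> sh H; have ih : integ mu (fun x => \1_(rbox cube) x * h x).
  by apply: sqint_mul => //; exact: sqint_rbox.
apply: orthant_ae0 => // al; rewrite Rint_indic.
pose inside n k := [forall j, al j <= (dyadic n k).1 j].
pose f n x := \sum_(0 <= k < 2 ^ n) (inside n k)%:R * (h x * \1_(rbox (dyadic n k)) x).
have ifk n k : integ mu (fun x => (inside n k)%:R * (h x * \1_(rbox (dyadic n k)) x)).
  by apply: integZ; apply: sqint_mul => //; exact: sqint_rbox.
have f0 n : \int[mu]_x f n x = 0.
  rewrite Rint_sum//; rewrite big_nat_cond big1// => k /andP[/andP[_ kn] _].
  rewrite RintegralZl//; last by apply: sqint_mul => //; exact: sqint_rbox.
  by have := H n k kn; rewrite /ip => ->; rewrite mulr0.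
have fl n x : `|f n x| <= \1_(rbox cube) x * `|h x|.
  rewrite /f -(dyadic_indic n) mulr_suml.
  apply: le_trans (ler_norm_sum _ _ _) _; apply: ler_sum => k _.
  rewrite !normrM (ger0_norm (_ : 0 <= \1_(rbox (dyadic n k)) x :> R))//.
  rewrite mulrC -mulrA [leRHS]mulrC ler_wpM2l// ler_piMr//.
  by rewrite ger0_norm// lern1; case: (inside n k).
have [] := @Rdominated _ T R mu f (fun x => \1_(orthant al) x * (\1_(rbox cube) x * h x))
  (fun x => \1_(rbox cube) x * `|h x|).
- by move=> n; apply: integ_meas; exact: integ_sum.
- move=> x.
  have [xo|xo] := pselect (orthant al x); last first.
    rewrite indicE memNset// mul0r; apply: cvg_near_cst; apply: nearW => n.
    rewrite /f big1// => k _; rewrite /inside; case: forallP => [Hk|_]; last by rewrite mul0r.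
    rewrite indicE memNset ?mulr0// => xB; apply: xo => j.
    have := xB j; rewrite /= !in_itv/= andbT => /andP[+ _].
    by apply: le_lt_trans; exact: Hk.
  rewrite indicE mem_set// mul1r.
  have [e e0 He] : exists2 e : R, 0 < e & forall j, al j + e <= x 0 j.
    have p0 j : 0 < (x 0 j - al j)^-1.
      by rewrite invr_gt0 subr_gt0; have := xo j; rewrite /= in_itv/= andbT.
    have S0 : 0 <= \sum_j (x 0 j - al j)^-1 by apply: sumr_ge0 => j _; exact: ltW.
    exists (1 + \sum_j (x 0 j - al j)^-1)^-1; first by rewrite invr_gt0; lra.
    move=> j; rewrite addrC -lerBrDr -[leRHS]invrK lef_pV2 ?posrE//; last by lra.
    rewrite (bigD1 j)//= addrCA lerDl addr_ge0//.
    by apply: sumr_ge0 => k _; exact: ltW.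
  have [N HN] := side_small e0.
  apply: cvg_near_cst; exists N => // n /= Nn.
  rewrite -(dyadic_indic n) mulr_suml /f; apply: eq_big_nat => k /andP[_ kn].
  have [xB|xB] := pselect (rbox (dyadic n k) x); last first.
    by rewrite indicE memNset// mulr0 mulr0 mul0r.
  rewrite (_ : inside n k = true) ?mul1r; first by rewrite mulrC.
  apply/forallP => j; have [_ sB] := dyadic_nondeg kn.
  have := xB j; rewrite /= in_itv/= => /andP[_ xb].
  have := HN n Nn j; have := sB j; have := He j; lra.
- exact: fl.
- by apply: sqint_mul; [exact: sqint_rbox|exact: sqint_norm].
move=> _; under eq_fun do rewrite f0.
by move=> /(cvg_unique _ (cvg_cst 0)) <-.
Qed.

(** The total variance at level n is at most the squared distance to any
    function constant on the cells of level n, and such step functions, for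
    all n, are dense on the cube: what is orthogonal to all of them vanishes
    by [cells_ae0]. *)
Lemma totvar_small u e : sqint mu u -> 0 < e ->
  exists n, forall m, (n <= m)%N -> totvar u m <= e.
Proof.
move=> su e0.
pose S : set ((T -> R) * (T -> R)) :=
  [set p | [/\ p.2 = (fun=> 0), sqint mu p.1 & exists n, const_on n p.1]].
have sS : subspace2 mu S.
  split.
  - split => //; first exact: sqint0.
    by exists 0%N, (fun=> 0).
  - by move=> p [p2 sp _]; split => //; rewrite p2; exact: sqint0.
  - move=> c p q [p2 sp [n Hn]] [q2 sq [m Hm]]; split.
    + by rewrite /comb/= p2 q2; apply/funext => x; rewrite mulr0 addr0.
    + by apply: sqintD => //; exact: sqintZ.
    + exists (maxn n m); have [a Ha] := const_on_le (leq_maxl n m) Hn.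
      have [b Hb] := const_on_le (leq_maxr n m) Hm.
      by exists (fun k => a k + c * b k) => k kn x xk; rewrite /comb/= (Ha k)// (Hb k).
have su0 : sqint2 mu (u, fun=> 0) by split => //; exact: sqint0.
have [s [a [Ss [sa1 sa2] cs _ Ho]]] := projection2 sS su0.
pose h := (comb (-1) (u, fun=> 0) a).1.
have sh : sqint mu h by apply: sqintD => //; exact: sqintZ.
have h0 : {ae mu, forall x, \1_(rbox cube) x * h x = 0}.
  apply: cells_ae0 => // n k kn.
  have : S (\1_(rbox (dyadic n k)) : T -> R, fun=> 0).
    split => //; first exact: sqint_rbox.
    exists n, (fun j : nat => (j == k)%:R) => j jn x xj.
    rewrite /= indicE; congr (nat_of_bool _)%:R; apply/idP/eqP => [/set_mem xk|<-].
      exact: dyadic_uniq xj xk.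
    exact/mem_set.
  move=> /Ho; rewrite /ip2/= => <-.
  by rewrite [X in _ + X](_ : _ = 0) ?addr0//; rewrite /ip; under eq_Rintegral do rewrite mulr0; rewrite Rintegral_cst// mul0r.
have [N _ HN] := (cvgrPdist_lt _ _).1 cs _ e0.
have [_ ss [n Hn]] := Ss N.
exists n => m nm; apply: (le_trans (totvar_const su ss (const_on_le nm Hn))).
have : ipn mu (fun x => (s N).1 x - a.1 x) < e.
  by have := HN N (leqnn N); rewrite /= sub0r normrN => /(le_lt_trans (ler_norm _)).
move=> /ltW; apply: le_trans.
rewrite /sqmass (@ae_Rint _ _ _ _ _ (fun x => \1_(rbox cube) x * ((s N).1 x - a.1 x) ^+ 2)).
- rewrite /ipn /ip; apply: le_Rintegral => //.
  + exact: integ_rbox_sq (sqintB ss sa1).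
  + by apply: sqint_mul; exact: sqintB.
  + move=> x _; rewrite -expr2 indicE; case: (_ \in _); rewrite ?mul1r ?mul0r//.
    exact: sqr_ge0.
- by apply: integ_meas; exact: integ_rbox_sq (sqintB su ss).
- by apply: integ_meas; exact: integ_rbox_sq (sqintB ss sa1).
- apply: filterS h0 => x; rewrite /h /comb/= indicE.
  by case: (_ \in _); rewrite ?mul0r// !mul1r => E; have -> : u x = a.1 x; [lra|ring].
Qed.

(** Bisection is stopped at the end of a round K. The total variance left at
    that stage is the sum of what later bisections lose, since it tends to 0
    in the end, hence at most a geometric tail times the Dirichlet integral.
    The rest of the mass comes from the means over the cells, which are
    finitely many coefficients. *)
Lemma finite_rank_cube (e : R) : 0 < e -> exists (N : nat) (w : nat -> T -> R),
  (forall k, sqint mu (w k)) /\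
  forall u (g : 'I_d -> T -> R), sqint mu u -> (forall i, sqint mu (g i)) ->
    (forall i, slab_weak i u (g i)) ->
  sqmass u cube <= e * (\sum_i ipn mu (g i)) + \sum_(0 <= k < N) ip mu u (w k) ^+ 2.
Proof.
move=> e0.
have : (d%:R * L ^+ 2 * 2) * 4^-1 ^+ n @[n --> \oo] --> (d%:R * L ^+ 2 * 2) * 0.
  by apply: cvgMr; apply: cvg_expr; rewrite ger0_norm; lra.
rewrite mulr0 => /cvgrPdist_lt/(_ _ e0)[K _ /(_ K (leqnn K))].
rewrite /= sub0r normrN => /(le_lt_trans (ler_norm _)) HK.
pose c k := Num.sqrt (vol (dyadic (K * d) k))^-1.
exists (2 ^ (K * d))%N, (fun k x => c k * \1_(rbox (dyadic (K * d) k)) x); split.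
  by move=> k; apply: sqintZ; exact: sqint_rbox.
move=> u g su sg W.
have -> : sqmass u cube = totvar u (K * d)%N +
    \sum_(0 <= k < 2 ^ (K * d)) ip mu u (fun x => c k * \1_(rbox (dyadic (K * d) k)) x) ^+ 2.
  rewrite -(dyadic_sqmass (K * d) su) /totvar -big_split/=; apply: eq_big_nat => k /andP[_ kn].
  have [nB _] := dyadic_nondeg kn.
  rewrite ipZr//; last exact: sqint_rbox.
  rewrite exprMn sqr_sqrtr ?invr_ge0 ?(ltW (vol_gt0 nB))//.
  by rewrite /variance /mass; ring.
rewrite lerD2r.
have E0 : energy_cube g <= \sum_i ipn mu (g i).
  apply: ler_sum => i _; apply: le_Rintegral => //.
  - exact: integ_rbox_sq.
  - exact: sqint_mul.
  - move=> x _; rewrite -expr2 indicE; case: (_ \in _); rewrite ?mul1r ?mul0r//.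
    exact: sqr_ge0.
apply/ler_addgt0Pr => e1 e10.
have [n Hn] := totvar_small su e10.
have := totvar_tail K n su sg W.
have := Hn _ (leq_trans (leq_addl K n) (leq_pmulr _ d_gt0)).
have : d%:R * L ^+ 2 * energy_cube g * (2 / 4 ^+ K) <= e * (\sum_i ipn mu (g i)).
  rewrite (_ : _ * (2 / _) = (d%:R * L ^+ 2 * 2 * 4^-1 ^+ K) * energy_cube g); last by rewrite exprVn; ring.
  apply: ler_pM => //; last exact: ltW.
    by rewrite !mulr_ge0 ?exprn_ge0 ?sqr_ge0 ?invr_ge0// ltW.
  exact: energy_cube_ge0.
lra.
Qed.

End boxes.

(** * Skew-symmetry of weak derivatives *)

Section skew.
Context {R : realType} {d : nat}.
Local Notation T := ('rV[R]_d).
Local Notation mu := (@lebesgue_rV R d).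
Local Notation leb := (@lebesgue_measure R).

Lemma integral_restricted_measure dd (X : measurableType dd) (m : {measure set X -> \bar R})
    (A : set X) (mA : measurable A) (f : X -> \bar R) : measurable_fun setT f ->
  (\int[mrestr m mA]_x f x = \int[m]_(x in A) f x)%E.
Proof.
move=> mf.
transitivity (\int[mrestr m mA]_(x in A) f x)%E; last first.
  by apply: eq_measure_integral => B mB BA; rewrite /= /mrestr setIidl.
rewrite [RHS]integral_mkcond; apply: ae_eq_integral => //.
  apply/(measurable_restrictT f mA); exact: measurable_funTS.
exists (~` A); split.
- exact: measurableC.
- by rewrite /= /mrestr setICl measure0.
- move=> x /=; apply: contra_not => Ax _; by rewrite patchE mem_set.
Qed.

(** The image under the i-th coordinate of Lebesgue measure restricted to a
    slab is a multiple of Lebesgue measure on the line. *)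
Lemma coord_slab_integral i a b (f : R -> R) :
  measurable_fun setT f -> leb.-integrable setT (EFin \o f) ->
  exists2 c : R, 0 <= c & \int[mu]_x slab_fun i a b f x = c * \int[leb]_t f t.
Proof.
move=> mf fi.
pose A := slab i a b : set T.
have mA : measurable A := measurable_slab i a b.
pose co (x : T) : measurableTypeR R := x 0 i.
have mco : measurable_fun setT co := measurable_coord i.
pose nu := pushforward (mrestr mu mA) co.
pose c := (\prod_(j | j != i) lebesgue_measure (`]a j, b j]%classic : set R))%E.
have c0 : (0 <= c)%E by apply: prode_ge0.
have cfin : c \is a fin_num.
  apply: prode_fin_num => j _; rewrite lebesgue_measure_itv/=.
  by case: ifP => // _; rewrite -EFinB.
have nuE B : measurable B -> nu B = (c * leb B)%E.
  move=> mB; rewrite /nu /pushforward /mrestr.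
  have -> : co @^-1` B `&` A = [set x : T | forall j,
      (if j == i then B else `]a j, b j]%classic : set R) (x 0 j)].
    apply/seteqP; split => x /=.
      by move=> [xB xA] j; case: ifPn => [/eqP ->//|/xA].
    move=> H; split; first by have := H i; rewrite eqxx.
    by move=> j ji; have := H j; rewrite (negbTE ji).
  rewrite (@lebesgue_rV_box R d (fun j => if j == i then B else `]a j, b j]%classic)); last first.
    by move=> j; case: ifP => _//; exact: measurable_itv.
  rewrite (bigD1 i)//= eqxx muleC; congr (_ * _)%E.
  by apply: eq_bigr => j /negbTE ->.
exists (fine c); first exact: fine_ge0.
rewrite /Rintegral -fineM//; last exact: (integrable_fin_num measurableT fi).
congr fine.
have mfE : measurable_fun setT (EFin \o f) by exact/measurable_EFinP.
transitivity (\int[mu]_(x in A) ((EFin \o f) \o co) x)%E.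
  rewrite [RHS]integral_mkcond; apply: eq_integral => x _.
  by rewrite patchE /slab_fun indicE; case: ifPn => _; rewrite ?mul1r ?mul0r.
rewrite -(integral_restricted_measure mu mA); last exact: measurableT_comp mfE mco.
have cp g : (forall x, 0 <= g x)%E -> measurable_fun setT g ->
    (\int[mrestr mu mA]_x (g \o co) x = c * \int[leb]_t g t)%E.
  move=> g0 mg.
  have := @ge0_integral_pushforward _ _ T (measurableTypeR R) R co mco (mrestr mu mA) setT g measurableT mg.
  rewrite preimage_setT => <- //.
  pose k : {nonneg R} := NngNum (fine_ge0 c0).
  rewrite (@eq_measure_integral _ _ _ setT (mscale k leb)); last first.
    by move=> B mB _; rewrite /= /mscale /= fineK//; exact: nuE.
  rewrite ge0_integral_mscale//= ?fineK//.
have fp := integral_funepos_lt_pinfty measurableT fi.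
have fn := integral_funeneg_lt_pinfty measurableT fi.
have fnf : (\int[leb]_t ((EFin \o f)^\-)%E t)%E \is a fin_num.
  by rewrite ge0_fin_numE//; apply: integral_ge0 => x _; exact: funeneg_ge0.
rewrite [LHS]integralE [X in _ = (c * X)%E]integralE muleBr//; last first.
  by rewrite fin_num_adde_defl// fin_numN.
congr (_ - _)%E.
- have mpos : measurable_fun setT ((EFin \o f)^\+)%E by exact: measurable_funepos.
  apply: (etrans _ (cp _ (fun t => funepos_ge0 (EFin \o f) t) mpos)).
  by apply: eq_integral => x _; rewrite /= ?funeposE ?funenegE.
- have mneg : measurable_fun setT ((EFin \o f)^\-)%E by exact: measurable_funeneg.
  apply: (etrans _ (cp _ (fun t => funeneg_ge0 (EFin \o f) t) mneg)).
  by apply: eq_integral => x _; rewrite /= ?funeposE ?funenegE.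
Qed.

Lemma deriv_integral0 (r r' : R -> R) : test1 r r' ->
  leb.-integrable setT (EFin \o r') /\ \int[leb]_t r' t = 0.
Proof.
move=> rr'; have [M [al [be [ab rM rM' S S']]]] := test1_bounded rr'.
have [sr dr _] := rr'.
have cr' := smooth1_cont (smooth1_deriv_of sr dr).
have ii : integ leb r'.
  apply: (@le_integ _ (measurableTypeR R) R leb r' (fun t => M * \1_(`[al, be]%classic : set R) t)).
  - exact: continuous_measurable_fun.
  - move=> t; rewrite indicE; have [tt|tt] := boolP (al <= t <= be).
      by rewrite mem_set ?mulr1//= in_itv.
    by rewrite S'// normr0 mulr_ge0// (le_trans _ (rM 0)).
  - by apply: integZ; exact: (@integrable_indic_itv R al be true false).
split => //.
have ab1 : al - 1 < be + 1 by lra.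
have := @continuous_FTC2 R r' r (al - 1) (be + 1) ab1.
move=> /(_ (continuous_subspaceT cr')).
have dd : derivable_oo_LRcontinuous r (al - 1) (be + 1).
  have cr := has_deriv_cont dr.
  split.
  - by move=> x _; have [] := dr x.
  - by apply: cvg_at_right_filter; exact: cr.
  - by apply: cvg_at_left_filter; exact: cr.
move=> /(_ dd).
have r'E : {in `](al - 1), (be + 1)[, r^`()%classic =1 r'}.
  by move=> x _; rewrite derive1E; have [_] := dr x.
move=> /(_ r'E); rewrite !S; last 2 first.
  by rewrite negb_and -!ltNge; apply/orP; left; lra.
  by rewrite negb_and -!ltNge; apply/orP; right; lra.
rewrite -EFinB subrr => E.
rewrite -[RHS](congr1 fine E) /Rintegral; congr fine.
rewrite [RHS]integral_mkcond; apply: eq_integral => t _; rewrite patchE.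
case: ifPn => // /negP nt; rewrite S'//; apply: contra_notN nt => /andP[h1 h2].
by apply/mem_set; rewrite /= in_itv/=; lra.
Qed.

Lemma slab_fun_deriv0 i a b r r' : test1 r r' -> \int[mu]_x slab_fun i a b r' x = 0.
Proof.
move=> rr'; have [ii i0] := deriv_integral0 rr'.
have [sr dr _] := rr'.
have mr : measurable_fun setT r'.
  exact: continuous_measurable_fun (smooth1_cont (smooth1_deriv_of sr dr)).
by have [c _ ->] := coord_slab_integral i a b mr ii; rewrite i0 mulr0.
Qed.

Lemma slab_setI i (a b a' b' : 'I_d -> R) (x : T) : \1_(slab i a b) x * \1_(slab i a' b') x =
  \1_(slab i (fun j => Num.max (a j) (a' j)) (fun j => Num.min (b j) (b' j))) x :> R.
Proof.
rewrite !indicE -natrM mulnb; congr (nat_of_bool _)%:R.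
apply/andP/idP => [[/set_mem h /set_mem h']|/set_mem h].
  apply/mem_set => j ji; have := h j ji; have := h' j ji.
  by rewrite /= !in_itv/= gt_max le_min => /andP[-> ->] /andP[-> ->].
split; apply/mem_set => j ji; have := h j ji;
  by rewrite /= !in_itv/= gt_max le_min => /andP[/andP[? ?] /andP[? ?]]; apply/andP.
Qed.

Lemma test1_mul (r r' q q' : R -> R) : test1 r r' -> test1 q q' ->
  test1 (fun t => r t * q t) (fun t => r t * q' t + q t * r' t).
Proof.
move=> [sr dr [al [be [ab S S']]]] [sq dq _].
apply: (test1_intro (a := al) (b := be)) => //.
- exact: smooth1M.
- exact: has_derivM.
- by move=> t /S ->; rewrite mul0r.
Qed.

Local Notation V := ((T -> R) * (T -> R))%type.

(** For pairs made of functions u, v and their derivatives in one variable,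
    the integral of the derivative of u v: the defect of integration by parts.
    *)
Definition twist (p q : V) : R := ip mu p.1 q.2 + ip mu p.2 q.1.

Definition slab_pairs i : set V := [set p | exists r r' a b, test1 r r' /\ p = (slab_fun i a b r, slab_fun i a b r')].

Lemma slab_pairs_sqint i p : slab_pairs i p -> sqint2 mu p.
Proof.
by move=> [r [r' [a [b [tr ->]]]]]; split; [exact: sqint_slab_fun tr|exact: sqint_slab_fun' tr].
Qed.

(** The product of two slab functions is again one, over the intersection of
    the slabs, and the derivative of a compactly supported function has
    integral 0. *)
Lemma twist_slab_pairs i p q : slab_pairs i p -> slab_pairs i q -> twist p q = 0.
Proof.
move=> gp gq; have [p1 p2] := slab_pairs_sqint gp; have [q1 q2] := slab_pairs_sqint gq.
move: gp gq p1 p2 q1 q2 => [r [r' [a [b [tr ->]]]]] [q0 [q0' [a' [b' [tq ->]]]]] /= p1 p2 q1 q2.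
rewrite /twist/= /ip -RintegralD//; [|exact: sqint_mul..].
rewrite -[RHS](slab_fun_deriv0 i (fun j => Num.max (a j) (a' j)) (fun j => Num.min (b j) (b' j)) (test1_mul tr tq)).
congr Rintegral; apply/funext => x; rewrite /slab_fun -slab_setI; ring.
Qed.

Inductive spanned (G : set V) : V -> Prop :=
| spanned0 : spanned G (fun=> 0, fun=> 0)
| spanned_add c p q : spanned G p -> G q -> spanned G (comb c p q).

Lemma spanned_sub i : subspace2 mu (spanned (slab_pairs i)).
Proof.
split; first exact: spanned0.
- move=> p; elim=> [|c q q' _ sq gq]; first by split; exact: sqint0.
  by apply: sqint2_comb => //; exact: slab_pairs_sqint gq.
- move=> c p q sp; elim=> [|c' q' g' _ IH gg].
    have -> : comb c p (fun=> 0, fun=> 0) = p => //.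
    by rewrite /comb/= {3}(surjective_pairing p); congr pair; apply/funext => x; rewrite mulr0 addr0.
  have -> : comb c p (comb c' q' g') = comb (c * c') (comb c p q') g'.
    by rewrite /comb/=; congr pair; apply/funext => x; ring.
  exact: spanned_add.
Qed.

Lemma twist_combl c p q r : sqint2 mu p -> sqint2 mu q -> sqint2 mu r ->
  twist (comb c p q) r = twist p r + c * twist q r.
Proof.
move=> [p1 p2] [q1 q2] [r1 r2]; rewrite /twist /comb/= !ipDl//; [|exact: sqintZ..].
by rewrite !ipZl//; ring.
Qed.

Lemma twistC p q : twist p q = twist q p.
Proof. by rewrite /twist addrC ipC (ipC _ p.1). Qed.

Lemma ip0l (f : T -> R) : ip mu (fun=> 0) f = 0.
Proof.
rewrite /ip (_ : (fun x => 0 * f x) = fun=> 0) ?Rintegral_cst ?mul0r//.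
by apply/funext => x; rewrite mul0r.
Qed.

Lemma twist_spanned i p q : sqint2 mu p -> (forall g, slab_pairs i g -> twist p g = 0) ->
  spanned (slab_pairs i) q -> twist q p = 0.
Proof.
move=> sp H; elim=> [|c q' g sq IH gg].
  by rewrite /twist !ip0l addr0.
have [_ Ss _] := spanned_sub i.
rewrite twist_combl//; [|exact: Ss|exact: slab_pairs_sqint gg].
by rewrite IH (twistC g) H// mulr0 addr0.
Qed.

Lemma slab_weak_twist i u g : slab_weak i u g -> forall p, slab_pairs i p -> twist (u, g) p = 0.
Proof.
by move=> W _ [r [r' [a [b [tr ->]]]]]; rewrite /twist/= (W _ _ tr) addNr.
Qed.

Lemma expR_cvg0 (c : R) : c * expR (- k%:R) @[k --> \oo] --> (0 : R).
Proof.
rewrite -[X in _ --> X](mulr0 c); apply: cvgMr.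
apply: (@squeeze_cvgr _ _ _ _ (cst 0) (@harmonic R)).
- apply: nearW => k /=; rewrite expR_ge0/= expRN lef_pV2 ?posrE ?expR_gt0 ?ltr0n//.
  by rewrite -natr1 addrC; exact: expR_ge1Dx.
- exact: cvg_cst.
- exact: cvg_harmonic.
Qed.

(** In weak form, y solves dy/dx_i = s y, so e^(- s x_i) y has derivative 0 in
    x_i and the same integral over all translates of a box in direction i.
    Translated to where the exponential decays, this integral tends to 0 by
    Cauchy-Schwarz, since y is in L2. *)
Lemma deficiency0 i (s : R) (y : T -> R) : s = 1 \/ s = -1 -> sqint mu y ->
  (forall p, slab_pairs i p -> ip mu y (fun x => p.2 x + s * p.1 x) = 0) ->
  {ae mu, forall x, y x = 0}.
Proof.
move=> s1 sy H.
pose w (t : R) := expR (- s * t).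
have cw : continuous w.
  by move=> t; apply: continuous_comp; [exact: mulrl_continuous|exact: continuous_expR].
have cwx : continuous (fun t => - s * t) by exact: mulrl_continuous.
have dw : has_deriv w (fun t => - s * w t).
  move=> t; rewrite mulrC; apply: is_derive1_comp.
  by rewrite -[X in is_derive _ _ _ X]mulr1; exact: is_deriveZ.
have sw : smooth1 w.
  have := smooth1_affine (- s) 0 (@smooth1_expR R).
  by congr smooth1; apply/funext => t; rewrite addr0.
have mwx := measurable_coord_fun i cw.
pose h (x : T) := w (x 0 i) * y x.
have box_bound (a b : 'I_d -> R) : exists2 M : R, 0 <= M & forall x, box a b x -> `|w (x 0 i)| <= M.
  exists (expR (`|a i| + `|b i|)); first exact: expR_ge0.
  move=> x /(_ i); rewrite /= in_itv/= => /andP[ax xb].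
  rewrite ger0_norm ?expR_ge0// ler_expR.
  have := ler_norm (- a i); have := ler_norm (b i); rewrite normrN.
  have := normr_ge0 (a i); have := normr_ge0 (b i).
  by case: s1 => ->; lra.
have hi (a b : 'I_d -> R) : integ mu (fun x => \1_(box a b) x * h x).
  have [M M0 HM] := box_bound a b.
  apply: (@le_integ _ _ _ _ _ (fun x => M * (\1_(box a b) x * `|y x|))).
  - apply: measurable_funM; first exact: measurable_indic (measurable_box _ _).
    by apply: measurable_funM => //; case: sy.
  - move=> x; rewrite indicE; case: (boolP (x \in _)) => [/set_mem xb|_].
      by rewrite !mul1r normrM ler_wpM2r// HM.
    by rewrite !mul0r normr0 mulr0.
  - by apply: integZ; apply: sqint_mul; [exact: sqint_box|exact: sqint_norm].
apply: (@filterS _ _ _ (fun x => h x = 0)).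
  by move=> x /eqP; rewrite /h mulf_eq0 gt_eqF ?expR_gt0//= => /eqP.
apply: box_ae0 => // a b.
have [ab|ba] := ltP (a i) (b i); last first.
  rewrite (_ : (fun x => _) = fun=> 0) ?Rintegral_cst ?mul0r//.
  apply/funext => x; rewrite indicE memNset ?mul0r// => /(_ i).
  by rewrite /= in_itv/= => /andP[/lt_le_trans h1 /h1]; rewrite ltNge ba.
set l := b i - a i; have l0 : 0 < l by rewrite subr_gt0.
(* Translation by s N, towards the decay of e^(- s x_i). *)
pose sh (f : 'I_d -> R) (N : nat) j := if j == i then f j + s * N%:R else f j.
pose G N := \int[mu]_x (\1_(box (sh a N) (sh b N)) x * h x).
have GG N : \int[mu]_x (\1_(box a b) x * h x) = G N.
  have slabN r : slab_fun i (sh a N) (sh b N) r = slab_fun i a b r.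
    rewrite /slab_fun (_ : slab i (sh a N) (sh b N) = slab i a b)//.
    apply/seteqP; split => x xs j ji; have := xs j ji; by rewrite /sh (negbTE ji).
  have c1 := @slab_fun_bump_cvg R d i a b w y cw sy.
  have c2 := @slab_fun_bump_cvg R d i (sh a N) (sh b N) w y cw sy.
  apply: (etrans (esym (cvg_lim (@Rhausdorff R) c1))).
  apply: (etrans _ (cvg_lim (@Rhausdorff R) c2)).
  apply: (congr1 (fun q : nat -> R => limn q)); apply/funext => k; apply/eqP; rewrite -subr_eq0; apply/eqP.
  rewrite slabN /sh eqxx; set c := a i + s * N%:R.
  rewrite (_ : b i + s * N%:R - c = l); last by rewrite /c /l; ring.
  have [P [dP P0 Pb Pl]] := bump_prim k l0.
  (* A compactly supported primitive of the difference of two translated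
      bumps; tested with e^(- s t) r(t), the hypothesis on y only sees e^(- s
      t) r'(t). *)
  pose r t := P (t - c) - P (t - a i).
  pose r' t := bump l k (t - c) - bump l k (t - a i).
  have dr : has_deriv r r'.
    by move=> x; apply: is_deriveB; exact: (has_deriv_shift _ dP).
  have sb cc : smooth1 (fun t => bump l k (t - cc)) by exact: smooth1_shift (smooth1_bump _ _).
  have sr' : smooth1 r'.
    apply: smooth1D => //; have := smooth1Z (-1) (sb (a i)).
    by congr smooth1; apply/funext => t; rewrite mulN1r.
  pose al := Num.min c (a i); pose be := Num.max c (a i) + l + k.+1%:R^-1.
  have Sr t : ~~ (al <= t <= be) -> r t = 0.
    rewrite negb_and -!ltNge /al /be /r lt_min => /orP[/andP[t1 t2]|].
      by rewrite !P0 ?subrr//; lra.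
    rewrite -addrA -ltrBrDr gt_max => /andP[t1 t2].
    have q0 : 0 < k.+1%:R^-1 :> R by rewrite invr_gt0.
    by rewrite (Pl (t - c)) ?(Pl (t - a i)) ?subrr//; move: q0 t1 t2; set q := k.+1%:R^-1; clearbody q; lra.
  have albe : al <= be.
    have : 0 < k.+1%:R^-1 :> R by rewrite invr_gt0.
    have : al <= c by rewrite ge_min lexx.
    have : c <= Num.max c (a i) by rewrite le_max lexx.
    by rewrite /be; set q := k.+1%:R^-1; set mm := Num.max _ _; set m' := al; clearbody q mm m'; lra.
  have tt : test1 (fun t => w t * r t) (fun t => w t * r' t + r t * (- s * w t)).
    apply: (test1_intro (a := al) (b := be)) => //.
    - by apply: smooth1M => //; exact: smooth1_prim dr sr'.
    - exact: has_derivM.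
    - by move=> t /Sr ->; rewrite mulr0.
  have gp : slab_pairs i (slab_fun i a b (fun t => w t * r t), slab_fun i a b (fun t => w t * r' t + r t * (- s * w t))).
    by do 4 eexists; split; first exact: tt.
  have sbk cc : sqint mu (slab_fun i a b (fun t => w t * bump l k (t - cc))).
    have [q tq] := test1_bump l k cc; have [_ dq [x1 [x2 [x12 Sq _]]]] := tq.
    apply: (@sqint_slab_fun _ _ _ _ _ _ (fun t => w t * q t + bump l k (t - cc) * (- s * w t))).
    apply: (test1_intro (a := x1) (b := x2)) => //.
    - exact: smooth1M.
    - exact: has_derivM.
    - by move=> t /Sq ->; rewrite mulr0.
  apply/eqP; rewrite -oppr_eq0 opprB; apply/eqP.
  rewrite -ipBr// -[RHS](H _ gp); congr ip; apply/funext => x /=.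
  by rewrite /slab_fun /r'; ring.
have sab : sqint mu (fun x => `|y x|) by exact: sqint_norm.
pose M := expR (`|a i| + `|b i|).
have muN N : mu (box (sh a N) (sh b N)) = mu (box a b).
  rewrite (@lebesgue_rV_box R d (fun j => `]sh a N j, sh b N j]%classic)); last by move=> j; exact: measurable_itv.
  rewrite (@lebesgue_rV_box R d (fun j => `]a j, b j]%classic)); last by move=> j; exact: measurable_itv.
  apply: eq_bigr => j _; rewrite !lebesgue_measure_itv/= /sh !lte_fin; case: eqP => // _.
  by rewrite ltrD2r; case: ifP => // _; rewrite -!EFinB; congr EFin; ring.
have Gb N : G N ^+ 2 <= (M ^+ 2 * (ipn mu (fun x => `|y x|) * fine (mu (box a b)))) * expR (- N%:R).
  have e0 := expR_ge0 (- N%:R : R).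
  pose B := box (sh a N) (sh b N) : set T.
  have le1 : `|G N| <= M * expR (- N%:R) * ip mu (fun x => `|y x|) (\1_B).
    apply: (le_trans (le_normr_Rintegral measurableT (hi _ _))).
    rewrite /ip -RintegralZl//; last by apply: sqint_mul => //; exact: sqint_box.
    apply: le_Rintegral => //.
    - exact: (integrable_norm (hi _ _)).
    - by apply: integZ; apply: sqint_mul => //; exact: sqint_box.
    - move=> x _; rewrite /B indicE; case: (boolP (x \in _)) => [/set_mem xB|_]; last first.
        by rewrite mul0r normr0 !mulr0.
      rewrite mul1r mulr1 normrM ler_wpM2r// ger0_norm ?expR_ge0// -expRD ler_expR.
      have := xB i; rewrite /= in_itv/= /sh eqxx => /andP[ax xb].
      have := ler_norm (- a i); have := ler_norm (b i); rewrite normrN.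
      have := normr_ge0 (a i); have := normr_ge0 (b i); move: ax xb.
      by case: s1 => ->; set n := N%:R; lra.
  have cs := cauchy_schwarz_ip sab (sqint_box (sh a N) (sh b N)).
  have i1 : ip mu (\1_B) (\1_B) = fine (mu (box a b)).
    rewrite -(muN N) -[RHS]mul1r -Rintegral_cst; last exact: measurable_box.
    rewrite [RHS]Rint_indic; congr Rintegral; apply/funext => x.
    by rewrite indicE; case: (_ \in _); rewrite ?mulr1 ?mulr0.
  rewrite -/B i1 in cs.
  rewrite -[G N ^+ 2]real_normK ?num_real//.
  apply: (@le_trans _ _ ((M * expR (- N%:R) * ip mu (fun x => `|y x|) (\1_B)) ^+ 2)).
    by rewrite lerXn2r ?nnegrE// (le_trans _ le1).
  have e1 : expR (- N%:R) <= 1 :> R by rewrite -expR0 ler_expR oppr_le0.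
  have AB0 : 0 <= ipn mu (fun x => `|y x|) * fine (mu (box a b)).
    by apply: mulr_ge0; [exact: ip_ge0|exact: fine_ge0].
  move: cs AB0 e0 e1; rewrite -/(ipn mu _).
  set e := expR _; set P := ip _ _ _; set AB := _ * fine _.
  clearbody e P AB; move=> cs AB0 e0 e1.
  rewrite (_ : (M * e * P) ^+ 2 = M ^+ 2 * (P ^+ 2 * (e * e))); last by ring.
  rewrite -mulrA; apply: ler_wpM2l; first exact: sqr_ge0.
  by apply: ler_pM => //; [exact: sqr_ge0|exact: mulr_ge0|rewrite ler_piMl].
set I := \int[mu]_x _; set K := _ ^+ 2 * _ in Gb.
have I0 : I ^+ 2 <= 0.
  rewrite -(cvg_lim _ (expR_cvg0 K))//; apply: limr_ge.
    by apply/cvg_ex; eexists; exact: expR_cvg0.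
  by apply: nearW => N; rewrite /I (GG N).
by apply/eqP; rewrite -sqrf_eq0 eq_le I0 sqr_ge0.
Qed.

(** The argument that a skew-symmetric operator with trivial deficiency spaces
    is essentially skew-adjoint. Project (u, g) onto the closed span of the
    slab pairs. The residual (b, b') is orthogonal to the slab pairs, and its
    twist with them is 0 because this holds both for (u, g) and for the
    projection; by [deficiency0] b + b' and b - b' vanish. So (u, g) is a
    limit of combinations of slab pairs, whose twist with (v, k) is 0 by the
    definition of weak derivatives. *)
Lemma slab_weak_skew i u g v k : sqint mu u -> sqint mu g -> sqint mu v -> sqint mu k ->
  slab_weak i u g -> slab_weak i v k -> ip mu u k + ip mu g v = 0.
Proof.
move=> su sg sv sk Wu Wv.
have sub := spanned_sub i; have [_ Ss _] := sub.
have sF : sqint2 mu (u, g) by [].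
have [s [a [Hs sa c1 c2 Ho]]] := projection2 sub sF.
have [sa1 sa2] := sa.
have tvs q : spanned (slab_pairs i) q -> twist q (v, k) = 0.
  by move=> sq; apply: (@twist_spanned i (v, k)) => //; exact: slab_weak_twist.
have lim_twist q : sqint2 mu q -> twist (s n) q @[n --> \oo] --> twist a q.
  move=> [q1 q2]; apply: cvgD; apply: ip_cvg => // n; by have [] := Ss _ (Hs n).
have tag q : slab_pairs i q -> twist a q = 0.
  move=> gq; have := lim_twist _ (slab_pairs_sqint gq).
  under eq_fun do rewrite (twist_spanned (slab_pairs_sqint gq) (fun g' gg => twist_slab_pairs gq gg) (Hs _)).
  by move=> /(cvg_unique _ (cvg_cst 0)) <-.
pose H := comb (-1) (u, g) a.
have sH : sqint2 mu H by exact: sqint2_comb.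
have [sH1 sH2] := sH.
have tH q : slab_pairs i q -> twist H q = 0.
  move=> gq; rewrite twist_combl//; last exact: slab_pairs_sqint gq.
  by rewrite (slab_weak_twist Wu gq) tag// mulr0 addr0.
have oH q : slab_pairs i q -> ip2 mu H q = 0.
  move=> gq; apply: Ho; have -> : q = comb 1 (fun=> 0, fun=> 0) q.
    by rewrite /comb/= {1}(surjective_pairing q); congr pair; apply/funext => x; rewrite add0r mul1r.
  by apply: spanned_add => //; exact: spanned0.
have HE1 x : H.1 x = u x + (-1) * a.1 x by [].
have HE2 x : H.2 x = g x + (-1) * a.2 x by [].
clearbody H.
have y0 : {ae mu, forall x, H.1 x + H.2 x = 0}.
  apply: (@deficiency0 i 1); [by left|exact: sqintD|] => p gp.
  have [p1 p2] := slab_pairs_sqint gp; have := tH p gp; have := oH p gp; rewrite /twist /ip2.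
  rewrite ipDr//; [|by [exact: sqintD|exact: sqintZ]..].
  rewrite ipZr//; last exact: sqintD.
  rewrite !ipDl//.
  by set a1 := ip _ _ _; set a2 := ip _ _ _; set a3 := ip _ _ _; set a4 := ip _ _ _; clearbody a1 a2 a3 a4; lra.
have z0 : {ae mu, forall x, H.1 x - H.2 x = 0}.
  apply: (@deficiency0 i (-1)); [by right|exact: sqintB|] => p gp.
  have [p1 p2] := slab_pairs_sqint gp; have := tH p gp; have := oH p gp; rewrite /twist /ip2.
  rewrite ipDr//; [|by [exact: sqintB|exact: sqintZ]..].
  rewrite ipZr//; last exact: sqintB.
  rewrite !ipBl//.
  by set a1 := ip _ _ _; set a2 := ip _ _ _; set a3 := ip _ _ _; set a4 := ip _ _ _; clearbody a1 a2 a3 a4; lra.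
have [e1 e2] : {ae mu, forall x, a.1 x = u x} /\ {ae mu, forall x, a.2 x = g x}.
  by split; apply: filterS2 y0 z0 => x; rewrite HE1 HE2; lra.
have ta : twist a (v, k) = ip mu u k + ip mu g v.
  congr (_ + _); apply: ae_Rint.
  - by apply: measurable_funM; [case: sa1|case: sk].
  - by apply: measurable_funM; [case: su|case: sk].
  - by apply: filterS e1 => x /= ->.
  - by apply: measurable_funM; [case: sa2|case: sv].
  - by apply: measurable_funM; [case: sg|case: sv].
  - by apply: filterS e2 => x /= ->.
rewrite -ta; have := lim_twist (v, k) (conj sv sk).
under eq_fun do rewrite tvs//.
by move=> /(cvg_unique _ (cvg_cst 0)) <-.
Qed.

Lemma smooth1_id : smooth1 (fun t : R => t).
Proof.
have := smooth1_prim (g := fun=> 1) (fun x => is_derive_id x 1) (smooth1_cst 1).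
by [].
Qed.

(** The weight, once cut off smoothly, can be moved onto u because j differs
    from i. The cut-off is then removed by dominated convergence. *)
Lemma weighted_skew i j u g v k : j != i ->
  sqint mu u -> sqint mu g -> sqint mu v -> sqint mu k ->
  prod_weak i u g -> prod_weak i v k ->
  integ mu (fun x => x 0 j * (u x * k x + g x * v x)) ->
  \int[mu]_x (x 0 j * (u x * k x + g x * v x)) = 0.
Proof.
move=> ji su sg sv sk Wu Wv; set h := fun x : T => _; move=> hi.
have mh := integ_meas hi.
have mj : measurable_fun setT (fun x : T => x 0 j) by exact: measurable_coord.
have cut0 N n : \int[mu]_x (bump (N%:R - - N%:R) n (x 0 j - - N%:R) * h x) = 0.
  set b : R -> R := fun t => bump (N%:R - - N%:R) n (t - - N%:R).
  have [b' tb] := test1_bump (N%:R - - N%:R) n (- N%:R : R).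
  have sb : smooth1 b by case: tb.
  pose w t := t * b t.
  have sw : smooth1 w by apply: smooth1M => //; exact: smooth1_id.
  have cw := smooth1_cont sw.
  have [M HM] : exists M : R, forall t, `|w t| <= M.
    have [_ _ [al [be [_ S _]]]] := tb.
    by apply: (supp_in_bounded (a := al) (b := be) cw) => t /S; rewrite /w /b => ->; rewrite mulr0.
  have mw := measurable_coord_fun j cw.
  have swu : sqint mu (fun x => w (x 0 j) * u x) by exact: (sqintM mw (C := M)).
  have swg : sqint mu (fun x => w (x 0 j) * g x) by exact: (sqintM mw (C := M)).
  have := slab_weak_skew swu swg sv sk (prod_weak_slab swu swg (prod_weak_mul ji sw Wu)) (prod_weak_slab sv sk Wv).
  rewrite /ip -RintegralD//; [|exact: sqint_mul..] => <-.
  by apply: eq_Rintegral => x _; rewrite /h /w /b; ring.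
have mI (a b : R) : measurable_fun setT (fun x : T => \1_(`]a, b]%classic : set R) (x 0 j) : R).
  apply: (@measurableT_comp _ _ _ _ _ _ (\1_(`]a, b]%classic : set R) : R -> R)) => //; exact: measurable_coord.
have cutI N : \int[mu]_x (\1_(`](- N%:R), N%:R]%classic : set R) (x 0 j) * h x) = 0.
  have [] := @Rdominated _ _ _ mu (fun n x => bump (N%:R - - N%:R) n (x 0 j - - N%:R) * h x)
     (fun x => \1_(`](- N%:R), N%:R]%classic : set R) (x 0 j) * h x) (fun x => `|h x|).
  - move=> n; apply: measurable_funM => //.
    apply: (measurable_coord_fun j (w := fun t => bump (N%:R - - N%:R) n (t - - N%:R))).
    exact: smooth1_cont (smooth1_shift _ (smooth1_bump _ _)).
  - by move=> x; apply: cvgMl; exact: bump_shift_cvg.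
  - by move=> n x; rewrite normrM ger0_norm ?bump_ge0// ler_piMl// bump_le1.
  - exact: integrable_norm.
  - move=> _; under eq_fun do rewrite cut0.
    by move=> /(cvg_unique _ (cvg_cst 0)) <-.
have [] := @Rdominated _ _ _ mu (fun N x => \1_(`](- N%:R), N%:R]%classic : set R) (x 0 j) * h x) h (fun x => `|h x|).
- by move=> n; apply: measurable_funM.
- move=> x; apply: cvg_near_cst.
  exists (Num.bound `|x 0 j|) => // n /= Nn.
  have bN := archi_boundP (normr_ge0 (x 0 j)).
  have : `|x 0 j| < n%:R by apply: lt_le_trans bN _; rewrite ler_nat.
  rewrite ltr_norml => /andP[x1 x2].
  by rewrite indicE mem_set ?mul1r//= in_itv/= x1 ltW.
- move=> n x; rewrite normrM ler_piMl// indicE; case: (_ \in _); by rewrite ?normr0 ?normr1.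
- exact: integrable_norm.
- move=> _; under eq_fun do rewrite cutI.
  by move=> /(cvg_unique _ (cvg_cst 0)) <-.
Qed.

End skew.

(** * Weak derivatives against all test functions *)

Section tests.
Context {R : realType} {d : nat}.
Local Notation T := ('rV[R]_d).
Local Notation mu := (@lebesgue_rV R d).

Lemma coord_le_norm (x : T) i : `|x 0 i| <= `|x|.
Proof. by rewrite [leRHS]mx_normrE; apply: (le_bigmax _ (fun ij => `|x ij.1 ij.2|) (0, i)). Qed.

Lemma sqint_compact_support (f : T -> R) (K : set T) : continuous f -> compact K ->
  (forall x, ~ K x -> f x = 0) -> sqint mu f.
Proof.
move=> cf cK f0.
have [r rK] : exists r : R, forall x, K x -> `|x| <= r.
  by have /pinfty_ex_gt0[r _ Hr] := compact_bounded cK; exists r => x Kx; exact: Hr.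
have [M MK] : exists M : R, forall x, K x -> `|f x| <= M.
  have /pinfty_ex_gt0[M _ HM] := compact_bounded (continuous_compact (continuous_subspaceT cf) cK).
  by exists M => x Kx; apply: HM; exists x.
apply: (@sqint_le _ _ _ _ _ (fun x => M * \1_(box (fun=> - r - 1) (fun=> r)) x)).
- exact: continuous_measurable_rV.
- move=> x; have [Kx|/f0 ->] := pselect (K x); last by rewrite normr0.
  rewrite indicE mem_set ?mulr1; first by rewrite (le_trans (MK _ Kx))// ler_norm.
  move=> i; rewrite /= in_itv/=; have := le_trans (coord_le_norm x i) (rK _ Kx).
  by rewrite ler_norml => /andP[x1 x2]; rewrite x2 andbT; lra.
- by apply: sqintZ; exact: sqint_box.
Qed.

Lemma test_sqint eta : test_function eta -> sqint mu eta.
Proof.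
move=> [se ce]; have [c _] := se [::].
apply: (sqint_compact_support c ce) => x; apply: contra_notP => /eqP ex.
exact: subset_closure.
Qed.

Lemma test_partial_sqint i eta : test_function eta -> sqint mu (partial i eta).
Proof.
move=> [se ce]; have [c _] := se [:: i].
apply: (sqint_compact_support c ce) => x nx.
have ox : open (~` closure [set x | eta x != 0]) by exact/closed_openC/closed_closure.
rewrite /= /partial; rewrite (@near_eq_derive _ _ _ eta (cst 0)).
  exact: derive_cst.
have : nbhs x (~` closure [set x | eta x != 0]) by exact: open_nbhs_nbhs.
apply: filterS => y ny; apply/eqP; apply: contra_notT ny => ey.
exact: subset_closure.
Qed.

(** The definition of weak partial derivatives of complex functions amounts to
    this for real and imaginary parts; all test functions are kept because
    membership in H^1 has to be recovered for limits. *)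
Definition real_weak i (u g : T -> R) := forall eta, test_function eta ->
  ip mu (partial i eta) u = - ip mu eta g.

Lemma real_weak_prod i u g : real_weak i u g -> prod_weak i u g.
Proof. by move=> H e te; apply: H; exact: test_prodf. Qed.

Lemma real_weak_lin i t u g v k : sqint mu u -> sqint mu g -> sqint mu v -> sqint mu k ->
  real_weak i u g -> real_weak i v k ->
  real_weak i (fun x => u x + t * v x) (fun x => g x + t * k x).
Proof.
move=> su sg sv sk Wu Wv eta te.
have s1 := test_sqint te; have s2 := test_partial_sqint i te.
rewrite !ipDr//; [|by [|exact: sqintZ]..].
by rewrite !ipZr// Wu// Wv//; ring.
Qed.

Lemma real_weak_lim i (u_ g_ : (T -> R)^nat) u g : (forall n, sqint mu (u_ n)) ->
  (forall n, sqint mu (g_ n)) -> sqint mu u -> sqint mu g ->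
  (forall n, real_weak i (u_ n) (g_ n)) ->
  ipn mu (fun x => u_ n x - u x) @[n --> \oo] --> (0 : R) ->
  ipn mu (fun x => g_ n x - g x) @[n --> \oo] --> (0 : R) -> real_weak i u g.
Proof.
move=> su_ sg_ su sg W cu cg eta te.
have s1 := test_sqint te; have s2 := test_partial_sqint i te.
have c1 := ip_cvg su_ su s2 cu.
have c2 : - ip mu (g_ n) eta @[n --> \oo] --> - ip mu g eta by apply: cvgN; exact: ip_cvg.
rewrite ipC [in RHS]ipC -(cvg_lim (@Rhausdorff R) c1) -(cvg_lim (@Rhausdorff R) c2).
apply: (congr1 (fun q : nat -> R => limn q)); apply/funext => n.
by rewrite ipC (W n _ te) ipC.
Qed.

End tests.

(** * Jets and their quadratic forms *)

Section jets.
Context {R : realType} {d : nat}.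
Local Notation T := ('rV[R]_d).
Local Notation mu := (@lebesgue_rV R d).
Variables (hd : (2 <= d)%N) (V : T -> R).

(** A complex function with its gradient: false and true select real and
    imaginary parts, None the function and Some i its derivative in direction
    i. Contrary to the chosen representatives of weak derivatives, jets depend
    linearly on the function. *)
Definition jet := bool -> option 'I_d -> T -> R.
Implicit Types (J K L : jet) (s : bool).

(** With this weight the potential energy becomes one more squared L2 norm. *)
Definition Vroot x := Num.sqrt (V x).

Definition jlin J (t : R) K : jet := fun s c x => J s c x + t * K s c x.

Definition valid J := forall s,
  [/\ sqint mu (J s None), sqint mu (fun x => Vroot x * J s None x),
      forall i, sqint mu (J s (Some i)) &
      forall i, real_weak i (J s None) (J s (Some i))].

Lemma valid_lin J t K : valid J -> valid K -> valid (jlin J t K).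
Proof.
move=> vJ vK s; have [J1 J2 J3 J4] := vJ s; have [K1 K2 K3 K4] := vK s; split.
- by apply: sqintD => //; exact: sqintZ.
- apply: (@sqint_ext _ _ _ _ (fun x => Vroot x * J s None x + t * (Vroot x * K s None x))).
    by move=> x; rewrite /jlin; ring.
  by apply: sqintD => //; exact: sqintZ.
- by move=> i; apply: sqintD => //; exact: sqintZ.
- by move=> i; exact: real_weak_lin.
Qed.

(** Multiplication by the imaginary unit. *)
Definition jrot J : jet := fun s c x => if s then J false c x else - J true c x.

Lemma real_weakN i (u g : T -> R) : sqint mu u -> sqint mu g -> real_weak i u g ->
  real_weak i (fun x => - u x) (fun x => - g x).
Proof.
move=> su sg W eta te.
have s1 := test_sqint te; have s2 := test_partial_sqint i te.
by rewrite ipC ipNl// [in RHS]ipC ipNl// (ipC _ u) (W _ te) (ipC _ g).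
Qed.

Lemma valid_rot J : valid J -> valid (jrot J).
Proof.
move=> vJ [|]; have [J1 J2 J3 J4] := vJ false; have [K1 K2 K3 K4] := vJ true.
  by split.
split.
- exact: sqintN.
- by apply: (@sqint_ext _ _ _ _ (fun x => - (Vroot x * J true None x))) (sqintN K2) => x; rewrite /jrot mulrN.
- by move=> i; exact: sqintN.
- by move=> i; exact: real_weakN.
Qed.

Definition jlinear (P : jet -> T -> R) := (forall J, valid J -> sqint mu (P J)) /\
  forall J t K, P (jlin J t K) = fun x => P J x + t * P K x.

(** The forms below are combinations of scalar products of linear images of
    jets, so they inherit bilinearity from the closure properties that follow.
    *)
Definition jbilinear (B : jet -> jet -> R) := forall J K L t, valid J -> valid K -> valid L ->
  B (jlin J t K) L = B J L + t * B K L /\ B L (jlin J t K) = B L J + t * B L K.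

Lemma bil_ip P Q : jlinear P -> jlinear Q -> jbilinear (fun J K => ip mu (P J) (Q K)).
Proof.
move=> [sP lP] [sQ lQ] J K L t vJ vK vL; rewrite lP lQ; split.
  by rewrite ipDl ?ipZl//; [exact: sP|exact: sQ|exact: sP|apply: sqintZ; exact: sP|exact: sQ].
by rewrite ipDr ?ipZr//; [exact: sQ|exact: sP|exact: sQ|apply: sqintZ; exact: sQ|exact: sP].
Qed.

Lemma bilD B B' : jbilinear B -> jbilinear B' -> jbilinear (fun J K => B J K + B' J K).
Proof.
move=> b b' J K L t vJ vK vL; have [-> ->] := b J K L t vJ vK vL.
by have [-> ->] := b' J K L t vJ vK vL; split; ring.
Qed.

Lemma bilZ r B : jbilinear B -> jbilinear (fun J K => r * B J K).
Proof.
by move=> b J K L t vJ vK vL; have [-> ->] := b J K L t vJ vK vL; split; ring.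
Qed.

Lemma bilB B B' : jbilinear B -> jbilinear B' -> jbilinear (fun J K => B J K - B' J K).
Proof.
move=> b b' J K L t vJ vK vL; have [-> ->] := b J K L t vJ vK vL.
by have [-> ->] := b' J K L t vJ vK vL; split; ring.
Qed.

Lemma bil_sum (I : finType) (B : I -> jet -> jet -> R) : (forall i, jbilinear (B i)) ->
  jbilinear (fun J K => \sum_i B i J K).
Proof.
move=> b J K L t vJ vK vL; rewrite !mulr_sumr -!big_split/=; split;
  by apply: eq_bigr => i _; have [E1 E2] := b i J K L t vJ vK vL.
Qed.

Lemma bil_quad B J t K : jbilinear B -> valid J -> valid K ->
  B (jlin J t K) (jlin J t K) = B J J + t * (B J K + B K J) + t ^+ 2 * B K K.
Proof.
move=> b vJ vK; have vL := valid_lin t vJ vK.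
have [-> _] := b J K _ t vJ vK vL.
have [_ ->] := b J K J t vJ vK vJ; have [_ ->] := b J K K t vJ vK vK.
by ring.
Qed.

Lemma lin_comp s c : jlinear (fun J => J s c).
Proof. by split => // J /(_ s)[J1 J2 J3 J4]; case: c. Qed.

Lemma lin_sV s : jlinear (fun J x => Vroot x * J s None x).
Proof.
split; first by move=> J /(_ s)[].
by move=> J t K; apply/funext => x; rewrite /jlin; ring.
Qed.

(** Here and below, the real part of a sesquilinear form of the problem: the
    L2 scalar product, then the Dirichlet form, the potential and the
    rotation. *)
Definition mform J K := ip mu (J false None) (K false None) + ip mu (J true None) (K true None).

Definition gform J K :=
  \sum_i (ip mu (J false (Some i)) (K false (Some i)) + ip mu (J true (Some i)) (K true (Some i))).

Definition vform J K :=
  ip mu (fun x => Vroot x * J false None x) (fun x => Vroot x * K false None x) +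
  ip mu (fun x => Vroot x * J true None x) (fun x => Vroot x * K true None x).

Local Notation a1 := (axis1 hd).
Local Notation a2 := (axis2 hd).

Definition tform (f : T -> R) (g : option 'I_d -> T -> R) : R :=
  ip mu (fun x => x 0 a2 * f x) (g (Some a1)) - ip mu (fun x => x 0 a1 * f x) (g (Some a2)).

Definition angd (g : option 'I_d -> T -> R) (x : T) : R :=
  x 0 a2 * g (Some a1) x - x 0 a1 * g (Some a2) x.

(** The real part of the integral of conj(v) Lz u, where J is the jet of v and
    K that of u. *)
Definition rform J K := tform (J true None) (K false) - tform (J false None) (K true).

Definition eform (Omega : R) J K := 2^-1 * gform J K + vform J K - Omega * rform J K.

Lemma bil_mform : jbilinear mform.
Proof. by apply: bilD; apply: bil_ip; exact: lin_comp. Qed.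

Lemma bil_gform : jbilinear gform.
Proof. by apply: bil_sum => i; apply: bilD; apply: bil_ip; exact: lin_comp. Qed.

Lemma bil_vform : jbilinear vform.
Proof. by apply: bilD; apply: bil_ip; exact: lin_sV. Qed.

Lemma mformC J K : mform J K = mform K J.
Proof. by rewrite /mform ipC (ipC _ (J true _)). Qed.

Lemma gformC J K : gform J K = gform K J.
Proof. by apply: eq_bigr => i _; rewrite ipC (ipC _ (J true _)). Qed.

Lemma vformC J K : vform J K = vform K J.
Proof. by rewrite /vform ipC (ipC _ (fun x => Vroot x * J true None x)). Qed.

Lemma mform_ge0 J : 0 <= mform J J.
Proof. by apply: addr_ge0; exact: ip_ge0. Qed.

Lemma gform_ge0 J : 0 <= gform J J.
Proof. by apply: sumr_ge0 => i _; apply: addr_ge0; exact: ip_ge0. Qed.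

Lemma vform_ge0 J : 0 <= vform J J.
Proof. by apply: addr_ge0; exact: ip_ge0. Qed.

Variables (gam C : R) (gam_gt0 : 0 < gam) (C_ge0 : 0 <= C).
Hypothesis V_ge0 : forall x, 0 <= V x.
Hypothesis mV : measurable_fun setT V.
Hypothesis HV : forall x : T, gam ^+ 2 / 2 * (x 0 a1 ^+ 2 + x 0 a2 ^+ 2) <= V x + C.

Lemma VrootK x : Vroot x ^+ 2 = V x.
Proof. exact: sqr_sqrtr. Qed.

(** Domination of the harmonic potential by V turns finite potential energy
    into finite moments in x_1 and x_2. *)
Lemma radial_sqint (f : T -> R) : sqint mu f -> sqint mu (fun x => Vroot x * f x) ->
  [/\ sqint mu (fun x => x 0 a1 * f x), sqint mu (fun x => x 0 a2 * f x) &
    gam ^+ 2 / 2 * (ipn mu (fun x => x 0 a1 * f x) + ipn mu (fun x => x 0 a2 * f x)) <=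
    ipn mu (fun x => Vroot x * f x) + C * ipn mu f].
Proof.
move=> sf svf.
have E x : (Vroot x * f x) ^+ 2 + C * f x ^+ 2 = (V x + C) * f x ^+ 2.
  by rewrite exprMn VrootK; ring.
have P (x : T) : gam ^+ 2 / 2 * ((x 0 a1 * f x) ^+ 2 + (x 0 a2 * f x) ^+ 2) <=
    (Vroot x * f x) ^+ 2 + C * f x ^+ 2.
  rewrite E (_ : _ * _ = gam ^+ 2 / 2 * (x 0 a1 ^+ 2 + x 0 a2 ^+ 2) * f x ^+ 2); last by ring.
  by rewrite ler_wpM2r ?sqr_ge0.
have g0 : 0 < gam ^+ 2 / 2 by rewrite divr_gt0// exprn_gt0.
have ib : integ mu (fun x => (gam ^+ 2 / 2)^-1 * ((Vroot x * f x) ^+ 2 + C * f x ^+ 2)).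
  by apply: integZ; apply: integD; [exact: svf.2|apply: integZ; exact: sf.2].
have S i : i = a1 \/ i = a2 -> sqint mu (fun x => x 0 i * f x).
  move=> ii; have mi : measurable_fun setT (fun x : T => x 0 i * f x).
    by apply: measurable_funM; [exact: measurable_coord|case: sf].
  split => //; apply: le_integ ib; first exact: measurable_funX.
  move=> x; rewrite ger0_norm ?sqr_ge0// ler_pdivlMl//; apply: le_trans (P x).
  rewrite ler_pM2l//; case: ii => ->; by rewrite ?lerDl ?lerDr sqr_ge0.
have s1 := S a1 (or_introl erefl); have s2 := S a2 (or_intror erefl).
split => //.
rewrite /ipn /ip -RintegralD//; [|exact: sqint_mul..].
rewrite -RintegralZl//; last by apply: integD; exact: sqint_mul.
rewrite -RintegralZl//; last exact: sqint_mul.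
rewrite -RintegralD//; [|exact: sqint_mul|by apply: integZ; exact: sqint_mul].
apply: le_Rintegral => //.
- by apply: integZ; apply: integD; exact: sqint_mul.
- by apply: integD; [exact: sqint_mul|apply: integZ; exact: sqint_mul].
- by move=> x _; have := P x; rewrite !expr2.
Qed.

Lemma lin_x1 s : jlinear (fun J x => x 0 a1 * J s None x).
Proof.
split; first by move=> J /(_ s)[J1 J2 _ _]; have [] := radial_sqint J1 J2.
by move=> J t K; apply/funext => x; rewrite /jlin; ring.
Qed.

Lemma lin_x2 s : jlinear (fun J x => x 0 a2 * J s None x).
Proof.
split; first by move=> J /(_ s)[J1 J2 _ _]; have [] := radial_sqint J1 J2.
by move=> J t K; apply/funext => x; rewrite /jlin; ring.
Qed.

Lemma bil_rform : jbilinear rform.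
Proof.
by apply: bilB; apply: bilB; apply: bil_ip;
  [exact: lin_x2|exact: lin_comp|exact: lin_x1|exact: lin_comp
  |exact: lin_x2|exact: lin_comp|exact: lin_x1|exact: lin_comp].
Qed.

Lemma bil_eform Omega : jbilinear (eform Omega).
Proof.
apply: bilB; last exact/bilZ/bil_rform.
by apply: bilD; [exact/bilZ/bil_gform|exact: bil_vform].
Qed.

Lemma tform_skew J K s s' : valid J -> valid K ->
  tform (J s None) (K s') + tform (K s' None) (J s) = 0.
Proof.
move=> vJ vK; have [J1 J2 J3 J4] := vJ s; have [K1 K2 K3 K4] := vK s'.
have [Jx1 Jx2 _] := radial_sqint J1 J2; have [Kx1 Kx2 _] := radial_sqint K1 K2.
have H i j : j != i -> sqint mu (fun x => x 0 j * J s None x) -> sqint mu (fun x => x 0 j * K s' None x) ->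
  ip mu (fun x => x 0 j * J s None x) (K s' (Some i)) + ip mu (fun x => x 0 j * K s' None x) (J s (Some i)) = 0.
  move=> ji xJ xK; rewrite /ip -RintegralD//; [|exact: sqint_mul..].
  rewrite -[RHS](weighted_skew ji J1 (J3 i) K1 (K3 i) (real_weak_prod (J4 i)) (real_weak_prod (K4 i))).
    by apply: eq_Rintegral => x _; ring.
  rewrite (_ : (fun x : T => _) = fun x => (x 0 j * J s None x) * K s' (Some i) x + (x 0 j * K s' None x) * J s (Some i) x).
    by apply: integD; exact: sqint_mul.
  by apply/funext => x; ring.
have h1 := H a1 a2 isT Jx2 Kx2; have h2 := H a2 a1 isT Jx1 Kx1.
by rewrite /tform; move: h1 h2; set p1 := ip _ _ _; set p2 := ip _ _ _; set p3 := ip _ _ _; set p4 := ip _ _ _; lra.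
Qed.

(** Lz is symmetric: its two terms are integrated by parts, with weights x_2
    and x_1 independent of the variable of derivation. *)
Lemma rformC J K : valid J -> valid K -> rform J K = rform K J.
Proof.
move=> vJ vK; rewrite /rform.
have := tform_skew true false vJ vK; have := tform_skew false true vJ vK; lra.
Qed.

Lemma eformC Omega J K : valid J -> valid K -> eform Omega J K = eform Omega K J.
Proof. by move=> vJ vK; rewrite /eform gformC vformC rformC. Qed.

Lemma ip_young (f g : T -> R) : sqint mu f -> sqint mu g ->
  `|gam * ip mu f g| <= 2^-1 * (gam ^+ 2 * ipn mu f + ipn mu g).
Proof.
move=> sf sg.
have H t : 0 <= t ^+ 2 * ipn mu f + 2 * t * ip mu f g + ipn mu g.
  have := ip_ge0 mu (fun x => g x + t * f x); rewrite ip_sqrD// (ipC _ g) /ipn; lra.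
have := H gam; have := H (- gam); rewrite sqrrN ler_norml => h1 h2.
by apply/andP; split; nra.
Qed.

Lemma gform_axes J : ipn mu (J false (Some a1)) + ipn mu (J true (Some a1)) +
  (ipn mu (J false (Some a2)) + ipn mu (J true (Some a2))) <= gform J J.
Proof.
rewrite /gform (bigD1 a1)//= (bigD1 a2)//= addrA lerDl.
by apply: sumr_ge0 => i _; apply: addr_ge0; exact: ip_ge0.
Qed.

(** Young's inequality with weight gam produces gam^2 / 2 times the moments,
    exactly what V + C dominates. *)
Lemma rform_bound J : valid J ->
  gam * `|rform J J| <= 2^-1 * gform J J + vform J J + C * mform J J.
Proof.
move=> vJ; have [J1 J2 J3 J4] := vJ false; have [K1 K2 K3 K4] := vJ true.
have [Jx1 Jx2 Jr] := radial_sqint J1 J2; have [Kx1 Kx2 Kr] := radial_sqint K1 K2.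
have := ip_young Kx2 (J3 a1); have := ip_young Kx1 (J3 a2).
have := ip_young Jx2 (K3 a1); have := ip_young Jx1 (K3 a2).
have := gform_axes J.
have -> : gam * `|rform J J| = `|gam * rform J J| by rewrite normrM gtr0_norm.
rewrite /vform /mform /rform /tform !ler_norml.
move: Jr Kr; rewrite -!/(ipn mu _).
move=> Jr Kr G /andP[x1 x2] /andP[y1 y2] /andP[z1 z2] /andP[w1 w2].
by apply/andP; split; rewrite !mulrBr; lra.
Qed.

Lemma eform_bounds th Omega J : valid J -> 0 <= th -> Omega = th * gam ->
  (1 - th) * (2^-1 * gform J J + vform J J) - th * C * mform J J <= eform Omega J J <=
  (1 + th) * (2^-1 * gform J J + vform J J) + th * C * mform J J.
Proof.
move=> vJ t0 ->; have := ler_wpM2l t0 (rform_bound vJ).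
rewrite mulrA /eform; have : 0 <= th * gam by rewrite mulr_ge0// ltW.
set r := rform J J => tg h.
have : `|th * gam * r| <= th * (2^-1 * gform J J + vform J J + C * mform J J).
  by rewrite normrM (ger0_norm tg).
rewrite ler_norml => /andP[h1 h2]; apply/andP; split; lra.
Qed.

End jets.

(** * Complex functions as jets *)

Import Normc.
Local Open Scope complex_scope.

Section parts.
Context {R : realType}.
Implicit Types z w : R[i].

Definition part (s : bool) z : R := if s then complex.Im z else complex.Re z.

Lemma partD s z w : part s (z + w) = part s z + part s w.
Proof. by case: z w s => [a b] [a' b'] []. Qed.

Lemma partN s z : part s (- z) = - part s z.
Proof. by case: z s => [a b] []. Qed.

Lemma part_sum s (I : finType) (F : I -> R[i]) : part s (\sum_i F i) = \sum_i part s (F i).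
Proof. by apply: (big_morph _ (partD s)); case: s. Qed.

Lemma partZ s r z : part s (r%:C * z) = r * part s z.
Proof. by case: z s => [a b] [] /=; rewrite mul0r ?subr0 ?addr0. Qed.

Lemma part_half s z : part s (2^-1 * z) = 2^-1 * part s z.
Proof. by rewrite -partZ fmorphV rmorph_nat. Qed.

Lemma part_conjM s z w : part s (conjc z * w) =
  (if s then - part true z else part false z) * part false w +
  (if s then part false z else part true z) * part true w.
Proof. by case: z w s => [a b] [a' b'] [] /=; ring. Qed.

Lemma part_inj z w : (forall s, part s z = part s w) -> z = w.
Proof. by case: z w => [a b] [a' b'] H; have /= -> := H false; have /= -> := H true. Qed.

Lemma normc_sqr z : normc z ^+ 2 = part false z ^+ 2 + part true z ^+ 2.
Proof. by case: z => a b /=; rewrite sqr_sqrtr// addr_ge0// sqr_ge0. Qed.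

End parts.

Section dictionary.
Context {R : realType} {d : nat}.
Local Notation T := ('rV[R]_d).
Local Notation mu := (@lebesgue_rV R d).
Implicit Types (u v g : T -> R[i]) (J K : @jet R d).

Lemma part_Cintegral s u : part s (Cintegral u) = \int[mu]_x part s (u x).
Proof. by case: s. Qed.

(** Test functions being real, the identity splits into real and imaginary
    parts. *)
Lemma weak_partialP i u g : is_weak_partial i u g <->
  forall s, real_weak i (fun x => part s (u x)) (fun x => part s (g x)).
Proof.
have E s f h : part s (Cintegral (fun x => (f x)%:C * h x)) = ip mu f (fun x => part s (h x)).
  by rewrite part_Cintegral; apply: eq_Rintegral => x _; rewrite partZ.
split=> [H s eta te|H eta te].
  by rewrite -!E -partN H.
by apply: part_inj => s; rewrite partN !E (H s _ te).
Qed.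

Lemma nonneg_integ (f : T -> R) : measurable_fun setT f -> (forall x, 0 <= f x) ->
  (\int[mu]_x (f x)%:E < +oo)%E <-> integ mu f.
Proof.
move=> mf f0; rewrite /integ; split=> [H|/integrableP[_]].
  apply/integrableP; split; first exact/measurable_EFinP.
  by under eq_integral do rewrite /= ger0_norm//.
by under eq_integral do rewrite /= ger0_norm//.
Qed.

Lemma weighted_L2P (w : T -> R) u : measurable_fun setT w ->
  (forall s, measurable_fun setT (fun x => part s (u x))) ->
  (\int[mu]_x (w x ^+ 2 * normc (u x) ^+ 2)%:E < +oo)%E <->
  forall s, sqint mu (fun x => w x * part s (u x)).
Proof.
move=> mw m; have m0 := m false; have m1 := m true.
have E x : w x ^+ 2 * normc (u x) ^+ 2 = (w x * part false (u x)) ^+ 2 + (w x * part true (u x)) ^+ 2.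
  by rewrite normc_sqr; ring.
under eq_integral do rewrite E.
have M s : measurable_fun setT (fun x => (w x * part s (u x)) ^+ 2).
  by apply: measurable_funX; apply: measurable_funM => //; case: s.
rewrite nonneg_integ; last 2 first.
- exact: measurable_funD.
- by move=> x; rewrite addr_ge0 ?sqr_ge0.
split=> [H s|H]; last by apply: integD; [case: (H false)|case: (H true)].
split; first by apply: measurable_funM => //; case: s.
apply: le_integ H => //.
by move=> x; rewrite ger0_norm ?sqr_ge0//; case: s; rewrite ?lerDl ?lerDr sqr_ge0.
Qed.

Lemma L2P u : L2 u <-> forall s, sqint mu (fun x => part s (u x)).
Proof.
have W (m : forall s, measurable_fun setT (fun x => part s (u x))) :
   (\int[mu]_x (normc (u x) ^+ 2)%:E < +oo)%E <-> forall s, sqint mu (fun x => part s (u x)).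
  have := @weighted_L2P (fun=> 1) u (measurable_cst _) m.
  under eq_integral do rewrite expr1n mul1r.
  move=> ->; split=> H s; apply: sqint_ext (H s) => x; by rewrite mul1r.
split=> [[[m0 m1] H]|H]; first by apply/W => // -[].
by split; [split; [case: (H false)|case: (H true)]|apply/W => // s; case: (H s)].
Qed.

Lemma wpartialP i u : (exists2 g, L2 g & is_weak_partial i u g) ->
  L2 (wpartial i u) /\ is_weak_partial i u (wpartial i u).
Proof. by move=> [g g2 gu]; apply: (@xgetPex _ (fun=> 0) [set g | L2 g /\ is_weak_partial i u g]); exists g. Qed.

Definition jet_of u : @jet R d :=
  fun s c x => part s (if c is Some i then wpartial i u x else u x).

Definition toC J : T -> R[i] := fun x => J false None x +i* J true None x.

Definition jeq J K := forall s c, {ae mu, forall x, J s c x = K s c x}.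

Section withV.
Variables (hd : (2 <= d)%N) (V : T -> R).
Hypothesis V_ge0 : forall x, 0 <= V x.
Hypothesis mV : measurable_fun setT V.
Local Notation sV := (Vroot V).
Local Notation valid := (valid V).

Lemma measurable_sV : measurable_fun setT sV.
Proof.
rewrite /Vroot; apply: (@measurableT_comp _ _ _ _ _ _ (fun t : R => Num.sqrt t)) => //.
apply: continuous_measurable_fun; exact: sqrt_continuous.
Qed.

Lemma Xspace_valid u : Xspace V u -> valid (jet_of u).
Proof.
move=> [[u2 ug] uV] s; have ms := (L2P u).1 u2.
have H i := wpartialP (ug i).
have G i := (L2P (wpartial i u)).1 (H i).1.
have vs : forall s, sqint mu (fun x => sV x * part s (u x)).
  apply/weighted_L2P; [exact: measurable_sV|by move=> s'; case: (ms s')|].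
  by under eq_integral do rewrite VrootK//.
split; [exact: ms|exact: vs|by move=> i; exact: G|].
by move=> i; apply: ((weak_partialP i u (wpartial i u)).1 (H i).2 s).
Qed.

(** Weak derivatives are unique up to null sets, so the representatives chosen
    by [wpartial] agree with the given ones almost everywhere. *)
Lemma valid_Xspace J : valid J -> Xspace V (toC J) /\ jeq (jet_of (toC J)) J.
Proof.
move=> vJ.
have pE s : (fun x => part s (toC J x)) = J s None by case: s.
pose g i : T -> R[i] := fun x => J false (Some i) x +i* J true (Some i) x.
have gE i s : (fun x => part s (g i x)) = J s (Some i) by case: s.
have g2 i : L2 (g i) by apply/L2P => s; rewrite gE; case: (vJ s).
have gw i : is_weak_partial i (toC J) (g i).
  by apply/weak_partialP => s; rewrite pE gE; case: (vJ s).
have u2 : L2 (toC J) by apply/L2P => s; rewrite pE; case: (vJ s).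
split.
  split; first by split => // i; exists (g i).
  have := @weighted_L2P sV (toC J) measurable_sV.
  under eq_integral do rewrite VrootK//.
  move=> ->; last by move=> s; rewrite pE; case: (vJ s) => -[].
  by move=> s; case: (vJ s) => _ + _ _; apply: sqint_ext => x; rewrite -pE.
move=> s [i|]; last by apply: aeW => x; case: s.
have [h2 hw] := wpartialP (ex_intro2 _ _ (g i) (g2 i) (gw i)).
have [J1 J2 J3 J4] := vJ s.
have hs : sqint mu (jet_of (toC J) s (Some i)) := (L2P _).1 h2 s.
apply: (@slab_weak_uniq R d i (J s None)) => //.
  apply: prod_weak_slab => //; apply: real_weak_prod.
  by have := (weak_partialP _ _ _).1 hw s; rewrite pE.
by apply: prod_weak_slab => //; exact: real_weak_prod.
Qed.

Lemma ae_ip (f f' g g' : T -> R) : sqint mu f -> sqint mu f' -> sqint mu g -> sqint mu g' ->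
  {ae mu, forall x, f x = f' x} -> {ae mu, forall x, g x = g' x} -> ip mu f g = ip mu f' g'.
Proof.
move=> [mf _] [mf' _] [mg _] [mg' _] ff gg; apply: ae_Rint; try exact: measurable_funM.
by apply: filterS2 ff gg => x -> ->.
Qed.

Variables (gam C : R) (gam_gt0 : 0 < gam) (C_ge0 : 0 <= C).
Hypothesis HV : forall x : T, gam ^+ 2 / 2 * (x 0 (axis1 hd) ^+ 2 + x 0 (axis2 hd) ^+ 2) <= V x + C.

Let sq1 := radial_sqint gam_gt0 V_ge0 HV.

Lemma forms_jeq Om J K : valid J -> valid K -> jeq J K ->
  [/\ mform J J = mform K K, gform J J = gform K K, vform V J J = vform V K K &
     eform hd V Om J J = eform hd V Om K K].
Proof.
move=> vJ vK jk.
have c s c : sqint mu (J s c) /\ sqint mu (K s c).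
  by have [J1 _ J3 _] := vJ s; have [K1 _ K3 _] := vK s; case: c.
have sv s : sqint mu (fun x => sV x * J s None x) /\ sqint mu (fun x => sV x * K s None x).
  by have [_ J2 _ _] := vJ s; have [_ K2 _ _] := vK s.
have E s c' : ip mu (J s c') (J s c') = ip mu (K s c') (K s c').
  by apply: ae_ip; [case: (c s c')|case: (c s c')|case: (c s c')|case: (c s c')|exact: jk|exact: jk].
have mE : mform J J = mform K K by rewrite /mform !E.
have gE : gform J J = gform K K by apply: eq_bigr => i _; rewrite !E.
have vv s : ip mu (fun x => sV x * J s None x) (fun x => sV x * J s None x) =
   ip mu (fun x => sV x * K s None x) (fun x => sV x * K s None x).
  have a : {ae mu, forall x, sV x * J s None x = sV x * K s None x}.
    by apply: filterS (jk s None) => x ->.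
  by apply: ae_ip => //; case: (sv s).
have vE : vform V J J = vform V K K by rewrite /vform !vv.
split => //; rewrite /eform gE vE; congr (_ - _ * _).
have tE s s' : tform hd (J s None) (J s') = tform hd (K s None) (K s').
  have [J1 J2 J3 J4] := vJ s; have [K1 K2 K3 K4] := vK s.
  have [x1 x2 _] := sq1 J1 J2; have [y1 y2 _] := sq1 K1 K2.
  have a i : {ae mu, forall x : T, x 0 i * J s None x = x 0 i * K s None x}.
    by apply: filterS (jk s None) => x ->.
  by congr (_ - _); apply: ae_ip => //; try (by case: (c s' (Some (axis1 hd))));
    try (by case: (c s' (Some (axis2 hd)))); try exact: a; exact: jk.
by rewrite /rform !tE.
Qed.

Lemma gform_int J K : valid J -> valid K ->
  let D x := \sum_i (J false (Some i) x * K false (Some i) x + J true (Some i) x * K true (Some i) x) in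
  integ mu D /\ \int[mu]_x D x = gform J K.
Proof.
move=> vJ vK /=.
have i0 s i : integ mu (fun x => J s (Some i) x * K s (Some i) x).
  by apply: sqint_mul; [case: (vJ s)|case: (vK s)].
split; first by apply: integ_sum => i; apply: integD.
by rewrite Rint_sum => [|i]; [apply: eq_bigr => i _; rewrite RintegralD//; exact: i0|exact: integD].
Qed.

Lemma mform_int J K : valid J -> valid K ->
  let D x := J false None x * K false None x + J true None x * K true None x in
  integ mu D /\ \int[mu]_x D x = mform J K.
Proof.
move=> vJ vK /=.
have i0 s : integ mu (fun x => J s None x * K s None x).
  by apply: sqint_mul; [case: (vJ s)|case: (vK s)].
by split; [exact: integD|rewrite RintegralD//; exact: i0].
Qed.

Lemma vform_int J K : valid J -> valid K ->
  let D x := V x * (J false None x * K false None x + J true None x * K true None x) in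
  integ mu D /\ \int[mu]_x D x = vform V J K.
Proof.
move=> vJ vK /=.
have i0 s : integ mu (fun x => (sV x * J s None x) * (sV x * K s None x)).
  by apply: sqint_mul; [case: (vJ s)|case: (vK s)].
have -> : (fun x => V x * (J false None x * K false None x + J true None x * K true None x)) =
  fun x => (sV x * J false None x) * (sV x * K false None x) + (sV x * J true None x) * (sV x * K true None x).
  by apply/funext => x; rewrite -[V x](VrootK V_ge0); ring.
by split; [exact: integD|rewrite RintegralD//; exact: i0].
Qed.

Lemma rform_int J K : valid J -> valid K ->
  let D (x : T) := J true None x * angd hd (K false) x
   - J false None x * angd hd (K true) x in
  integ mu D /\ \int[mu]_x D x = rform hd J K.
Proof.
move=> vJ vK /=.
have i0 s s' : integ mu (fun x : T => (x 0 (axis2 hd) * J s None x) * K s' (Some (axis1 hd)) x) /\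
   integ mu (fun x : T => (x 0 (axis1 hd) * J s None x) * K s' (Some (axis2 hd)) x).
  have [J1 J2 _ _] := vJ s; have [x1 x2 _] := sq1 J1 J2.
  by split; apply: sqint_mul => //; case: (vK s').
have [p1 p2] := i0 true false; have [p3 p4] := i0 false true.
have -> : (fun x : T => J true None x * angd hd (K false) x
   - J false None x * angd hd (K true) x) =
 fun x => ((x 0 (axis2 hd) * J true None x) * K false (Some (axis1 hd)) x - (x 0 (axis1 hd) * J true None x) * K false (Some (axis2 hd)) x)
  - ((x 0 (axis2 hd) * J false None x) * K true (Some (axis1 hd)) x - (x 0 (axis1 hd) * J false None x) * K true (Some (axis2 hd)) x).
  by apply/funext => x; rewrite /angd; ring.
split; first by apply: integB; exact: integB.
by rewrite RintegralB//; [rewrite !RintegralB|exact: integB..].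
Qed.

Lemma eform_int Om J K : valid J -> valid K -> eform hd V Om J K =
  \int[mu]_x (2^-1 * \sum_i (J false (Some i) x * K false (Some i) x + J true (Some i) x * K true (Some i) x)
   + V x * (J false None x * K false None x + J true None x * K true None x)
   - Om * (J true None x * angd hd (K false) x
   - J false None x * angd hd (K true) x)).
Proof.
move=> vJ vK; have [ig eg] := gform_int vJ vK; have [iv ev] := vform_int vJ vK.
have [ir er] := rform_int vJ vK.
rewrite RintegralB//; [|by apply: integD => //; exact: integZ|exact: integZ].
by rewrite RintegralD//; [rewrite !RintegralZl// eg ev er|exact: integZ].
Qed.

Lemma L2norm_sqrE u : Xspace V u -> L2norm u ^+ 2 = mform (jet_of u) (jet_of u).
Proof.
move=> Xu; have vu := Xspace_valid Xu; have [_ <-] := mform_int vu vu.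
rewrite /L2norm sqr_sqrtr; last by apply: Rintegral_ge0 => x _; exact: sqr_ge0.
by apply: eq_Rintegral => x _; rewrite normc_sqr !expr2.
Qed.

Lemma gradsqE u : Xspace V u -> \int[mu]_x gradsq u x = gform (jet_of u) (jet_of u).
Proof.
move=> Xu; have vu := Xspace_valid Xu; have [_ <-] := gform_int vu vu.
by apply: eq_Rintegral => x _; apply: eq_bigr => i _; rewrite normc_sqr !expr2.
Qed.

Lemma potentialE u : Xspace V u ->
  \int[mu]_x (V x * normc (u x) ^+ 2) = vform V (jet_of u) (jet_of u).
Proof.
move=> Xu; have vu := Xspace_valid Xu; have [_ <-] := vform_int vu vu.
by apply: eq_Rintegral => x _; rewrite normc_sqr !expr2.
Qed.

Lemma part_conj_jet s v w x : part s (conjc (v x) * w) =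
  (if s then jrot (jet_of v) else jet_of v) false None x * part false w +
  (if s then jrot (jet_of v) else jet_of v) true None x * part true w.
Proof. by rewrite part_conjM; case: s. Qed.

Lemma part_Lz s u x : part s (Lz hd u x) =
  (if s then angd hd (jet_of u false) x
   else - angd hd (jet_of u true) x).
Proof.
have pi (b : bool) (z : R[i]) : part b ('i%C * z) = if b then part false z else - part true z.
  by case: z b => [p q] [] /=; ring.
rewrite /Lz pi /angd /jet_of; move: (wpartial _ u x) (wpartial _ u x) => p q.
by case: s; rewrite partD partN !partZ.
Qed.

Lemma angularE u : Xspace V u -> angular_momentum hd u = rform hd (jet_of u) (jet_of u).
Proof.
move=> Xu; have vu := Xspace_valid Xu; have [_ <-] := rform_int vu vu.
rewrite /angular_momentum -/(part false _) part_Cintegral; apply: eq_Rintegral => x _.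
by rewrite (part_conj_jet false) !part_Lz mulrN addrC.
Qed.

Lemma energyE Om u : Xspace V u -> energy hd V Om u = eform hd V Om (jet_of u) (jet_of u).
Proof. by move=> Xu; rewrite /energy gradsqE// potentialE// angularE. Qed.

Lemma XnormE u : Xspace V u ->
  Xnorm V u = Num.sqrt (gform (jet_of u) (jet_of u) + vform V (jet_of u) (jet_of u) + mform (jet_of u) (jet_of u)).
Proof.
move=> Xu; have vu := Xspace_valid Xu.
have [ig <-] := gform_int vu vu; have [iv <-] := vform_int vu vu; have [im <-] := mform_int vu vu.
rewrite /Xnorm -RintegralD// -RintegralD//; last exact: integD.
congr Num.sqrt; apply: eq_Rintegral => x _; rewrite mulrDl mul1r normc_sqr -!expr2.
rewrite [X in _ + X = _]addrC addrA; congr (_ + _ + _).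
by apply: eq_bigr => i _; rewrite normc_sqr !expr2.
Qed.

Lemma valid_jrot_if (s : bool) J : valid J -> valid (if s then jrot J else J).
Proof. by case: s => //; exact: valid_rot. Qed.

(** The imaginary part of the form at (u, v) is its real part at (u, i v). *)
Lemma part_rot_form s Om u v : Xspace V u -> Xspace V v ->
  part s (rot_form hd V Om u v) =
  eform hd V Om (if s then jrot (jet_of v) else jet_of v) (jet_of u).
Proof.
move=> Xu Xv; have vu := Xspace_valid Xu; have vv := valid_jrot_if s (Xspace_valid Xv).
rewrite eform_int// /rot_form part_Cintegral; apply: eq_Rintegral => x _.
rewrite partD partN partD part_half part_sum !partZ !part_conj_jet !part_Lz.
congr (_ * _ + _ - _ * _); last by rewrite mulrN addrC.
by apply: eq_bigr => i _; rewrite part_conjM; case: s {vv}.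
Qed.

Lemma part_L2_pairing s (c : R) u v : Xspace V u -> Xspace V v ->
  part s (Cintegral (fun x => conjc (v x) * (c%:C * u x))) =
  c * mform (if s then jrot (jet_of v) else jet_of v) (jet_of u).
Proof.
move=> Xu Xv; have vu := Xspace_valid Xu; have vv := valid_jrot_if s (Xspace_valid Xv).
have [im <-] := mform_int vv vu.
rewrite part_Cintegral -RintegralZl//; apply: eq_Rintegral => x _.
by rewrite part_conj_jet !partZ; ring.
Qed.

(** Norms and energy may thus be computed on whichever jet is at hand, such as
    a combination or a limit of jets. *)
Lemma valid_norms Om J : valid J -> [/\ Xspace V (toC J),
  L2norm (toC J) ^+ 2 = mform J J,
  Xnorm V (toC J) = Num.sqrt (gform J J + vform V J J + mform J J) &
  energy hd V Om (toC J) = eform hd V Om J J].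
Proof.
move=> vJ; have [XJ JJ] := valid_Xspace vJ.
have [mE gE vE eE] := forms_jeq Om (Xspace_valid XJ) vJ JJ.
by split => //; rewrite ?L2norm_sqrE// ?XnormE// ?energyE// ?mE ?gE ?vE.
Qed.

End withV.

End dictionary.

(** * Compactness of near-minimisers *)

Section near_minimizer_near_E0.
Context {R : realType} {d : nat}.
Local Notation T := ('rV[R]_d).
Local Notation mu := (@lebesgue_rV R d).
Variables (hd : (2 <= d)%N) (V : T -> R).
Hypothesis V_ge0 : forall x, 0 <= V x.
Hypothesis mV : measurable_fun setT V.
Variables (gam C th Omega : R).
Hypothesis gam_gt0 : 0 < gam.
Hypothesis C_ge0 : 0 <= C.
Hypothesis HV : forall x : T, gam ^+ 2 / 2 * (x 0 (axis1 hd) ^+ 2 + x 0 (axis2 hd) ^+ 2) <= V x + C.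
Hypothesis th_ge0 : 0 <= th.
Hypothesis th_lt1 : th < 1.
Hypothesis OmegaE : Omega = th * gam.
Implicit Types (u v : T -> R[i]) (J K : @jet R d).
Local Notation valid := (valid V).
Local Notation lam := (lambda0 hd V Omega).
Local Notation eform := (eform hd V Omega).

Lemma eform_lower J : valid J ->
  (1 - th) * (2^-1 * gform J J + vform V J J) - th * C * mform J J <= eform J J.
Proof. by move=> vJ; have /andP[] := eform_bounds gam_gt0 V_ge0 HV vJ th_ge0 OmegaE. Qed.

Lemma eform_upper J : valid J ->
  eform J J <= (1 + th) * (2^-1 * gform J J + vform V J J) + th * C * mform J J.
Proof. by move=> vJ; have /andP[] := eform_bounds gam_gt0 V_ge0 HV vJ th_ge0 OmegaE. Qed.

Lemma eform_lower0 J : valid J -> - (th * C * mform J J) <= eform J J.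
Proof.
move=> vJ; apply: le_trans (eform_lower vJ); rewrite lerDr mulr_ge0//; first by rewrite subr_ge0 ltW.
by rewrite addr_ge0 ?mulr_ge0 ?gform_ge0 ?vform_ge0.
Qed.

(** Coercivity bounds the Rayleigh quotients from below, so their infimum is a
    genuine lower bound; it also covers functions with zero L2 norm, which
    have no quotient. *)
Lemma lambda0_le u : Xspace V u -> lam * L2norm u ^+ 2 <= energy hd V Omega u.
Proof.
move=> Xu; have lb w : Xspace V w -> - (th * C * L2norm w ^+ 2) <= energy hd V Omega w.
  move=> Xw; rewrite (L2norm_sqrE V_ge0 mV)// (energyE V_ge0 mV gam_gt0 HV)//.
  exact/eform_lower0/(Xspace_valid V_ge0 mV).
have [u0|u0] := eqVneq (L2norm u) 0.
  by have := lb u Xu; rewrite u0 expr0n !mulr0 oppr0.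
have u2 : 0 < L2norm u ^+ 2 by rewrite exprn_gt0// lt_def u0 sqrtr_ge0.
rewrite -ler_pdivlMr//; apply: ge_inf; last by exists u.
exists (- (th * C)) => _ [w [Xw w0] <-].
have w2 : 0 < L2norm w ^+ 2 by rewrite exprn_gt0// lt_def w0 sqrtr_ge0.
by rewrite ler_pdivlMr// mulNr; exact: lb.
Qed.

Definition Qform J K := eform J K - lam * mform J K.

Lemma bil_Qform : jbilinear V Qform.
Proof.
by apply: bilB; [exact: bil_eform gam_gt0 V_ge0 HV Omega|exact/bilZ/bil_mform].
Qed.

Lemma QformC J K : valid J -> valid K -> Qform J K = Qform K J.
Proof. by move=> vJ vK; rewrite /Qform mformC (eformC gam_gt0 V_ge0 HV). Qed.

Lemma Qform_ge0 J : valid J -> 0 <= Qform J J.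
Proof.
move=> vJ; have [XJ m _ e] := valid_norms (hd := hd) V_ge0 mV gam_gt0 HV Omega vJ.
by rewrite subr_ge0 -m -e lambda0_le.
Qed.

(** Q is nonnegative and vanishes at u, so t |-> Q(u + t w) forces its polar
    form to vanish at (u, w), for w and also for i w. *)
Lemma E0_intro u : Xspace V u -> energy hd V Omega u = lam * L2norm u ^+ 2 ->
  E0 hd V Omega u.
Proof.
move=> Xu; rewrite (energyE V_ge0 mV gam_gt0 HV)// (L2norm_sqrE V_ge0 mV)// => eq0.
have vu := Xspace_valid V_ge0 mV Xu.
have Q0 : Qform (jet_of u) (jet_of u) = 0 by rewrite /Qform eq0 subrr.
have orth K : valid K -> eform K (jet_of u) = lam * mform K (jet_of u).
  move=> vK; apply/eqP; rewrite -subr_eq0 -/(Qform K _) -sqrf_eq0 eq_le sqr_ge0 andbT.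
  rewrite -(mul0r (Qform K K)) -{1}Q0; apply: quad_disc => t.
  rewrite (_ : _ + _ = Qform (jlin (jet_of u) t K) (jlin (jet_of u) t K)).
    exact/Qform_ge0/valid_lin.
  by rewrite (bil_quad t bil_Qform vu vK) (QformC vu vK); ring.
split => //.
  apply/L2P => s; apply: (@sqint_ext _ _ _ _ (fun x => lam * part s (u x))).
    by move=> x; rewrite partZ.
  by apply: sqintZ; case: (vu s).
move=> w Xw; apply: part_inj => s.
rewrite (part_rot_form V_ge0 mV gam_gt0 HV)// (part_L2_pairing V_ge0 mV)//.
exact/orth/valid_jrot_if/(Xspace_valid V_ge0 mV).
Qed.

(** Coefficients of the real and of the imaginary part are interleaved, so
    that they form a single row vector. *)
Definition coefsum N (w : nat -> T -> R) J : R :=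
  \sum_(0 <= k < N.*2) ip mu (J (odd k) None) (w k./2) ^+ 2.

Lemma coefsumE N w J : coefsum N w J =
  \sum_(0 <= k < N) ip mu (J false None) (w k) ^+ 2 + \sum_(0 <= k < N) ip mu (J true None) (w k) ^+ 2.
Proof.
rewrite /coefsum; elim: N => [|N IH]; first by rewrite !big_geq// addr0.
rewrite doubleS !big_nat_recr//= IH odd_double/= uphalf_double doubleK; ring.
Qed.

Lemma coefsum_ge0 N w J : 0 <= coefsum N w J.
Proof. by apply: sumr_ge0 => k _; exact: sqr_ge0. Qed.

Hypothesis V_pinfty : tends_to_pinfty V.

(** Outside a large cube V is at least 1 / e. *)
Lemma mass_tail (e : R) : 0 < e -> exists2 L : R, 0 < L & forall f : T -> R,
  sqint mu f -> sqint mu (fun x => Vroot V x * f x) ->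
  ipn mu f <= sqmass f (dyadic L (axis1 hd) 0 0) + e * ipn mu (fun x => Vroot V x * f x).
Proof.
move=> e0; have [r Hr] := V_pinfty e^-1.
exists (Num.max r 0 + 1); first by rewrite ltr_wpDl// le_max lexx orbT.
set L := _ + 1 => f sf svf.
rewrite /sqmass; set B := rbox _.
have mB : measurable B by exact: measurable_box.
have i1 : integ mu (fun x => \1_B x * f x ^+ 2).
  have := sqint_mul (sqint_ind mB sf) sf; congr integ.
  by apply/funext => x; rewrite expr2 mulrA.
have i2 : integ mu (fun x => e * ((Vroot V x * f x) * (Vroot V x * f x))).
  by apply: integZ; exact: sqint_mul.
rewrite /ipn /ip -RintegralZl//; last exact: sqint_mul.
rewrite -RintegralD//; apply: le_Rintegral => //; [exact: sqint_mul|exact: integD|].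
move=> x _; rewrite -!expr2 exprMn VrootK// indicE.
case: (boolP (x \in B)) => [_|/negP nB].
  by rewrite mul1r lerDl; apply: mulr_ge0; [exact: ltW|rewrite mulr_ge0// sqr_ge0].
rewrite mul0r add0r mulrA ler_peMl ?sqr_ge0//.
have xr : r < `|x|.
  rewrite ltNge; apply/negP => xr; apply: nB; apply/mem_set => i.
  have := le_trans (coord_le_norm x i) xr; rewrite ler_norml => /andP[x1 x2].
  have rL : r < L by rewrite ltr_pwDr// le_max lexx.
  by rewrite /= in_itv/=; apply/andP; split; lra.
by have := Hr x xr; rewrite -(ltr_pM2l e0) mulfV ?gt_eqF// => /ltW.
Qed.

Definition jnorm J := gform J J + vform V J J + mform J J.

Lemma jnorm_ge0 J : 0 <= jnorm J.
Proof. by apply: addr_ge0; [apply: addr_ge0; [exact: gform_ge0|exact: vform_ge0]|exact: mform_ge0]. Qed.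

(** The mass in a large cube is estimated by [finite_rank_cube] and the mass
    outside by [mass_tail], in both cases with a factor e in front of the
    energy. Coercivity bounds that energy by Q plus a multiple of the mass,
    which is absorbed when e is small. *)
Lemma finite_rank : exists (N : nat) (w : nat -> T -> R) (K : R),
  [/\ 0 <= K, forall k, sqint mu (w k) &
    forall J, valid J -> jnorm J <= K * (Qform J J + coefsum N w J)].
Proof.
pose c1 := 2 / (1 - th); pose c2 := `|lam| + th * C.
have t1 : 0 < 1 - th by rewrite subr_gt0.
have c1_gt0 : 0 < c1 by rewrite divr_gt0.
have c2_ge0 : 0 <= c2 by rewrite addr_ge0// mulr_ge0.
(* Chosen so that the mass fed back by coercivity is at most half the mass. *)
pose e := (2 * c1 * (c2 + 1))^-1.
have e0 : 0 < e by rewrite invr_gt0; apply: mulr_gt0; [exact: mulr_gt0|exact: ltr_wpDl].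
have ec : e * c1 * c2 <= 2^-1.
  rewrite /e invfM mulrAC -mulrA; have : 0 < c2 + 1 by rewrite ltr_wpDl.
  move=> c20; rewrite (_ : _ * _ = 2^-1 * (c2 / (c2 + 1))); last first.
    by field; rewrite !gt_eqF.
  by rewrite ler_piMr// ler_pdivrMr// mul1r lerDl.
have [L L0 HL] := mass_tail e0.
have [N [w [sw Hw]]] := finite_rank_cube L0 (axis1 hd) e0.
exists N, w, (c1 + (c1 * c2 + 1) * (2 * e * c1 + 2)); split => //.
  have ? := ltW c1_gt0; have ? := ltW e0.
  have h1 : 0 <= c1 * c2 + 1 by rewrite addr_ge0// mulr_ge0.
  have h2 : 0 <= 2 * e * c1 + 2 by rewrite addr_ge0// mulr_ge0// mulr_ge0.
  by rewrite addr_ge0// mulr_ge0.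
move=> J vJ.
have part_le s : ipn mu (J s None) <= e * (\sum_i ipn mu (J s (Some i))) +
    \sum_(0 <= k < N) ip mu (J s None) (w k) ^+ 2 + e * ipn mu (fun x => Vroot V x * J s None x).
  have [J1 J2 J3 J4] := vJ s.
  apply: le_trans (HL _ J1 J2) _; rewrite lerD2r.
  apply: (Hw (J s None) (fun i => J s (Some i))) => // i.
  by apply: prod_weak_slab => //; exact: real_weak_prod.
have m_le : mform J J <= e * (gform J J + vform V J J) + coefsum N w J.
  rewrite coefsumE /gform big_split/= /vform /mform.
  by have := part_le false; have := part_le true; rewrite /ipn; lra.
have low := eform_lower vJ.
have Q0 := Qform_ge0 vJ; have S0 := coefsum_ge0 N w J.
have g0 := gform_ge0 J; have v0 := vform_ge0 V J; have m0 := mform_ge0 J.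
have gv : gform J J + vform V J J <= c1 * (Qform J J + c2 * mform J J).
  rewrite /c1 mulrAC ler_pdivlMr//.
  have : (1 - th) * (2^-1 * gform J J + vform V J J) <= Qform J J + c2 * mform J J.
    have : lam * mform J J <= `|lam| * mform J J by rewrite ler_wpM2r// ler_norm.
    by rewrite /Qform /c2; move: low; lra.
  have : 0 <= (1 - th) * vform V J J by rewrite mulr_ge0// ltW.
  by lra.
move: m_le gv Q0 S0 m0; rewrite /jnorm; clear low g0 v0 part_le Hw HL.
move: (coefsum N w J) (Qform J J) (gform J J + vform V J J) (mform J J) => S Q G m.
move=> m_le gv Q0 S0 m0.
have h1 : m <= 2 * e * c1 * Q + 2 * S.
  have a : e * G <= e * (c1 * (Q + c2 * m)) by rewrite ler_pM2l.
  have b : e * c1 * c2 * m <= 2^-1 * m by rewrite ler_wpM2r.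
  by lra.
have c1_ge0 := ltW c1_gt0; have c0 : 0 <= c1 * c2 + 1 by rewrite addr_ge0// mulr_ge0.
have h2 := ler_wpM2l c0 h1.
have h3 : 0 <= c1 * S by rewrite mulr_ge0// ltW.
have h4 : 0 <= (c1 * c2 + 1) * Q by rewrite mulr_ge0.
have e_ge0 := ltW e0; have a0 : 0 <= 2 * e * c1 by rewrite mulr_ge0// mulr_ge0.
have h5 : 0 <= (c1 * c2 + 1) * (2 * e * c1) * S by rewrite mulr_ge0// mulr_ge0.
by lra.
Qed.

Lemma Qform_parallelogram J K : valid J -> valid K ->
  Qform (jlin J (-1) K) (jlin J (-1) K) <= 2 * Qform J J + 2 * Qform K K.
Proof.
move=> vJ vK; have := Qform_ge0 (valid_lin 1 vJ vK).
by rewrite !(bil_quad _ bil_Qform vJ vK); lra.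
Qed.

Lemma Qform_le_jnorm : exists2 K : R, 0 <= K & forall J, valid J -> Qform J J <= K * jnorm J.
Proof.
exists (1 + th + th * C + `|lam|); first by rewrite !addr_ge0// mulr_ge0.
move=> J vJ; have up := eform_upper vJ.
have g0 := gform_ge0 J; have v0 := vform_ge0 V J; have m0 := mform_ge0 J.
have h1 : - (lam * mform J J) <= `|lam| * mform J J by rewrite -mulNr ler_wpM2r// -normrN ler_norm.
rewrite /Qform /jnorm; apply: le_trans (lerD up h1) _.
have p1 : 0 <= `|lam| by []. have p2 : 0 <= th * C by rewrite mulr_ge0.
move: g0 v0 m0 p1 p2 th_ge0; clear.
move: (gform J J) (vform V J J) (mform J J) `|lam| (th * C) => g v m l c g0 v0 m0 l0 c0 t0.
rewrite [leRHS]mulrDr -[leLHS]addrA -mulrDl; apply: lerD.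
  by apply: ler_pM; lra.
by apply: ler_wpM2r => //; lra.
Qed.

Lemma jlin_limit (L : nat -> @jet R d) (F : @jet R d) : (forall k, valid (L k)) -> valid F ->
  (forall s c, ipn mu (fun x => L k s c x - F s c x) @[k --> \oo] --> (0 : R)) ->
  (forall s, ipn mu (fun x => Vroot V x * L k s None x - Vroot V x * F s None x) @[k --> \oo] --> (0 : R)) ->
  jnorm (jlin (L k) (-1) F) @[k --> \oo] --> (0 : R).
Proof.
move=> vL vF H1 H2.
have E k s c : ip mu (jlin (L k) (-1) F s c) (jlin (L k) (-1) F s c) =
    ipn mu (fun x => L k s c x - F s c x).
  by congr ip; apply/funext => x; rewrite /jlin mulN1r.
have E2 k s : ip mu (fun x => Vroot V x * jlin (L k) (-1) F s None x) (fun x => Vroot V x * jlin (L k) (-1) F s None x) =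
    ipn mu (fun x => Vroot V x * L k s None x - Vroot V x * F s None x).
  by congr ip; apply/funext => x; rewrite /jlin; ring.
have z2 : (0 : R) = 0 + 0 by rewrite addr0.
rewrite [X in _ --> X](_ : _ = 0 + (0 + 0) + (0 + 0)); last by rewrite !addr0.
apply: cvgD; first apply: cvgD.
- have c0 : \sum_i (ipn mu (fun x => L k false (Some i) x - F false (Some i) x) +
      ipn mu (fun x => L k true (Some i) x - F true (Some i) x)) @[k --> \oo] --> \sum_(i < d) (0 + 0 : R).
    by apply: (@cvg_big R 'I_d +%R 0); [exact: add_continuous|move=> i _; apply: cvgD; exact: H1].
  have E0 : \sum_(i < d) (0 + 0 : R) = 0 by rewrite big1// => i _; rewrite addr0.
  rewrite E0 in c0; suff -> : (fun k => gform (jlin (L k) (-1) F) (jlin (L k) (-1) F)) = fun k =>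
      \sum_i (ipn mu (fun x => L k false (Some i) x - F false (Some i) x) +
      ipn mu (fun x => L k true (Some i) x - F true (Some i) x)) by exact: c0.
  by apply/funext => k; apply: eq_bigr => i _; rewrite !E.
- by rewrite /vform; under eq_fun do rewrite !E2; apply: cvgD; exact: H2.
- by rewrite /mform; under eq_fun do rewrite !E; apply: cvgD; exact: H1.
Qed.

(** Limits are taken in each component. Almost everywhere convergence
    identifies the limit of sqrt(V) f with sqrt(V) times the limit of f. *)
Lemma jet_complete (L : nat -> @jet R d) (B : R) : (forall k, valid (L k)) ->
  (forall k, jnorm (jlin (L k.+1) (-1) (L k)) <= B / 16 ^+ k) ->
  exists2 F, valid F & jnorm (jlin (L k) (-1) F) @[k --> \oo] --> (0 : R).
Proof.
move=> vL HB.
have E k s c : ip mu (jlin (L k.+1) (-1) (L k) s c) (jlin (L k.+1) (-1) (L k) s c) =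
    ipn mu (fun x => L k.+1 s c x - L k s c x).
  by congr ip; apply/funext => x; rewrite /jlin mulN1r.
have E2 k s : ip mu (fun x => Vroot V x * jlin (L k.+1) (-1) (L k) s None x) (fun x => Vroot V x * jlin (L k.+1) (-1) (L k) s None x) =
    ipn mu (fun x => Vroot V x * L k.+1 s None x - Vroot V x * L k s None x).
  by congr ip; apply/funext => x; rewrite /jlin; ring.
have sL k s c : sqint mu (L k s c) by have [J1 _ J3 _] := vL k s; case: c.
have svL k s : sqint mu (fun x => Vroot V x * L k s None x) by have [_ J2 _ _] := vL k s.
have rate s c k : ipn mu (fun x => L k.+1 s c x - L k s c x) <= B / 16 ^+ k.
  apply: le_trans (HB k); rewrite -E; set D := jlin _ _ _.
  have g0 := gform_ge0 D; have v0 := vform_ge0 V D; have m0 := mform_ge0 D.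
  have n0 s' c' := ip_ge0 mu (D s' c').
  suff : ip mu (D s c) (D s c) <= gform D D \/ ip mu (D s c) (D s c) <= mform D D.
    by rewrite /jnorm => -[|]; lra.
  case: c => [i|]; [left|right].
    rewrite /gform (bigD1 i)//=; set r := \sum_(_ | _) _.
    have : 0 <= r by apply: sumr_ge0 => j _; rewrite addr_ge0.
    by case: s; have := n0 false (Some i); have := n0 true (Some i); lra.
  by rewrite /mform; case: s; have := n0 false None; have := n0 true None; lra.
have rate2 s k : ipn mu (fun x => Vroot V x * L k.+1 s None x - Vroot V x * L k s None x) <= B / 16 ^+ k.
  apply: le_trans (HB k); rewrite -E2; set D := jlin _ _ _.
  have g0 := gform_ge0 D; have m0 := mform_ge0 D.
  have n0 s' := ip_ge0 mu (fun x => Vroot V x * D s' None x).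
  by rewrite /jnorm /vform; case: s; have := n0 false; have := n0 true; lra.
have lim s c := cid (sqint_complete (fun k => sL k s c) (rate s c)).
pose F : @jet R d := fun s c => sval (lim s c).
have FP s c : [/\ sqint mu (F s c), {ae mu, forall x, L k s c x @[k --> \oo] --> F s c x} &
    ipn mu (fun x => L k s c x - F s c x) @[k --> \oo] --> (0 : R)] := svalP (lim s c).
have FV s : sqint mu (fun x => Vroot V x * F s None x) /\
    ipn mu (fun x => Vroot V x * L k s None x - Vroot V x * F s None x) @[k --> \oo] --> (0 : R).
  have [G [sG aG cG]] := sqint_complete (fun k => svL k s) (rate2 s).
  have [sF aF cF] := FP s None.
  have GF : {ae mu, forall x, G x = Vroot V x * F s None x}.
    apply: filterS2 aG aF => x xG xF; apply: (cvg_unique _ xG) => //.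
    by apply: cvgMr.
  have mF : measurable_fun setT (fun x => Vroot V x * F s None x).
    by apply: measurable_funM; [exact: measurable_sV|case: sF].
  have sVF : sqint mu (fun x => Vroot V x * F s None x).
    split => //; apply: (@ae_integ _ _ _ mu (fun x => G x ^+ 2)).
    - exact: measurable_funX.
    - by apply: filterS GF => x ->.
    - by case: sG.
  split => //; apply: cvg_trans cG; apply: near_eq_cvg; apply: nearW => k.
  have GF' : {ae mu, forall x, Vroot V x * L k s None x - G x = Vroot V x * L k s None x - Vroot V x * F s None x}.
    by apply: filterS GF => x ->.
  by apply: ae_ip => //; exact: sqintB.
have vF : valid F.
  move=> s; have [sF _ cF] := FP s None; have [sVF _] := FV s; split => //.
    by move=> i; have [] := FP s (Some i).
  move=> i; have [sFi _ cFi] := FP s (Some i).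
  apply: (real_weak_lim (u_ := fun k => L k s None) (g_ := fun k => L k s (Some i))) => // k.
  by have [_ _ _ W] := vL k s.
exists F => //; apply: jlin_limit => //.
- by move=> s c; have [] := FP s c.
- by move=> s; have [] := FV s.
Qed.

(** Being close to p infinitely often is all that is needed to select a
    rapidly convergent sequence. *)
Lemma bounded_cluster M (c : nat -> 'rV[R]_M) (B : R) : (forall n i, `|c n 0 i| <= B) ->
  exists p : 'rV[R]_M, forall n (e : R), 0 < e -> exists2 k, (n <= k)%N & forall i, `|c k 0 i - p 0 i| < e.
Proof.
move=> cB; pose A := [set v : 'rV[R]_M | forall i, (`[- B, B]%classic : set R) (v ord0 i)].
have cA : compact A by apply: (@rV_compact R M (fun=> `[- B, B]%classic)) => i; exact: segment_compact.
have FA : (c @ \oo) A by exists 0%N => // n _ i; rewrite /= in_itv/= -ler_norml.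
have [p [_ clp]] := cA _ _ FA; exists p => n e e0.
have Fn : (c @ \oo) [set c k | k in [set k | (n <= k)%N]].
  by exists n => // k /= nk; exists k.
have [_ [[k nk <-] bk]] := clp _ _ Fn (nbhsx_ballx p e e0).
exists k => // i; rewrite distrC; move: bk; rewrite -ball_normE /=; apply: le_lt_trans.
by have := coord_le_norm (p - c k) i; rewrite !mxE.
Qed.

(** Otherwise there are unit vectors with Q at most 16^-n, all at distance at
    least e from the eigenspace. Select vectors whose coefficients are 4^-k
    close to a cluster point: by [finite_rank] and the parallelogram
    inequality their jets converge at rate 16^-k, and Q vanishes at the limit,
    which is therefore in the eigenspace. *)
Lemma near_minimizer_near_E0 (e : R) : 0 < e -> exists2 del : R, 0 < del & forall u, Xspace V u -> L2norm u = 1 ->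
  energy hd V Omega u - lam <= del ->
  exists2 v, E0 hd V Omega v & Xnorm V (fun x => u x - v x) < e.
Proof.
move=> e0; apply: contrapT => H.
have q0 n : 0 < 16^-1 ^+ n :> R by rewrite exprn_gt0.
have /choice[u Hu] : forall n : nat, exists u, [/\ Xspace V u, L2norm u = 1,
    energy hd V Omega u - lam <= 16^-1 ^+ n &
    forall v, E0 hd V Omega v -> e <= Xnorm V (fun x => u x - v x)].
  move=> n; apply: contrapT => Hn; apply: H; exists (16^-1 ^+ n) => // u Xu u1 uq.
  apply: contrapT => Hv; apply: Hn; exists u; split => // v Ev.
  by rewrite leNgt; apply/negP => lt; apply: Hv; exists v.
have [N [w [K [K0 sw HK]]]] := finite_rank.
pose U n := jet_of (u n).
have vU n : valid (U n) by have [Xu _ _ _] := Hu n; exact: Xspace_valid.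
have mU n : mform (U n) (U n) = 1.
  by have [Xu u1 _ _] := Hu n; rewrite -(L2norm_sqrE V_ge0 mV)// u1 expr1n.
have QU n : Qform (U n) (U n) <= 16^-1 ^+ n.
  have [Xu u1 uq _] := Hu n.
  by rewrite /Qform mU mulr1 -(energyE V_ge0 mV gam_gt0 HV).
pose cf n : 'rV[R]_(N.*2) := \row_k ip mu (U n (odd k) None) (w k./2).
(* Cauchy-Schwarz bounds the squared coefficients of unit vectors by the
    squared norms of the w k; adding 1 makes the sum smaller than its square.
    *)
pose B := 1 + \sum_(0 <= k < N) ipn mu (w k).
have cfB n k : `|cf n 0 k| <= B.
  rewrite mxE; set s := odd _; set a := ip _ _ _.
  have kN : (k./2 < N)%N by rewrite ltn_half_double.
  have w0 j : 0 <= ipn mu (w j) by exact: ip_ge0.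
  have wB : ipn mu (w k./2) <= \sum_(0 <= k < N) ipn mu (w k).
    rewrite big_mkord (bigD1 (Ordinal kN))//= lerDl; apply: sumr_ge0 => j _; exact: w0.
  have B1 : 1 <= B by rewrite lerDl (le_trans (w0 _) wB).
  have [J1 _ _ _] := vU n s.
  have a2 : a ^+ 2 <= B ^+ 2.
    apply: (le_trans (cauchy_schwarz_ip J1 (sw _))).
    apply: (@le_trans _ _ (1 * B)); last by rewrite mul1r expr2 ler_peMl// (le_trans ler01).
    apply: ler_pM => //; [exact: ip_ge0|exact: ip_ge0| |].
      by rewrite -(mU n) /mform; case: (s); rewrite ?lerDl ?lerDr ip_ge0.
    by rewrite /B (le_trans wB)// lerDr.
  by rewrite -(@ler_pXn2r _ 2) ?nnegrE ?real_normK ?num_real// (le_trans ler01).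
have [pt Hpt] := bounded_cluster cfB.
have e4 k : 0 < 4^-1 ^+ k :> R by rewrite exprn_gt0.
have /choice[nk Hnk] : forall k : nat, exists n, (k <= n)%N /\ forall i, `|cf n 0 i - pt 0 i| < 4^-1 ^+ k.
  by move=> k; have [n kn Hn] := Hpt k _ (e4 k); exists n.
pose L k := U (nk k).
have vL k : valid (L k) by exact: vU.
have QL k : Qform (L k) (L k) <= 16^-1 ^+ k.
  apply: (le_trans (QU _)); apply: ler_wiXn2l; [lra|lra|by have [] := Hnk k].
have rate k : jnorm (jlin (L k.+1) (-1) (L k)) <= K * (4 + 4 * (N.*2)%:R) / 16 ^+ k.
  apply: (le_trans (HK _ (valid_lin (-1) (vL k.+1) (vL k)))).
  rewrite -mulrA; apply: ler_wpM2l => //; rewrite mulrDl -exprVn; apply: lerD.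
    apply: (le_trans (Qform_parallelogram (vL k.+1) (vL k))).
    have h1 := QL k; have h2 := QL k.+1.
    have : 16^-1 ^+ k.+1 <= 16^-1 ^+ k :> R by apply: ler_wiXn2l; [lra|lra|exact: leqnSn].
    by lra.
  rewrite /coefsum big_mkord; apply: (@le_trans _ _ (\sum_(i < N.*2) 4 * 16^-1 ^+ k)); last first.
    by rewrite sumr_const card_ord -[leLHS]mulr_natr mulrAC.
  apply: ler_sum => i _.
  have -> : ip mu (jlin (L k.+1) (-1) (L k) (odd i) None) (w i./2) =
      cf (nk k.+1) 0 i - cf (nk k) 0 i.
    have [sJ _ _ _] := vL k.+1 (odd i); have [sK _ _ _] := vL k (odd i).
    rewrite !mxE -ipBl//.
    by congr ip; apply/funext => x; rewrite /jlin mulN1r.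
  have h1 := (Hnk k).2 i; have h2 := (Hnk k.+1).2 i.
  have h3 : 4^-1 ^+ k.+1 <= 4^-1 ^+ k :> R by apply: ler_wiXn2l; [lra|lra|exact: leqnSn].
  rewrite (_ : 16^-1 = 4^-1 * 4^-1 :> R); last by field.
  rewrite exprMn; have := e4 k; move: h1 h2 h3.
  set a := cf _ _ _; set b := cf _ _ _; set q' := 4^-1 ^+ k.+1; set q := 4^-1 ^+ k.
  clearbody a b q' q; rewrite !ltr_norml => /andP[? ?] /andP[? ?] ? ?.
  have q0' : 0 <= 2 * q by lra.
  have : `|b - a| <= 2 * q by rewrite ler_norml; apply/andP; split; lra.
  move=> ab; have : `|b - a| ^+ 2 <= (2 * q) ^+ 2 by rewrite ler_pXn2r// nnegrE.
  by rewrite real_normK ?num_real// exprMn; lra.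
have [F vF cF] := jet_complete vL rate.
have QF : Qform F F = 0.
  have [K3 K30 HK3] := Qform_le_jnorm.
  have le k : Qform F F <= 2 * 16^-1 ^+ k + 2 * K3 * jnorm (jlin (L k) (-1) F).
    set D := jlin (L k) (-1) F; have vD : valid D by exact: valid_lin.
    have -> : F = jlin (L k) (-1) D.
      by apply/funext => s; apply/funext => c; apply/funext => x; rewrite /D /jlin; ring.
    apply: (le_trans (Qform_parallelogram (vL k) vD)).
    by have := HK3 _ vD; have := QL k; lra.
  have c0 : 2 * 16^-1 ^+ k + 2 * K3 * jnorm (jlin (L k) (-1) F) @[k --> \oo] --> (2 * 0 + 2 * K3 * 0 : R).
    apply: cvgD; last by apply: cvgMr.
    by apply: cvgMr; apply: cvg_expr; rewrite ger0_norm; lra.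
  rewrite !mulr0 addr0 in c0.
  apply/eqP; rewrite eq_le Qform_ge0// andbT -(cvg_lim (@Rhausdorff R) c0); apply: limr_ge.
    by apply/cvg_ex; eexists; exact: c0.
  by apply: nearW.
have [XF mF _ eF] := valid_norms V_ge0 mV gam_gt0 HV Omega vF.
have EF : E0 hd V Omega (toC F).
  by apply: E0_intro => //; rewrite mF eF; apply/eqP; rewrite -subr_eq0 -/(Qform F F) QF.
have far k : e ^+ 2 <= jnorm (jlin (L k) (-1) F).
  have [_ _ _ Hv] := Hu (nk k); have := Hv _ EF.
  have -> : (fun x => u (nk k) x - toC F x) = toC (jlin (L k) (-1) F).
    apply/funext => x; apply: part_inj => s; rewrite partD partN.
    by case: s; rewrite /= /jlin mulN1r.
  have [_ _ -> _] := valid_norms V_ge0 mV gam_gt0 HV Omega (valid_lin (-1) (vL k) vF).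
  rewrite -/(jnorm _) -(@ler_pXn2r _ 2) ?nnegrE ?sqrtr_ge0 ?(ltW e0)//.
  by rewrite sqr_sqrtr// jnorm_ge0.
have : e ^+ 2 <= 0.
  rewrite -(cvg_lim (@Rhausdorff R) cF); apply: limr_ge.
    by apply/cvg_ex; eexists; exact: cF.
  by apply: nearW.
by rewrite leNgt exprn_gt0.
Qed.

End near_minimizer_near_E0.

(** * Ground states at the bottom of the spectrum *)

Section final.
Context {R : realType} {d : nat}.
Local Notation T := ('rV[R]_d).
Local Notation mu := (@lebesgue_rV R d).
Variables (hd : (2 <= d)%N) (V : T -> R).
Hypothesis V_ge0 : forall x, 0 <= V x.
Hypothesis mV : measurable_fun setT V.

(** Some gam > Omega is admissible in the supremum, so V exceeds the harmonic
    potential outside a ball; inside the ball that potential is bounded. *)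
Lemma coercive_below_Omega_max Omega : 0 < Omega -> (Omega%:E < Omega_max hd V)%E ->
  exists gam C : R, [/\ Omega < gam, 0 <= C &
    forall x : T, gam ^+ 2 / 2 * (x 0 (axis1 hd) ^+ 2 + x 0 (axis2 hd) ^+ 2) <= V x + C].
Proof.
move=> O0 /ereal_sup_gt[_ [gam [g0 Hg] <-]]; rewrite lte_fin => Og.
have [r Hr] := Hg 0; exists gam, (gam ^+ 2 * `|r| ^+ 2); split => //.
  by rewrite mulr_ge0// sqr_ge0.
move=> x; have [xr|rx] := ltP r `|x|.
  have := Hr x xr; rewrite subr_gt0 => /ltW/le_trans; apply.
  by rewrite lerDl mulr_ge0// sqr_ge0.
have sq i : x 0 i ^+ 2 <= `|r| ^+ 2.
  rewrite -[x 0 i ^+ 2]real_normK ?num_real// lerXn2r ?nnegrE//.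
  by rewrite (le_trans (coord_le_norm x i))// (le_trans rx)// ler_norm.
have := V_ge0 x; have := ler_wpM2l (sqr_ge0 gam) (lerD (sq (axis1 hd)) (sq (axis2 hd))).
by lra.
Qed.

Definition jzero : @jet R d := fun _ _ _ => 0.

Lemma valid_jzero : valid V jzero.
Proof.
move=> s; split.
- exact: sqint0.
- by apply: (@sqint_ext _ _ _ _ (fun=> 0)) (sqint0 _) => x; rewrite mulr0.
- by move=> i; exact: sqint0.
- by move=> i eta te; rewrite /jzero !(ipC _ _ (fun=> 0)) !ip0l oppr0.
Qed.

Lemma bil_scale B K t : jbilinear V B -> valid V K ->
  B (jlin jzero t K) (jlin jzero t K) = t ^+ 2 * B K K.
Proof.
move=> bB vK; have v0 := valid_jzero.
have j0 : jlin jzero 1 jzero = jzero.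
  by apply/funext => s; apply/funext => c; apply/funext => x; rewrite /jlin mulr0 addr0.
have z L : valid V L -> B jzero L = 0 /\ B L jzero = 0.
  by move=> vL; have := bB _ _ _ 1 v0 v0 vL; rewrite !j0 !mul1r => -[]; lra.
rewrite (bil_quad t bB v0 vK).
by rewrite (z _ v0).1 (z _ vK).1 (z _ vK).2; ring.
Qed.

Variables (gam C th Omega : R).
Hypothesis gam_gt0 : 0 < gam.
Hypothesis C_ge0 : 0 <= C.
Hypothesis HV : forall x : T, gam ^+ 2 / 2 * (x 0 (axis1 hd) ^+ 2 + x 0 (axis2 hd) ^+ 2) <= V x + C.
Hypothesis th_ge0 : 0 <= th.
Hypothesis th_lt1 : th < 1.
Hypothesis OmegaE : Omega = th * gam.
Local Notation lam := (lambda0 hd V Omega).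

Lemma scale_norms u t : Xspace V u -> [/\ Xspace V (fun x => t%:C * u x),
  L2norm (fun x => t%:C * u x) ^+ 2 = t ^+ 2 * L2norm u ^+ 2,
  Xnorm V (fun x => t%:C * u x) ^+ 2 = t ^+ 2 * Xnorm V u ^+ 2 &
  energy hd V Omega (fun x => t%:C * u x) = t ^+ 2 * energy hd V Omega u].
Proof.
move=> Xu; have vu := Xspace_valid V_ge0 mV Xu; set J := jlin jzero t (jet_of u).
have vJ : valid V J by apply: valid_lin => //; exact: valid_jzero.
have -> : (fun x => t%:C * u x) = toC J.
  apply/funext => x; apply: part_inj => s; rewrite partZ /toC /J /jlin /jet_of.
  by case: s; rewrite /= add0r.
have [XJ mJ nJ eJ] := valid_norms V_ge0 mV gam_gt0 HV Omega vJ.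
have nn w : 0 <= gform w w + vform V w w + mform w w :> R.
  by apply: addr_ge0; [apply: addr_ge0; [exact: gform_ge0|exact: vform_ge0]|exact: mform_ge0].
rewrite mJ nJ eJ (L2norm_sqrE V_ge0 mV)// (XnormE V_ge0 mV)// (energyE V_ge0 mV gam_gt0 HV)//.
split => //.
- by rewrite /J (bil_scale t (@bil_mform R d V) vu).
- rewrite !sqr_sqrtr//.
  rewrite /J (bil_scale t (@bil_gform R d V) vu) (bil_scale t (@bil_vform R d V) vu) (bil_scale t (@bil_mform R d V) vu).
  by ring.
- by rewrite /J (bil_scale t (bil_eform gam_gt0 V_ge0 HV Omega) vu).
Qed.

Lemma zero_norms : [/\ Xspace V (fun=> 0), L2norm (fun _ : T => 0 : R[i]) = 0,
  Xnorm V (fun=> 0) = 0 & energy hd V Omega (fun=> 0) = 0].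
Proof.
have [X0 _ _ _] := valid_norms V_ge0 mV gam_gt0 HV Omega valid_jzero.
have := scale_norms 0 X0; rewrite expr0n !mul0r.
have -> : (fun x : T => (0 : R)%:C * toC jzero x) = fun=> 0.
  by apply/funext => x; rewrite mul0r.
by case=> X /eqP + /eqP + ->; rewrite !sqrf_eq0 => /eqP -> /eqP ->.
Qed.

Lemma action_zero p omega : 0 < p -> action hd V Omega omega p (fun=> 0) = 0%E.
Proof.
move=> p0; have [X0 l0 _ e0] := zero_norms.
rewrite /action l0 (_ : (\int[mu]_x _)%E = 0%E); last first.
  apply: integral0_eq => x _; rewrite normc0 powR0//.
  by rewrite gt_eqF// addr_gt0.
by rewrite mule0 adde0 -EFinB -EFinD expr0n mulr0 addr0; congr EFin; rewrite -[RHS]e0.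
Qed.

(** The power term, finite or not, only increases the action. *)
Lemma energy_le_of_action p omega u : 0 < p -> (action hd V Omega omega p u <= 0)%E ->
  energy hd V Omega u + omega * L2norm u ^+ 2 <= 0.
Proof.
move=> p0; rewrite /action /energy => h; rewrite -lee_fin; apply: le_trans h.
rewrite EFinD EFinB; apply: leeD => //; apply: leeD => //.
rewrite leeDl//; apply: mule_ge0; first by rewrite lee_fin divr_ge0// addr_ge0// ltW.
by apply: integral_ge0 => x _; rewrite lee_fin powR_ge0.
Qed.

Lemma dist_E0_le u v : E0 hd V Omega v ->
  0 <= dist_E0 hd V Omega u <= Xnorm V (fun x => u x - v x).
Proof.
move=> Ev; have lb : lbound [set Xnorm V (fun x => u x - w x) | w in E0 hd V Omega] 0.
  by move=> _ [w _ <-]; exact: sqrtr_ge0.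
apply/andP; split.
  by apply: lb_le_inf => //; exists (Xnorm V (fun x => u x - v x)); exists v.
by apply: ge_inf; [exists 0|exists v].
Qed.

Lemma E0_zero : E0 hd V Omega (fun=> 0).
Proof.
have [X0 l0 _ e0] := zero_norms.
apply: (E0_intro V_ge0 mV gam_gt0 HV th_ge0 th_lt1 OmegaE) => //.
by rewrite l0 e0 expr0n mulr0.
Qed.

(** For the normalised ground state, Q is at most - omega - lambda0, by
    [energy_le_of_action]. When the L2 norm vanishes, normalisation gives 0,
    which lies in the eigenspace. *)
Lemma ground_state_distance p (e : R) : tends_to_pinfty V -> 1 < p -> 0 < e ->
  exists2 del : R, 0 < del & forall omega u, - lam - del < omega ->
    action_ground_states hd V Omega omega p u ->
    `|dist_E0 hd V Omega (normalize u)| < e.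
Proof.
move=> Vinf p1 e0; have p0 : 0 < p := lt_trans ltr01 p1.
have [del d0 Hd] := near_minimizer_near_E0 V_ge0 mV gam_gt0 C_ge0 HV th_ge0 th_lt1 OmegaE Vinf e0.
exists del => // omega u om [Xu min_u].
have [X0 l0 n0 _] := zero_norms.
have := min_u _ X0; rewrite action_zero// => /(energy_le_of_action p0) en.
suff [v Ev vlt] : exists2 v, E0 hd V Omega v & Xnorm V (fun x => normalize u x - v x) < e.
  have /andP[h1 h2] := dist_E0_le (normalize u) Ev.
  by rewrite ger0_norm// (le_lt_trans h2).
have [u0|u0] := eqVneq (L2norm u) 0.
  exists (fun=> 0); first exact: E0_zero.
  rewrite (_ : (fun x => _) = fun=> 0) ?n0//.
  by apply/funext => x; rewrite /normalize u0 invr0 mul0r subr0.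
have [Xn mn _ en'] := scale_norms (L2norm u)^-1 Xu.
have ln : L2norm (normalize u) = 1.
  apply/eqP; rewrite -(@eqrXn2 _ 2) ?sqrtr_ge0// expr1n mn -exprMn mulVf//.
  by rewrite expr1n.
apply: Hd => //; rewrite en' exprVn.
have m0 : 0 < L2norm u ^+ 2 by rewrite exprn_gt0// lt_def u0 sqrtr_ge0.
rewrite lerBlDr mulrC ler_pdivrMr//.
have : - omega * L2norm u ^+ 2 <= (del + lam) * L2norm u ^+ 2.
  by rewrite ler_pM2r// -lerN2 opprK opprD addrC ltW.
by apply: le_trans; rewrite mulNr -[leRHS]add0r lerBrDr.
Qed.

End final.

Theorem theorem4p5 (R : realType) (d : nat) (hd : (2 <= d)%N)
  (p : R) (hp1 : 1 < p)
  (hp : (3 <= d)%N -> p < (d%:R + 2) / (d%:R - 2))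
  (V : 'rV[R]_d -> R) (mV : measurable_fun setT V)
  (V_ge0 : forall x, 0 <= V x) (V_pinfty : tends_to_pinfty V)
  (Omega_max_gt0 : (0 < Omega_max hd V)%E)
  (Omega : R) (Omega_gt0 : 0 < Omega)
  (Omega_lt_max : (Omega%:E < Omega_max hd V)%E)
  (phi : R -> 'rV[R]_d -> R[i])
  (phi_gs : forall omega : R, omega < - lambda0 hd V Omega ->
    action_ground_states hd V Omega omega p (phi omega)) :
  dist_E0 hd V Omega (normalize (phi omega))
    @[omega --> (- lambda0 hd V Omega)^'-] --> (0 : R).
Proof.
have [gam [C [Og C0 HV]]] := coercive_below_Omega_max V_ge0 Omega_gt0 Omega_lt_max.
have gam0 : 0 < gam := lt_trans Omega_gt0 Og.
have th0 : 0 <= Omega / gam by rewrite divr_ge0// ltW.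
have th1 : Omega / gam < 1 by rewrite ltr_pdivrMr// mul1r.
have OE : Omega = Omega / gam * gam by rewrite divfK// gt_eqF.
apply/cvgrPdist_lt => e e0.
have [del d0 Hd] := ground_state_distance V_ge0 mV gam0 C0 HV th0 th1 OE V_pinfty hp1 e0.
near=> omega.
rewrite sub0r normrN; apply: (Hd omega); last apply: phi_gs.
- by near: omega; apply: nbhs_left_gt; rewrite gtrBl.
- by near: omega; exact: nbhs_left_lt.
Unshelve. all: by end_near.
Qed.
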